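(* The singular type and the singular defect are biholomorphic invariants of the germ of a CR-regular set. That is: let $M_p$ and $M'_{p'}$ be (locally connected, irreducible) germs of CR-regular sets in $\mathbb{C}^r$ at singular points $p\in\Sigma$ and $p'\in\Sigma'$ respectively, and suppose there is a biholomorphic map $F$ from a neighborhood of $p$ in $\mathbb{C}^r$ onto a neighborhood of $p'$ in $\mathbb{C}^r$ with $F(p)=p'$ which maps the germ $M_p$ onto the germ $M'_{p'}$. Then for each of the three ways $j\in\{1,2,3\}$ of defining the tangent cone, the singular types coincide, $$(\mathfrak{m}^1_j(p),\mathfrak{m}^2_j(p)) \text{ for } M_p \;=\; (\mathfrak{m}^1_j(p'),\mathfrak{m}^2_j(p')) \text{ for } M'_{p'},$$ and the singular defects coincide, $$(d^1_j(p),d^2_j(p)) \text{ for } M_p \;=\; (d^1_j(p'),d^2_j(p')) \text{ for } M'_{p'}.$$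
   Context: **CR-regular sets.** Let $z=(z_1,\dots,z_r)$ be coordinates in $\mathbb{C}^r$, $r=n+k$. A CR-regular set is a set $M$, defined in some open set $U\subset\mathbb{C}^r$ as the set of common zeros of real-analytic functions, such that outside some proper real-analytic subset $\Sigma\subset M$ it is a generic CR manifold of fixed CR type $(n,k)$: a real-analytic submanifold of real codimension $k$ whose complex tangent space $T_{p'}M\cap iT_{p'}M$ has constant complex dimension $n$. The points at which $M$ is such a CR manifold are called CR-regular, their set is $\mathrm{reg}\,M$, and $\Sigma=M\setminus \mathrm{reg}\,M$ is the set of singular points: these are either RC-singular points (points at which $M$ is smooth but the dimension of the complex tangent space is greater than $n$) or singular points of the smooth structure of $M$. Standing conventions: $\mathrm{reg}\,M$ is dense in $M$; germs are irreducible, and $M$ is connected in some neighborhood of the singular point under consideration. All constructions are made for a representative $M$ of the germ $M_p$. **Distributions at regular points.** Vectors are elements of the complexified tangent space of $\mathbb{C}^r$, i.e. of the form $\sum_i a_i\frac{\partial}{\partial z_i}+\sum_i b_i\frac{\partial}{\partial\bar z_i}$ with $a_i,b_i\in\mathbb{C}$. On $\mathrm{reg}\,M$ let $D_1=T^cM\oplus\overline{T^c}M$ be the distribution generated by the vector fields of type $(1,0)$ and of type $(0,1)$ tangent to $M$, and define inductively $D_{\nu+1}=[D_\nu,D_1]+D_\nu$, where $[\cdot,\cdot]$ is the commutator of vector fields. For $p'\in\mathrm{reg}\,M$, $D_\nu(p')\subset\mathbb{C}T_{p'}M$ denotes the complex linear space of values at $p'$ of the (local) vector fields in $D_\nu$.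 **Limit values at singular points.** Let $\mathcal{V}$ be a distribution on $\mathrm{reg}\,M$ (here $\mathcal V=D_\nu$) and let $p\in\Sigma$. (1) $v\in\mathcal{C}_1(M,\mathcal{V},p)$ if there is a (real-)analytic vector field $V$ (with complex-valued coefficients) in some neighborhood $U'$ of $p$ with $V(p')\in\mathcal{V}(p')$ for every $p'\in\mathrm{reg}\,M\cap U'$ and $V(p)=v$. (2) $v\in\mathcal{C}_2(M,\mathcal{V},p)$ if for every $\varepsilon>0$ there is $\delta>0$ such that for every $p'\in\mathrm{reg}\,M$ with $|p'-p|<\delta$ there is $v'\in\mathcal{V}(p')$ with $\|v'-v\|<\varepsilon$. (3) $v\in\mathcal{C}_3(M,\mathcal{V},p)$ if there are sequences $p^i\in\mathrm{reg}\,M$ and $v^i\in\mathcal{V}(p^i)$ with $p^i\to p$ and $v^i\to v$. Fix $j\in\{1,2,3\}$ (the index $j$ is suppressed below). For $p\in\Sigma$ put $D_\nu(p)=\mathcal{C}_j(M,D_\nu,p)$ and let $\langle\cdot\rangle$ denote the linear span over $\mathbb{C}$. **Zariski tangent spaces.** Let $\rho_s$ be real-analytic functions generating the ideal of germs at $p$ of real-analytic functions vanishing on $M_p$. Then - $\mathbb{C}T_pM_p$ is the space of all $\sum_i a_i\frac{\partial}{\partial z_i}+\sum_i b_i\frac{\partial}{\partial\bar z_i}$, $a_i,b_i\in\mathbb{C}$, with $\sum_i\big(a_i\frac{\partial\rho_s}{\partial z_i}(p)+b_i\frac{\partial\rho_s}{\partial\bar z_i}(p)\big)=0$ for all $s$;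 - $T^c_pM_p$ is the space of all $\sum_i a_i\frac{\partial}{\partial z_i}$ with $\sum_i a_i\frac{\partial\rho_s}{\partial z_i}(p)=0$ for all $s$; - $\overline{T^c_p}M_p$ is the space of all $\sum_i a_i\frac{\partial}{\partial\bar z_i}$ with $\sum_i a_i\frac{\partial\rho_s}{\partial\bar z_i}(p)=0$ for all $s$. **The two chains.** For $p\in\Sigma$ put $$D^1_\nu(p)=\langle D_\nu(p)\rangle,\qquad \mathcal{D}^1(p)=\bigcup_{\nu\ge1}D^1_\nu(p),\qquad E^1=\mathbb{C}T_pM_p,$$ $$D^2_\nu(p)=\langle D_\nu(p)\rangle\cap\big(T^c_pM_p\oplus\overline{T^c_p}M_p\big),\qquad \mathcal{D}^2(p)=\bigcup_{\nu\ge1}D^2_\nu(p),\qquad E^2=T^c_pM_p\oplus\overline{T^c_p}M_p.$$ Both chains are nested increasing chains of finite-dimensional complex spaces and stabilize. **Singular type and singular defect.** Fix $q\in\{1,2\}$ and let $d_\nu=\dim_{\mathbb{C}}D^q_\nu(p)$. Let $m_1<\dots<m_l$ be the list of the jump indices, consisting of all $\nu\ge2$ with $d_\nu>d_{\nu-1}$, together with $\nu=1$ if $d_1>2n$. To each $m_i$ is attached the multiplicity $k_i$, the magnitude of the jump: $k_i=d_{m_i}-d_{m_i-1}$ if $m_i\ge2$, and $k_1=d_1-2n$ if $m_1=1$. The singular defect of the $q$-th kind is $d^q(p)=\dim_{\mathbb{C}}E^q-\dim_{\mathbb{C}}\mathcal{D}^q(p)$. The germ is of finite singular type of the $q$-th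 kind if $\mathcal{D}^q(p)=E^q$, and of infinite singular type of the $q$-th kind otherwise. The singular type of the $q$-th kind is $$\mathfrak{m}^q(p)=((m_1,k_1),\dots,(m_l,k_l))\ \text{ in the finite case},\qquad \mathfrak{m}^q(p)=((m_1,k_1),\dots,(m_l,k_l),(\infty,d^q(p)))\ \text{ in the infinite case}.$$ The pair $(\mathfrak{m}^1,\mathfrak{m}^2)$ is the singular type and the pair $(d^1,d^2)$ is the singular defect; with the dependence on $j$ restored they are written $\mathfrak{m}^q_j$, $d^q_j$. *)

(* Defs.v *)
(* MathComp / MathComp-Analysis; complex numbers are R[i] over R : realType. *)
From HB Require Import structures.
From mathcomp Require Import all_boot all_order all_algebra.
From mathcomp Require Import all_classical all_reals all_analysis.
From mathcomp.real_closed Require Import complex.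

Set Implicit Arguments.
Unset Strict Implicit.
Unset Printing Implicit Defensive.

Import Order.TTheory GRing.Theory Num.Theory.
Import numFieldNormedType.Exports.

Local Open Scope classical_set_scope.
Local Open Scope ring_scope.
Local Open Scope complex_scope.

(* MathComp-Analysis gives the usual topology to numFieldType variables only,
   not to the concrete field R[i]; this is the same copy. *)
Set Warnings "-redundant-canonical-projection".
HB.instance Definition _ (R : realType) :=
  NormedModule.copy R[i] (R[i])^o.
Set Warnings "redundant-canonical-projection".

(* Sum of an absolutely convergent power series on a polydisc around a.  With
   K = R this is real-analyticity, with K = R[i] it is holomorphy.  The partial
   sums run over the multi-indices with all entries < N. *)
Definition analytic_at (K : numFieldType) (m : nat)
    (f : 'rV[K]_m -> K) (a : 'rV[K]_m) : Prop :=
  exists (c : {ffun 'I_m -> nat} -> K) (e B : K), [/\ 0 < e,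
    forall N : nat,
      \sum_(alpha : {ffun 'I_m -> 'I_N})
        `|c [ffun i => nat_of_ord (alpha i)]| * e ^+ (\sum_i alpha i)%N <= B &
    forall x : 'rV[K]_m, (forall i, `|x 0 i - a 0 i| < e) ->
      (fun N : nat => \sum_(alpha : {ffun 'I_m -> 'I_N})
          c [ffun i => nat_of_ord (alpha i)] *
          \prod_i (x 0 i - a 0 i) ^+ alpha i) @ \oo --> f x].

(* Real coordinates (x_1, ..., x_r, y_1, ..., y_r) of z_j = x_j + i y_j. *)
Definition real_coords (R : realType) (r : nat) (z : 'rV[R[i]]_r) :
    'rV[R]_(r + r) :=
  row_mx (map_mx (@complex.Re R) z) (map_mx (@complex.Im R) z).

Definition of_real_coords (R : realType) (r : nat) (t : 'rV[R]_(r + r)) :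
    'rV[R[i]]_r :=
  \row_j (t 0 (lshift r j) +i* t 0 (rshift r j)).

Definition real_analytic_at (R : realType) (r : nat)
    (f : 'rV[R[i]]_r -> R) (p : 'rV[R[i]]_r) : Prop :=
  analytic_at (f \o @of_real_coords R r) (real_coords p).

Definition cplx_real_analytic_at (R : realType) (r : nat)
    (f : 'rV[R[i]]_r -> R[i]) (p : 'rV[R[i]]_r) : Prop :=
  real_analytic_at (fun z => complex.Re (f z)) p /\
  real_analytic_at (fun z => complex.Im (f z)) p.

Definition holomorphic_at (R : realType) (r s : nat)
    (F : 'rV[R[i]]_r -> 'rV[R[i]]_s) (p : 'rV[R[i]]_r) : Prop :=
  forall j, analytic_at (fun z => F z 0 j) p.

Definition biholomorphic (R : realType) (r : nat)
    (W W' : set 'rV[R[i]]_r) (F : 'rV[R[i]]_r -> 'rV[R[i]]_r) : Prop :=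
  [/\ open W, open W', set_bij W W' F,
      forall z, W z -> holomorphic_at F z &
      exists G : 'rV[R[i]]_r -> 'rV[R[i]]_r,
        (forall z, W z -> G (F z) = z) /\
        (forall w, W' w -> holomorphic_at G w)].

Definition real_diff (R : realType) (r : nat)
    (f : 'rV[R[i]]_r -> R) (p v : 'rV[R[i]]_r) : R :=
  'D_(real_coords v) (f \o @of_real_coords R r) (real_coords p).

Definition real_partial (R : realType) (r : nat)
    (f : 'rV[R[i]]_r -> R) (j : 'I_(r + r)) (p : 'rV[R[i]]_r) : R :=
  'D_(delta_mx 0 j) (f \o @of_real_coords R r) (real_coords p).

Definition cplx_partial (R : realType) (r : nat)
    (f : 'rV[R[i]]_r -> R[i]) (j : 'I_(r + r)) (p : 'rV[R[i]]_r) : R[i] :=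
  real_partial (fun z => complex.Re (f z)) j p +i*
  real_partial (fun z => complex.Im (f z)) j p.

Definition d_dz (R : realType) (r : nat)
    (f : 'rV[R[i]]_r -> R[i]) (j : 'I_r) (p : 'rV[R[i]]_r) : R[i] :=
  (cplx_partial f (lshift r j) p - 'i%C * cplx_partial f (rshift r j) p) / 2.

Definition d_dzbar (R : realType) (r : nat)
    (f : 'rV[R[i]]_r -> R[i]) (j : 'I_r) (p : 'rV[R[i]]_r) : R[i] :=
  (cplx_partial f (lshift r j) p + 'i%C * cplx_partial f (rshift r j) p) / 2.

(* A complexified tangent vector sum_j a_j d/dz_j + sum_j b_j d/dzbar_j is the
   row (a_1, ..., a_r, b_1, ..., b_r); a vector field is a function with values
   in such rows, meaningful only where it is required to be analytic. *)
Definition vec_apply (R : realType) (r : nat) (w : 'rV[R[i]]_(r + r))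
    (f : 'rV[R[i]]_r -> R[i]) (p : 'rV[R[i]]_r) : R[i] :=
  \sum_(j < r) (w 0 (lshift r j) * d_dz f j p +
                w 0 (rshift r j) * d_dzbar f j p).

Definition analytic_field_at (R : realType) (r : nat)
    (V : 'rV[R[i]]_r -> 'rV[R[i]]_(r + r)) (p : 'rV[R[i]]_r) : Prop :=
  forall j, cplx_real_analytic_at (fun z => V z 0 j) p.

Definition commutator (R : realType) (r : nat)
    (X Y : 'rV[R[i]]_r -> 'rV[R[i]]_(r + r)) :
    'rV[R[i]]_r -> 'rV[R[i]]_(r + r) :=
  fun p => \row_j (vec_apply (X p) (fun z => Y z 0 j) p -
                   vec_apply (Y p) (fun z => X z 0 j) p).

Definition germ_ideal (R : realType) (r : nat)
    (M : set 'rV[R[i]]_r) (p : 'rV[R[i]]_r) : set ('rV[R[i]]_r -> R) :=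
  [set rho | real_analytic_at rho p /\ \forall z \near p, M z -> rho z = 0].

(* The Zariski tangent spaces use the whole ideal as its own generating system;
   the equations given by any other generating system are equivalent.  At points
   where M is a submanifold these are the usual tangent spaces. *)
Definition CT (R : realType) (r : nat)
    (M : set 'rV[R[i]]_r) (p : 'rV[R[i]]_r) : set 'rV[R[i]]_(r + r) :=
  [set w | forall rho, germ_ideal M p rho ->
             vec_apply w (fun z => (rho z)%:C) p = 0].

Definition Tc (R : realType) (r : nat)
    (M : set 'rV[R[i]]_r) (p : 'rV[R[i]]_r) : set 'rV[R[i]]_(r + r) :=
  [set row_mx a 0 | a in [set a : 'rV[R[i]]_r |
     forall rho, germ_ideal M p rho ->
       \sum_(j < r) a 0 j * d_dz (fun z => (rho z)%:C) j p = 0]].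

Definition Tcbar (R : realType) (r : nat)
    (M : set 'rV[R[i]]_r) (p : 'rV[R[i]]_r) : set 'rV[R[i]]_(r + r) :=
  [set row_mx 0 b | b in [set b : 'rV[R[i]]_r |
     forall rho, germ_ideal M p rho ->
       \sum_(j < r) b 0 j * d_dzbar (fun z => (rho z)%:C) j p = 0]].

Definition Tc_sum (R : realType) (r : nat)
    (M : set 'rV[R[i]]_r) (p : 'rV[R[i]]_r) : set 'rV[R[i]]_(r + r) :=
  [set u + v | u in Tc M p & v in Tcbar M p].

Definition real_tangent (R : realType) (r : nat)
    (M : set 'rV[R[i]]_r) (p : 'rV[R[i]]_r) : set 'rV[R[i]]_r :=
  [set v | forall rho, germ_ideal M p rho -> real_diff rho p v = 0].

Definition cplx_tangent (R : realType) (r : nat)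
    (M : set 'rV[R[i]]_r) (p : 'rV[R[i]]_r) : set 'rV[R[i]]_r :=
  real_tangent M p `&` [set 'i%C *: v | v in real_tangent M p].

Definition lin_span (K : fieldType) (vT : vectType K) (A : set vT) : set vT :=
  [set v | exists2 X : seq vT, (forall w, w \in X -> A w) & v \in <<X>>%VS].

(* Dimension of a set that is a linear subspace (0 if it is not one). *)
Definition cdim (K : fieldType) (vT : vectType K) (A : set vT) : nat :=
  \dim (xget 0%VS [set U : {vspace vT} | [set` U] = A]).

Definition zero_set (R : realType) (r : nat) (U A : set 'rV[R[i]]_r) : Prop :=
  exists S : set ('rV[R[i]]_r -> R),
    (forall rho z, S rho -> U z -> real_analytic_at rho z) /\
    A = [set z | U z /\ forall rho, S rho -> rho z = 0].

Definition analytic_subset (R : realType) (r : nat)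
    (U A : set 'rV[R[i]]_r) : Prop :=
  A `<=` U /\
  forall z, U z ->
    exists O : set 'rV[R[i]]_r,
      [/\ open_nbhs z O, O `<=` U & zero_set O (A `&` O)].

(* Points near which M is a real-analytic submanifold of real codimension k
   whose complex tangent spaces all have complex dimension n. *)
Definition reg (R : realType) (r : nat) (n k : nat)
    (M : set 'rV[R[i]]_r) : set 'rV[R[i]]_r :=
  [set p | M p /\
     (exists rho : 'I_k -> 'rV[R[i]]_r -> R,
        [/\ forall s, real_analytic_at (rho s) p,
            row_free (\matrix_(s < k, j < r + r) real_partial (rho s) j p) &
            \forall z \near p, M z <-> forall s, rho s z = 0]) /\
     (\forall z \near p, M z -> cdim (cplx_tangent M z) = n)].

Definition sing (R : realType) (r : nat) (n k : nat)
    (M : set 'rV[R[i]]_r) : set 'rV[R[i]]_r :=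
  M `\` reg n k M.

Definition CR_regular (R : realType) (r : nat) (n k : nat)
    (M : set 'rV[R[i]]_r) : Prop :=
  [/\ r = (n + k)%N,
      exists U : set 'rV[R[i]]_r,
        [/\ open U, zero_set U M &
            exists Sigma : set 'rV[R[i]]_r,
              [/\ analytic_subset U Sigma, Sigma `<` M &
                  M `\` Sigma `<=` reg n k M]] &
      M `<=` closure (reg n k M)].

Definition irreducible_germ (R : realType) (r : nat)
    (M : set 'rV[R[i]]_r) (p : 'rV[R[i]]_r) : Prop :=
  forall O A B : set 'rV[R[i]]_r,
    open_nbhs p O -> zero_set O A -> zero_set O B ->
    (\forall z \near p, M z <-> A z \/ B z) ->
    (\forall z \near p, M z <-> A z) \/ (\forall z \near p, M z <-> B z).

Definition CR_regular_sing_germ (R : realType) (r : nat) (n k : nat)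
    (M : set 'rV[R[i]]_r) (p : 'rV[R[i]]_r) : Prop :=
  [/\ CR_regular n k M, sing n k M p, irreducible_germ M p &
      exists2 W : set 'rV[R[i]]_r, open_nbhs p W & connected (M `&` W)].

Definition germ_onto (R : realType) (r : nat)
    (F : 'rV[R[i]]_r -> 'rV[R[i]]_r) (W M M' : set 'rV[R[i]]_r)
    (p : 'rV[R[i]]_r) : Prop :=
  exists O : set 'rV[R[i]]_r,
    [/\ open_nbhs p O, O `<=` W & F @` (M `&` O) = M' `&` F @` O].

Definition D1_germ (R : realType) (r : nat) (M : set 'rV[R[i]]_r)
    (p : 'rV[R[i]]_r) (V : 'rV[R[i]]_r -> 'rV[R[i]]_(r + r)) : Prop :=
  analytic_field_at V p /\ \forall z \near p, M z -> Tc_sum M z (V z).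

(* Germs at a regular point p of vector fields of the distribution D_nu
   (nu >= 1).  A vector field on M is given by an analytic field V on a
   neighbourhood of p in the ambient space, only its values on M being relevant:
   the commutator of fields tangent to M depends, along M, only on their
   restrictions to M.  [D_nu, D_1] consists of the finite sums of
   commutators. *)
Fixpoint D_germ (R : realType) (r : nat) (M : set 'rV[R[i]]_r)
    (p : 'rV[R[i]]_r) (nu : nat) (V : 'rV[R[i]]_r -> 'rV[R[i]]_(r + r))
    {struct nu} : Prop :=
  match nu with
  | 0 => False
  | 1 => D1_germ M p V
  | mu.+1 => analytic_field_at V p /\
      exists (m : nat) (X Y : 'I_m -> 'rV[R[i]]_r -> 'rV[R[i]]_(r + r))
             (Z : 'rV[R[i]]_r -> 'rV[R[i]]_(r + r)),
        [/\ forall i, D_germ M p mu (X i), forall i, D1_germ M p (Y i),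
            D_germ M p mu Z &
            \forall z \near p, M z ->
              V z = \sum_(i < m) commutator (X i) (Y i) z + Z z]
  end.

Definition D_reg (R : realType) (r : nat) (M : set 'rV[R[i]]_r)
    (nu : nat) (p : 'rV[R[i]]_r) : set 'rV[R[i]]_(r + r) :=
  [set v | exists2 V, D_germ M p nu V & V p = v].

Variant cone_kind := Cone1 | Cone2 | Cone3.

Definition cone (R : realType) (r : nat) (j : cone_kind)
    (regM : set 'rV[R[i]]_r) (D : 'rV[R[i]]_r -> set 'rV[R[i]]_(r + r))
    (p : 'rV[R[i]]_r) : set 'rV[R[i]]_(r + r) :=
  match j with
  | Cone1 => [set v |
      exists (U : set 'rV[R[i]]_r) (V : 'rV[R[i]]_r -> 'rV[R[i]]_(r + r)),
        [/\ open_nbhs p U, forall z, U z -> analytic_field_at V z,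
            forall z, regM z -> U z -> D z (V z) & V p = v]]
  | Cone2 => [set v |
      forall eps : R, 0 < eps -> exists2 delta : R, 0 < delta &
        forall z, regM z -> `|z - p| < delta%:C ->
          exists2 v', D z v' & `|v' - v| < eps%:C]
  | Cone3 => [set v |
      exists (z_ : nat -> 'rV[R[i]]_r) (v_ : nat -> 'rV[R[i]]_(r + r)),
        [/\ forall i, regM (z_ i) /\ D (z_ i) (v_ i),
            z_ @ \oo --> p & v_ @ \oo --> v]]
  end.

Definition D_sing (R : realType) (r : nat) (n k : nat) (M : set 'rV[R[i]]_r)
    (j : cone_kind) (nu : nat) (p : 'rV[R[i]]_r) : set 'rV[R[i]]_(r + r) :=
  cone j (reg n k M) (D_reg M nu) p.

Variant type_kind := Kind1 | Kind2.

Definition chain (R : realType) (r : nat) (n k : nat) (M : set 'rV[R[i]]_r)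
    (j : cone_kind) (q : type_kind) (nu : nat) (p : 'rV[R[i]]_r) :
    set 'rV[R[i]]_(r + r) :=
  match q with
  | Kind1 => lin_span (D_sing n k M j nu p)
  | Kind2 => lin_span (D_sing n k M j nu p) `&` Tc_sum M p
  end.

Definition chain_union (R : realType) (r : nat) (n k : nat)
    (M : set 'rV[R[i]]_r) (j : cone_kind) (q : type_kind) (p : 'rV[R[i]]_r) :
    set 'rV[R[i]]_(r + r) :=
  \bigcup_(nu in [set nu : nat | (1 <= nu)%N]) chain n k M j q nu p.

Definition ambient_space (R : realType) (r : nat) (M : set 'rV[R[i]]_r)
    (q : type_kind) (p : 'rV[R[i]]_r) : set 'rV[R[i]]_(r + r) :=
  match q with Kind1 => CT M p | Kind2 => Tc_sum M p end.

Definition sing_defect (R : realType) (r : nat) (n k : nat)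
    (M : set 'rV[R[i]]_r) (j : cone_kind) (q : type_kind)
    (p : 'rV[R[i]]_r) : nat :=
  (cdim (ambient_space M q p) - cdim (chain_union n k M j q p))%N.

Definition is_jump (n : nat) (d : nat -> nat) (nu : nat) : bool :=
  (2 <= nu)%N && (d nu.-1 < d nu)%N || (nu == 1)%N && (2 * n < d 1)%N.

Definition jump_size (n : nat) (d : nat -> nat) (nu : nat) : nat :=
  if (nu == 1)%N then (d 1 - 2 * n)%N else (d nu - d nu.-1)%N.

(* The increasing list of the jump indices (finitely many when d is
   nondecreasing and bounded). *)
Definition jump_list (n : nat) (d : nat -> nat) : seq nat :=
  xget [::] [set s | sorted ltn s /\ forall nu, (nu \in s) = is_jump n d nu].

(* The entry (None, d) stands for (infinity, d). *)
Definition sing_type (R : realType) (r : nat) (n k : nat)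
    (M : set 'rV[R[i]]_r) (j : cone_kind) (q : type_kind)
    (p : 'rV[R[i]]_r) : seq (option nat * nat) :=
  let d nu := cdim (chain n k M j q nu p) in
  [seq (Some nu, jump_size n d nu) | nu <- jump_list n d] ++
  (if `[< chain_union n k M j q p = ambient_space M q p >] then [::]
   else [:: (None, sing_defect n k M j q p)]).

(* Main.v *)
Require Import Defs.
From HB Require Import structures.
From mathcomp Require Import all_boot all_order all_algebra.
From mathcomp Require Import all_classical all_reals all_analysis.
From mathcomp.real_closed Require Import complex.
From mathcomp Require Import ring lra zify.

Set Implicit Arguments.
Unset Strict Implicit.
Unset Printing Implicit Defensive.

Import Order.TTheory GRing.Theory Num.Theory.
Import numFieldNormedType.Exports.

Local Open Scope classical_set_scope.
Local Open Scope ring_scope.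
Local Open Scope complex_scope.

(* A biholomorphic map F acts on complexified vectors by its differential, which
   is block diagonal in the d/dz and d/dzbar coordinates.  It therefore
   transports the Zariski tangent spaces together with their types (1,0) and
   (0,1), hence regularity and D_1; since second derivatives of F are symmetric
   it commutes with commutators of vector fields, hence it transports every
   D_nu.  By continuity of the differential the three kinds of limit values at p
   are carried to those at F p by the linear isomorphism dF(p), which preserves
   all dimensions.  The CR type is the same for both germs because
   regular points of both types coexist arbitrarily close to each other.
   Analyticity of compositions and derivatives comes from absolutely convergent
   power series: a convergent sum of series with summable l1 norms is again a
   series, which covers products and substitutions, and substituting u + v
   yields the derivatives. *)

(** * Power series *)

(** The definitions speak of directional derivatives, that is, of limits, while commutators must be
    compared at every point near a regular point and second derivatives of F must be symmetric
    there. The proof therefore replaces limits by explicit estimates. A function has a first-order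
    expansion if its remainder is at most a constant times the square of the increment; sums,
    products and compositions of such expansions are plain inequalities, and the coefficients are
    recovered as Wirtinger derivatives, hence are unique. Power series supply these expansions on a
    whole neighbourhood, since the terms of degree at least 2 carry the factor (rho / e)^2 relative
    to their weight in the norm. The symmetry of second derivatives is read off from a symmetric
    choice of coefficients for f (u + v), without differentiating twice.

    On the algebraic side, none of the limit sets is shown to be a linear subspace. The dimension
    used in the definitions has a default value for other sets, so a bijection induced by an
    invertible matrix preserves it in all cases. *)

Definition box (T : finType) (N : nat) : seq {ffun T -> nat} :=
  [seq [ffun i => nat_of_ord (f i)] | f : {ffun T -> 'I_N}].

Lemma mem_box (T : finType) (N : nat) (al : {ffun T -> nat}) :
  (al \in box T N) = [forall i, (al i < N)%N].
Proof.
apply/mapP/forallP => [[f _ ->] i|H]; first by rewrite ffunE.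
exists [ffun i => Ordinal (H i)]; first by rewrite mem_enum.
by apply/ffunP => i; rewrite !ffunE.
Qed.

Lemma box_uniq (T : finType) (N : nat) : uniq (box T N).
Proof.
rewrite map_inj_uniq ?enum_uniq // => f g /ffunP E.
by apply/ffunP => i; apply: val_inj; move: (E i); rewrite !ffunE.
Qed.

Lemma big_boxE (V : nmodType) (T : finType) (N : nat)
    (u : {ffun T -> nat} -> V) :
  \sum_(al <- box T N) u al =
  \sum_(al : {ffun T -> 'I_N}) u [ffun i => nat_of_ord (al i)].
Proof. by rewrite /box big_map big_enum. Qed.

(** Boxes of all sizes are lists over the single type [{ffun T -> nat}], so that a smaller box can
    be split off a larger one; the type [{ffun T -> 'I_N}] of the definitions changes with N. *)
Lemma big_box_split (V : nmodType) (T : finType) (K N : nat)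
    (u : {ffun T -> nat} -> V) : (K <= N)%N ->
  \sum_(al <- box T N) u al =
  \sum_(al <- box T K) u al + \sum_(al <- box T N | al \notin box T K) u al.
Proof.
move=> KN; rewrite (bigID (mem (box T K))) /=; congr (_ + _).
rewrite -big_filter; apply: perm_big; apply: uniq_perm.
- by rewrite filter_uniq ?box_uniq.
- exact: box_uniq.
move=> al; rewrite mem_filter andb_idr // !mem_box => /forallP H.
by apply/forallP => i; apply: leq_trans KN.
Qed.

Lemma ler_box (R : realType) (T : finType) (K N : nat)
    (w : {ffun T -> nat} -> R) : (K <= N)%N -> (forall al, 0 <= w al) ->
  \sum_(al <- box T K) w al <= \sum_(al <- box T N) w al.
Proof.
by move=> KN w0; rewrite (big_box_split w KN) lerDl sumr_ge0.
Qed.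

Lemma box_diff_le (R : realType) (T : finType) (K N : nat)
    (u w : {ffun T -> nat} -> R) : (K <= N)%N -> (forall al, `|u al| <= w al) ->
  `|\sum_(al <- box T N) u al - \sum_(al <- box T K) u al| <=
  \sum_(al <- box T N) w al - \sum_(al <- box T K) w al.
Proof.
move=> KN uw; rewrite (big_box_split u KN) (big_box_split w KN).
rewrite ![_ + _ - _]addrAC !subrr !add0r.
by apply: (le_trans (ler_norm_sum _ _ _)); apply: ler_sum => al _.
Qed.

Lemma le_term_box (R : realType) (T : finType) (w : {ffun T -> nat} -> R)
    (B : R) (al : {ffun T -> nat}) : (forall al, 0 <= w al) ->
  (forall N, \sum_(al <- box T N) w al <= B) -> w al <= B.
Proof.
move=> w0 /(_ (\sum_i al i).+1%N); apply: le_trans.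
rewrite (bigD1_seq al) ?box_uniq //=; last first.
  rewrite mem_box; apply/forallP => i; rewrite ltnS (bigD1 i) //= leq_addr //.
by rewrite lerDl sumr_ge0.
Qed.

(** Both [w] and [s + w] are nondecreasing and bounded above, hence converge, and s is their
    difference. *)
Lemma dominated_cvg (R : realType) (s w : nat -> R) (B : R) :
  (forall K N, (K <= N)%N -> `|s N - s K| <= w N - w K) ->
  (forall N, w N <= B) -> exists l : R, s @ \oo --> l.
Proof.
move=> sw wB.
have cw : cvgn w.
  apply: nondecreasing_is_cvgn.
    by move=> K N /sw H; rewrite -subr_ge0; apply: le_trans H.
  by exists B => _ [N _ <-].
have cs : cvgn (s \+ w).
  apply: nondecreasing_is_cvgn.
    by move=> K N /sw; rewrite ler_norml /= => /andP[]; lra.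
  exists (s 0%N + 2 * B - w 0%N) => _ [N _ <-] /=.
  have := sw 0%N N isT; have := wB N; rewrite ler_norml => ? /andP[? ?]; lra.
exists (lim ((s \+ w) @ \oo) - lim (w @ \oo)).
rewrite {1}(_ : s = (s \+ w) \- w); last by apply/funext => N /=; lra.
exact: cvgB.
Qed.

Lemma nondecreasing_tail (R : realType) (w : nat -> R) (B eps : R) :
  (forall K N, (K <= N)%N -> w K <= w N) -> (forall N, w N <= B) -> 0 < eps ->
  exists K0, forall K N, (K0 <= K)%N -> (K <= N)%N -> w N - w K <= eps.
Proof.
move=> wi wB e0.
have cw : cvgn w by apply: nondecreasing_is_cvgn => //; exists B => _ [N _ <-].
have /cvgrPdist_lt/(_ _ e0)[K0 _ H] := cw.
exists K0 => K N K0K KN; have := H K K0K.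
have : w N <= lim (w @ \oo) by apply: (nondecreasing_cvgn_le _ cw) => ? ?;
  apply: wi.
by rewrite /= ltr_norml => ? /andP[]; lra.
Qed.

Lemma cvg_norm_sub_le (R : numFieldType) (s : nat -> R) (l a b : R) (K : nat) :
  s @ \oo --> l -> (forall N, (K <= N)%N -> `|s N - a| <= b) -> `|l - a| <= b.
Proof.
move=> /cvgrPdist_lt sl H; apply/ler_addgt0Pl => e e0.
have [N0 _ /(_ (maxn N0 K) (leq_maxl _ _)) /= HN] := sl _ e0.
have HK := H (maxn N0 K) (leq_maxr _ _).
rewrite -(subrKA (s (maxn N0 K))).
by apply: (le_trans (ler_normD _ _)); apply: lerD => //; apply: ltW.
Qed.

Definition mdeg (T : finType) (al : {ffun T -> nat}) : nat := (\sum_i al i)%N.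

Definition mono (K : comPzSemiRingType) (T : finType) (x : T -> K)
    (al : {ffun T -> nat}) : K := \prod_i x i ^+ al i.

(* f is the sum, on the polycube of radius e around 0, of the power series with
   coefficients c, whose l1 norm at radius e is at most B.  Variables are
   indexed by an arbitrary finite type so that a series in two vectors of
   variables is a series over T + T. *)
Definition power_sum (K : numFieldType) (T : finType) (e B : K)
    (c : {ffun T -> nat} -> K) (f : (T -> K) -> K) : Prop :=
  (forall N, \sum_(al <- box T N) `|c al| * e ^+ mdeg al <= B) /\
  (forall x, (forall i, `|x i| < e) ->
     (fun N => \sum_(al <- box T N) c al * mono x al) @ \oo --> f x).

(** Any B above the weighted l1 norm of the coefficients is allowed. This norm is subadditive and
    submultiplicative, so bounds for sums, products and substitutions are computed from B alone and
    the coefficients can stay hidden. *)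
Definition abs_series (R : realType) (T : finType) (e B : R) (f : (T -> R) ->
  R) :=
  exists c, power_sum e B c f.

Lemma expr_mdeg (K : comPzSemiRingType) (T : finType) (e : K) al :
  e ^+ @mdeg T al = mono (fun=> e) al.
Proof. by rewrite /mdeg /mono expr_sum. Qed.

Lemma mono_le (K : numDomainType) (T : finType) (x : T -> K) (y : T -> K) al :
  (forall i, `|x i| <= y i) -> `|mono x al| <= mono y al.
Proof.
move=> xy; rewrite normr_prod; apply: ler_prod => i _.
by rewrite normr_ge0 normrX /= lerXn2r // nnegrE ?(le_trans _ (xy i)).
Qed.

Lemma mono_le_deg (R : realType) (T : finType) (x : T -> R) (e : R) al :
  (forall i, `|x i| < e) -> `|mono x al| <= e ^+ mdeg al.
Proof. by move=> xe; rewrite expr_mdeg; apply: mono_le => i; apply: ltW. Qed.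

Lemma monoD (K : comPzSemiRingType) (T : finType) (x : T -> K) (al be : {ffun T
  -> nat}) :
  mono x [ffun i => al i + be i]%N = mono x al * mono x be.
Proof.
rewrite /mono -big_split /=; apply: eq_bigr => i _.
by rewrite ffunE exprD.
Qed.

Lemma abs_series_ext (R : realType) (T : finType) (e B : R) (f g : (T -> R) ->
  R) :
  (forall x, (forall i, `|x i| < e) -> f x = g x) -> abs_series e B f ->
    abs_series e B g.
Proof. by move=> fg [c [cB cf]]; exists c; split=> // x xe; rewrite -fg;
  auto. Qed.

Lemma abs_series_weaken (R : realType) (T : finType) (e B B' : R) (f : (T -> R)
  -> R) :
  B <= B' -> abs_series e B f -> abs_series e B' f.
Proof.
move=> BB [c [cB cf]]; exists c; split=> // N.
exact: (le_trans (cB N)).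
Qed.

Lemma abs_series_bound (R : realType) (T : finType) (e B : R) (f : (T -> R) ->
  R) x :
  (forall i, `|x i| < e) -> abs_series e B f -> `|f x| <= B.
Proof.
move=> xe [c [cB /(_ x xe) cf]]; rewrite -[f x]subr0.
apply: (cvg_norm_sub_le (K := 0%N) cf) => N _; rewrite subr0.
apply: le_trans (cB N); apply: (le_trans (ler_norm_sum _ _ _)).
by apply: ler_sum => al _; rewrite normrM ler_wpM2l // mono_le_deg.
Qed.

Lemma abs_series_ge0 (R : realType) (T : finType) (e B : R) (f : (T -> R) -> R)
  :
  0 < e -> abs_series e B f -> 0 <= B.
Proof.
move=> e0 H;
  apply: le_trans (normr_ge0 _) (abs_series_bound (x := fun=> 0) _ H).
by move=> i; rewrite normr0.
Qed.

Lemma abs_series0 (R : realType) (T : finType) (e : R) : @abs_series R T e 0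
  (fun=> 0).
Proof.
exists (fun=> 0); split=> [N|x _].
  by rewrite big1 // => al _; rewrite normr0 mul0r.
under eq_fun do under eq_bigr do rewrite mul0r.
by under eq_fun do rewrite big1 //; apply: cvg_cst.
Qed.

Lemma abs_seriesD (R : realType) (T : finType) (e B B' : R) (f g : (T -> R) ->
  R) :
  0 <= e -> abs_series e B f -> abs_series e B' g -> abs_series e (B + B') (fun
    x => f x + g x).
Proof.
move=> e0 [c [cB cf]] [d [dB dg]]; exists (fun al => c al + d al); split.
  move=> N; apply: le_trans (lerD (cB N) (dB N)); rewrite -big_split /=.
  by apply: ler_sum => al _; rewrite -mulrDl ler_wpM2r ?exprn_ge0 // ler_normD.
move=> x xe; under eq_fun do (under eq_bigr do rewrite mulrDl).
under eq_fun do rewrite big_split /=.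
exact: cvgD (cf x xe) (dg x xe).
Qed.

Lemma abs_series_monomial (R : realType) (T : finType) (e a : R) (be : {ffun T
  -> nat}) :
  0 <= e -> abs_series e (`|a| * e ^+ mdeg be) (fun x => a * mono x be).
Proof.
move=> e0; pose c al := if al == be then a else 0.
have sumc (V : nmodType) (u : {ffun T -> nat} -> V) N :
    (forall al, al != be -> u al = 0) ->
  \sum_(al <- box T N) u al = if be \in box T N then u be else 0.
  move=> u0; case: ifP => H.
    by rewrite (bigD1_seq be) ?box_uniq //= big1 ?addr0.
  rewrite big_seq big1 // => al alN; apply: u0.
  by apply: contraFN H => /eqP <-.
exists c; split=> [N|x xe].
  rewrite sumc; last by move=> al /negPf; rewrite /c => ->;
    rewrite normr0 mul0r.
  rewrite /c eqxx; case: ifP => // _; rewrite mulr_ge0 //; exact: exprn_ge0.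
apply: cvg_near_cst; exists (mdeg be).+1 => // N /= HN.
rewrite sumc; last by move=> al /negPf; rewrite /c => ->; rewrite mul0r.
rewrite /c eqxx mem_box ifT //; apply/forallP => i; apply: leq_trans HN.
by rewrite ltnS /mdeg (bigD1 i) //= leq_addr.
Qed.

Lemma abs_series_sum (R : realType) (T : finType) (e : R) (I : Type) (s : seq I)
    (P : pred I) (b : I -> R) (phi : I -> (T -> R) -> R) : 0 <= e ->
  (forall i, abs_series e (b i) (phi i)) ->
  abs_series e (\sum_(i <- s | P i) b i) (fun x => \sum_(i <- s | P i) phi i x).
Proof.
move=> e0 H; elim: s => [|i s IH].
  rewrite big_nil; apply: abs_series_ext (abs_series0 T e) => x _;
    by rewrite big_nil.
rewrite big_cons; case: (boolP (P i)) => Pi.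
  by apply: abs_series_ext (abs_seriesD e0 (H i) IH) => x _;
    rewrite big_cons Pi.
by apply: abs_series_ext IH => x _; rewrite big_cons (negPf Pi).
Qed.

(** * Infinite sums, products and substitutions of series *)

Lemma cvg_sum_seq (R : realType) (I : Type) (r : seq I) (P : pred I)
    (s : I -> nat -> R) (l : I -> R) : (forall i, s i @ \oo --> l i) ->
  (fun N => \sum_(i <- r | P i) s i N) @ \oo --> \sum_(i <- r | P i) l i.
Proof.
move=> H; elim: r => [|i r IH].
  by under eq_fun do rewrite big_nil; rewrite big_nil; apply: cvg_cst.
under eq_fun do rewrite big_cons; rewrite big_cons; case: ifP => // _.
exact: cvgD.
Qed.

(** This is completeness of the weighted l1 space. Each coefficient sequence is dominated by the
    sums of b, so it can be summed over k, and the tail of b controls the error made by exchanging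
    the two summations. *)
Lemma abs_series_series (R : realType) (T : finType) (e B : R) (b : nat -> R)
    (phi : nat -> (T -> R) -> R) (f : (T -> R) -> R) : 0 < e ->
  (forall k, abs_series e (b k) (phi k)) -> (forall N, \sum_(k < N) b k <= B) ->
  (forall x, (forall i, `|x i| < e) ->
    (fun N => \sum_(k < N) phi k x) @ \oo --> f x) ->
  abs_series e B f.
Proof.
move=> e0 /choice[H Hphi] bB phif.
have e0' := ltW e0.
have b0 k : 0 <= b k by apply: (abs_series_ge0 e0); exists (H k).
pose w N := \sum_(k < N) b k.
have w00 : w 0%N = 0 by rewrite /w big_ord0.
have wK K N : (K <= N)%N -> w N - w K = \sum_(K <= k < N) b k.
  move=> KN; rewrite /w -!(big_mkord xpredT b) (@big_cat_nat _ _ _ K) //=.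
  by rewrite addrAC subrr add0r.
pose s al N := \sum_(k < N) H k al.
have s0 al : s al 0%N = 0 by rewrite /s big_ord0.
have sK al K N : (K <= N)%N -> s al N - s al K = \sum_(K <= k < N) H k al.
  move=> KN; rewrite /s -!(big_mkord xpredT (fun k => H k al)).
  by rewrite (@big_cat_nat _ _ _ K) //= addrAC subrr add0r.
have wi K N : (K <= N)%N -> w K <= w N.
  by move=> KN; rewrite -subr_ge0 wK // sumr_ge0.
(* The bound does not depend on the box size N; this uniformity survives the limit in K' and
   justifies the exchange of sums. *)
have box_le K K' N : (K <= K')%N ->
    \sum_(al <- box T N) `|s al K' - s al K| * e ^+ mdeg al <= w K' - w K.
  move=> KK; rewrite wK //.
  apply: (@le_trans _ _ (\sum_(al <- box T N) \sum_(K <= k < K')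
      `|H k al| * e ^+ mdeg al)).
    apply: ler_sum => al _; rewrite sK // -mulr_suml.
    apply: ler_wpM2r; rewrite ?exprn_ge0 //. exact: ler_norm_sum.
  by rewrite exchange_big; apply: ler_sum => k _; have [] := Hphi k.
have /choice[d sd] : forall al, exists l : R, s al @ \oo --> l.
  move=> al; have ea : 0 < e ^+ mdeg al by rewrite exprn_gt0.
  apply: (@dominated_cvg _ _ (fun N => w N / e ^+ mdeg al)
    (B / e ^+ mdeg al)) => [K N KN|N]; last first.
    by rewrite ler_wpM2r ?invr_ge0 ?(ltW ea) ?bB.
  rewrite -mulrBl ler_pdivlMr //.
  apply: (le_term_box (w := fun al => `|s al N - s al K| * e ^+ mdeg al)).
    by move=> be; rewrite mulr_ge0 ?exprn_ge0.
  by move=> N'; apply: box_le.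
have box_cvg (g : {ffun T -> nat} -> R) K N b' : (forall K', (K <= K')%N ->
    \sum_(al <- box T N) `|s al K' - g al| * e ^+ mdeg al <= b') ->
    \sum_(al <- box T N) `|d al - g al| * e ^+ mdeg al <= b'.
  move=> H'.
  apply: (@cvgr_to_le _ \oo _ _
    (fun K' => \sum_(al <- box T N) `|s al K' - g al| * e ^+ mdeg al)).
    apply: cvg_sum_seq => al.
    apply: cvgM; last exact: cvg_cst.
    apply: cvg_norm; apply: (cvgB (f := s al)); [exact: sd|exact: cvg_cst].
  by exists K => // K' /H'.
exists d; split=> [N|x xe].
  have := @box_cvg (fun=> 0) 0%N N B.
  under eq_bigr do rewrite subr0; apply=> K' _.
  have := box_le 0%N K' N isT; rewrite w00 subr0 => Hle.
  apply: le_trans (le_trans Hle (bB K')).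
  by apply: ler_sum => al _; rewrite s0 subr0.
apply/cvgrPdist_le => eps eps0.
have eps3 : 0 < eps / 3 by lra.
(* Three errors of eps / 3: the tail of b after K terms, uniformly in the box; the distance from the
   K-th partial sum to f x; and the truncation to a box of the first K series, which are finitely
   many. *)
have [K1 HK1] := nondecreasing_tail wi bB eps3.
have /cvgrPdist_le/(_ _ eps3)[K2 _ HK2] := phif x xe.
pose K := maxn K1 K2.
have /cvgrPdist_le/(_ _ eps3)[N0 _ HN] :
    (fun N => \sum_(k < K) \sum_(al <- box T N) H k al * mono x al) @ \oo -->
    \sum_(k < K) phi k x.
  apply: (cvg_sum_seq (s := fun (k : 'I_K) N =>
    \sum_(al <- box T N) H k al * mono x al)
    (l := fun k : 'I_K => phi k x)) => k.
  by have [_] := Hphi k; apply.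
exists N0 => // N /= N0N.
have := HN N N0N; have := HK2 K (leq_maxr _ _); rewrite /=.
have : `|\sum_(al <- box T N) d al * mono x al -
    \sum_(k < K) \sum_(al <- box T N) H k al * mono x al| <= eps / 3.
  apply: le_trans (@box_cvg (s^~ K) K N (eps / 3) _); last first.
    move=> K' KK'; apply: (le_trans (box_le _ _ _ KK')).
    by apply: HK1 => //; rewrite leq_maxl.
  rewrite exchange_big /= -sumrB; apply: (le_trans (ler_norm_sum _ _ _)).
  apply: ler_sum => al _; rewrite -mulr_suml -mulrBl normrM ler_wpM2l //.
  exact: mono_le_deg.
rewrite !ler_norml => /andP[? ?] /andP[? ?] /andP[? ?].
by apply/andP; split; lra.
Qed.

(** Cutting the boxes into successive shells turns a sum over multi-indices into an ordinary series,
    each of whose terms is a finite sum. *)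
Lemma abs_series_box_series (R : realType) (S T : finType) (e B : R)
    (b : {ffun S -> nat} -> R) (phi : {ffun S -> nat} -> (T -> R) -> R)
    (f : (T -> R) -> R) : 0 < e ->
  (forall al, abs_series e (b al) (phi al)) ->
  (forall N, \sum_(al <- box S N) b al <= B) ->
  (forall x, (forall i, `|x i| < e) ->
    (fun N => \sum_(al <- box S N) phi al x) @ \oo --> f x) ->
  abs_series e B f.
Proof.
move=> e0 Aphi bB phif.
pose shell (u : {ffun S -> nat} -> R) k :=
  \sum_(al <- box S k.+1 | al \notin box S k) u al.
have shellE u N : \sum_(k < N) shell u k + \sum_(al <- box S 0%N) u al
    = \sum_(al <- box S N) u al.
  elim: N => [|N IH]; first by rewrite big_ord0 add0r.
  by rewrite big_ord_recr /= addrAC IH -big_box_split.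
have b0 al : 0 <= b al by apply: abs_series_ge0 e0 (Aphi al).
(* The box of size 0 needs its own term: it is empty when S is inhabited, but contains the unique
   multi-index when S is empty. *)
pose b' k := if k is k'.+1 then shell b k' else \sum_(al <- box S 0%N) b al.
pose phi' k x := if k is k'.+1 then shell (phi^~ x) k'
  else \sum_(al <- box S 0%N) phi al x.
have sumE u v N : (forall k, v k.+1 = shell u k) ->
    v 0%N = \sum_(al <- box S 0%N) u al ->
    \sum_(k < N.+1) v k = \sum_(al <- box S N) u al.
  move=> vS v0; rewrite big_ord_recl /= v0 -(shellE u N) addrC; congr (_ + _).
  by apply: eq_bigr => k _; rewrite -vS.
apply: (@abs_series_series _ _ _ _ b' phi') => //.
- move=> [|k]; rewrite /b' /phi'; apply: abs_series_sum => //; exact: ltW.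
- move=> [|N]; last by rewrite (sumE b).
  rewrite big_ord0; apply: le_trans (bB 0%N); exact: sumr_ge0.
move=> x xe; rewrite -(cvg_shiftS (fun N => \sum_(k < N) phi' k x)) /=.
rewrite (_ : (fun N => _) = fun N => \sum_(al <- box S N) phi al x).
  exact: phif.
by apply/funext => N; rewrite -(sumE (phi^~ x) (phi'^~ x)).
Qed.

(** Instead of collecting the coefficients of the Cauchy product, the product of the N-th box sums
    is written as a telescoping sum of its increments [block]. The norms of the blocks telescope in
    the same way, to a product bounded by B * B'. *)
Lemma abs_seriesM (R : realType) (T : finType) (e B B' : R) (f g : (T -> R) ->
  R) :
  0 < e -> abs_series e B f -> abs_series e B' g -> abs_series e (B * B') (fun
    x => f x * g x).
Proof.
move=> e0 Af Ag; have [c [cB cf]] := Af; have [d [dB dg]] := Ag.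
pose shell (u : {ffun T -> nat} -> R) k :=
  \sum_(al <- box T k.+1 | al \notin box T k) u al.
pose all u k : R := \sum_(al <- box T k) u al.
pose block u v k : R := shell u k * all v k.+1 + all u k * shell v k.
have blockE u v k : block u v k = all u k.+1 * all v k.+1 - all u k * all v k.
  by rewrite /block /all !(big_box_split _ (leqnSn k)) -!/(shell _ _); ring.
have tele u v N : \sum_(k < N) block u v k = all u N * all v N - all u 0%N *
  all v 0%N.
  elim: N => [|N IH]; first by rewrite big_ord0 subrr.
  by rewrite big_ord_recr /= IH blockE; ring.
pose nc al := `|c al| * e ^+ mdeg al; pose nd al := `|d al| * e ^+ mdeg al.
have Amono al be : abs_series e (nc al * nd be)
    (fun x => (c al * mono x al) * (d be * mono x be)).
  have := abs_series_monomial (c al * d be) [ffun i => al i + be i]%N (ltW e0).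
  rewrite !expr_mdeg monoD -!expr_mdeg normrM mulrACA.
  by apply: abs_series_ext => x _; rewrite monoD mulrACA.
have Aprod (s1 s2 : seq {ffun T -> nat}) (P Q : pred {ffun T -> nat}) :
    abs_series e ((\sum_(al <- s1 | P al) nc al) * (\sum_(be <- s2 | Q be) nd
      be))
      (fun x => (\sum_(al <- s1 | P al) c al * mono x al) *
                (\sum_(be <- s2 | Q be) d be * mono x be)).
  rewrite big_distrlr /=; apply: (@abs_series_ext _ _ _ _ (fun x =>
    \sum_(al <- s1 | P al) \sum_(be <- s2 | Q be)
      (c al * mono x al) * (d be * mono x be))).
    by move=> x _; rewrite big_distrlr.
  by do 2!(apply: abs_series_sum => [|?]; first exact: ltW); exact: Amono.
have nn0 (u : {ffun T -> nat} -> R) al : 0 <= `|u al| * e ^+ mdeg al.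
  by rewrite mulr_ge0 // exprn_ge0 // ltW.
have all0 u k : (forall al, 0 <= u al) -> 0 <= all u k.
  by move=> u0; apply: sumr_ge0.
apply: (@abs_series_series _ _ _ _ (fun k => if k is k'.+1 then block nc nd k'
    else all nc 0%N * all nd 0%N)
  (fun k x => if k is k'.+1 then
    block (fun al => c al * mono x al) (fun al => d al * mono x al) k'
    else all (fun al => c al * mono x al) 0%N * all (fun al =>
      d al * mono x al) 0%N)) => //.
- by move=> [|k]; [exact: Aprod|apply: abs_seriesD (ltW e0) _ _; exact: Aprod].
- move=> [|N]; first by rewrite big_ord0; apply: mulr_ge0;
  [apply: abs_series_ge0 Af|apply: abs_series_ge0 Ag].
  rewrite big_ord_recl /= tele addrC subrK.
  by apply: ler_pM => //; [apply: all0; exact: nn0|apply: all0;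
    exact: nn0|exact: cB|exact: dB].
move=> x xe; rewrite -cvg_shiftS /=.
rewrite (_ : (fun N => _) = (fun N => all (fun al => c al * mono x al) N) \*
    (fun N => all (fun al => d al * mono x al) N)).
  exact: cvgM (cf x xe) (dg x xe).
by apply/funext => N /=; rewrite big_ord_recl /= tele addrC subrK.
Qed.

Lemma abs_series_cst (R : realType) (T : finType) (e a : R) : 0 <= e ->
  @abs_series R T e `|a| (fun=> a).
Proof.
move=> e0; have := @abs_series_monomial R T e a [ffun=> 0%N] e0.
have E (x : T -> R) : mono x [ffun=> 0%N] = 1.
  by rewrite /mono big1 // => i _; rewrite ffunE expr0.
by rewrite expr_mdeg E mulr1; apply: abs_series_ext => x _; rewrite E mulr1.
Qed.

Definition munit (T : finType) (i : T) : {ffun T -> nat} :=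
  [ffun j => nat_of_bool (j == i)].

Lemma mono_munit (K : comPzSemiRingType) (T : finType) (x : T -> K) (i : T) :
  mono x (munit i) = x i.
Proof.
rewrite /mono (bigD1 i) //= big1 => [|j /negPf ji]; rewrite ffunE ?ji ?expr0 //.
by rewrite eqxx expr1 mulr1.
Qed.

Lemma abs_series_coord (R : realType) (T : finType) (e : R) (i : T) : 0 <= e ->
  abs_series e e (fun x => x i).
Proof.
move=> e0; have := abs_series_monomial 1 (munit i) e0.
rewrite expr_mdeg mono_munit normr1 mul1r.
by apply: abs_series_ext => x _; rewrite mono_munit mul1r.
Qed.

Lemma abs_seriesX (R : realType) (T : finType) (e B : R) (f : (T -> R) -> R) n :
  0 < e -> abs_series e B f -> abs_series e (B ^+ n) (fun x => f x ^+ n).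
Proof.
move=> e0 Af; elim: n => [|n IH].
  by have := @abs_series_cst R T e 1 (ltW e0); rewrite normr1.
by rewrite exprS; apply: abs_series_ext (abs_seriesM e0 Af IH) => x _;
  rewrite exprS.
Qed.

Lemma abs_series_prod (R : realType) (T : finType) (e : R) (I : Type) (s : seq
  I)
    (b : I -> R) (phi : I -> (T -> R) -> R) : 0 < e ->
  (forall i, abs_series e (b i) (phi i)) ->
  abs_series e (\prod_(i <- s) b i) (fun x => \prod_(i <- s) phi i x).
Proof.
move=> e0 H; elim: s => [|i s IH].
  rewrite big_nil; have := @abs_series_cst R T e 1 (ltW e0); rewrite normr1.
  by apply: abs_series_ext => x _; rewrite big_nil.
by rewrite big_cons; apply: abs_series_ext (abs_seriesM e0 (H i) IH) => x _;
  rewrite big_cons.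
Qed.

Lemma abs_series_mono (R : realType) (S T : finType) (e : R) (b : S -> R)
    (h : S -> (T -> R) -> R) al : 0 < e -> (forall i, abs_series e (b i) (h i))
      ->
  abs_series e (mono b al) (fun x => mono (h^~ x) al).
Proof. by move=> e0 H; apply: abs_series_prod => // i; apply: abs_seriesX. Qed.

(** Substituting h into the monomial of index al gives a series of norm at most [mono b al], hence
    at most e1 ^+ mdeg al. The strict inequality keeps the values of h inside the open polycube
    where f is the sum of its series. *)
Lemma abs_series_comp (R : realType) (S T : finType) (e e1 B : R) (b : S -> R)
    (f : (S -> R) -> R) (h : S -> (T -> R) -> R) : 0 < e ->
  abs_series e1 B f -> (forall i, abs_series e (b i) (h i)) -> (forall i, b i <
    e1) ->
  abs_series e B (fun x => f (h^~ x)).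
Proof.
move=> e0 [c [cB cf]] Ah be.
have b0 i : 0 <= b i by exact: abs_series_ge0 e0 (Ah i).
apply: (@abs_series_box_series _ _ _ _ _ (fun al => `|c al| * mono b al)
  (fun al x => c al * mono (h^~ x) al)) => // [al|N|x xe].
- by apply: abs_seriesM => //; [apply: abs_series_cst;
  exact: ltW|exact: abs_series_mono].
- apply: le_trans (cB N); apply: ler_sum => al _; rewrite ler_wpM2l //.
  rewrite expr_mdeg; apply: le_trans (ler_norm _) (mono_le _ _) => i.
  by rewrite ger0_norm // ltW.
by apply: cf => i; apply: le_lt_trans (be i); apply: abs_series_bound (Ah i).
Qed.

Lemma abs_series_shrink (R : realType) (T : finType) (e e' B : R) (f : (T -> R)
  -> R) :
  0 <= e' -> e' <= e -> abs_series e B f -> abs_series e' B f.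
Proof.
move=> e0 ee [c [cB cf]]; exists c; split=> [N|x xe].
  apply: le_trans (cB N); apply: ler_sum => al _.
  by rewrite ler_wpM2l // lerXn2r // nnegrE ?(le_trans e0).
by apply: cf => i; apply: lt_le_trans ee.
Qed.

(** * First-order expansion at the centre *)

Definition mzero (T : finType) : {ffun T -> nat} := [ffun=> 0%N].

Lemma mono_mzero (K : comPzSemiRingType) (T : finType) (x : T -> K) :
  mono x (mzero T) = 1.
Proof. by rewrite /mono big1 // => i _; rewrite ffunE expr0. Qed.

Lemma mdeg_munit (T : finType) (i : T) : mdeg (munit i) = 1%N.
Proof.
rewrite /mdeg (bigD1 i) //= big1 => [|j /negPf ji]; rewrite ffunE ?ji //.
by rewrite eqxx.
Qed.

Lemma munit_inj (T : finType) : injective (@munit T).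
Proof. by move=> i j /ffunP /(_ i); rewrite !ffunE eqxx; case: eqP. Qed.

Lemma munit_neq0 (T : finType) (i : T) : (munit i == mzero T) = false.
Proof.
by apply/eqP => /(congr1 (@mdeg T)); rewrite mdeg_munit /mdeg big1 // => j;
  rewrite ffunE.
Qed.

Lemma mdeg_le1 (T : finType) (al : {ffun T -> nat}) : (mdeg al <= 1)%N ->
  al = mzero T \/ exists i, al = munit i.
Proof.
case: (pickP (fun i => al i != 0%N)) => [i ai|a0]; last first.
  by move=> _; left; apply/ffunP => i; rewrite ffunE; apply/eqP/negPn;
    rewrite a0.
rewrite /mdeg (bigD1 i) //= => H; right; exists i; apply/ffunP => j.
rewrite ffunE; case: eqP => [->|/eqP ji] /=; first by lia.
by move: H; rewrite (bigD1 j) //=; lia.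
Qed.

(* Equal to mono v al when al has degree at most 1, and to 0 otherwise. *)
Definition lin_part (K : pzSemiRingType) (T : finType) (v : T -> K)
    (al : {ffun T -> nat}) : K :=
  (al == mzero T)%:R + \sum_j (al == munit j)%:R * v j.

(** In degree at most 1 the difference vanishes. In degree m at least 2 it is bounded by rho^m =
    (rho / e)^2 * rho^(m - 2) * e^2, and rho <= e. *)
Lemma mono_sub_lin_part (K : numFieldType) (T : finType) (v : T -> K)
    (rho e : K) al :
  0 <= rho -> 0 < e -> rho <= e -> (forall i, `|v i| <= rho) ->
  `|mono v al - lin_part v al| <= (rho / e) ^+ 2 * e ^+ mdeg al.
Proof.
move=> r0 e0 re vr; have rhs0 : 0 <= (rho / e) ^+ 2 * e ^+ mdeg al.
  by rewrite mulr_ge0 ?exprn_ge0 // ?divr_ge0 // ltW.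
case: (leqP (mdeg al) 1) => [/mdeg_le1[al0|[i ali]]|al2].
- move: rhs0; rewrite al0 /lin_part mono_mzero eqxx.
  rewrite big1 ?addr0 ?subrr ?normr0 // => j _.
  by rewrite eq_sym munit_neq0 mul0r.
- move: rhs0;
  rewrite ali /lin_part mono_munit munit_neq0 add0r (bigD1 i) //= eqxx mul1r.
  rewrite big1 ?addr0 ?subrr ?normr0 // => j /negPf ji.
  by rewrite (inj_eq (@munit_inj T)) eq_sym ji mul0r.
have -> : lin_part v al = 0.
  rewrite /lin_part big1 => [|j _].
    case: eqP => [E|]; last by rewrite addr0.
    by move: al2; rewrite E /mdeg big1 // => i; rewrite ffunE.
  case: eqP => [E|]; last by rewrite mul0r.
  by move: al2; rewrite E mdeg_munit.
rewrite subr0; apply: (@le_trans _ _ (rho ^+ mdeg al)).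
  by rewrite expr_mdeg; apply: mono_le.
case: (mdeg al) al2 => [|[|n]] // _.
rewrite -(addn2 n) !exprD expr_div_n [leRHS]mulrCA divfK ?expf_neq0 ?gt_eqF //.
rewrite ler_wpM2r ?exprn_ge0 //.
by rewrite lerXn2r // nnegrE ltW.
Qed.

Lemma sum_eq_box (V : nmodType) (T : finType) (N : nat) (be : {ffun T -> nat})
    (u : {ffun T -> nat} -> V) : (mdeg be < N)%N ->
  \sum_(al <- box T N | al == be) u al = u be.
Proof.
move=> beN; rewrite -big_filter (_ : [seq _ <- _ | _] = [:: be]) ?big_seq1 //.
apply: perm_small_eq => //; apply: uniq_perm => //.
  by rewrite filter_uniq // box_uniq.
move=> al; rewrite mem_filter inE; case: eqP => // ->; rewrite mem_box /=.
apply/forallP => i; apply: leq_trans beN.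
by rewrite ltnS /mdeg (bigD1 i) //= leq_addr.
Qed.

Lemma sum_lin_part (K : comPzRingType) (T : finType) (N : nat)
    (c : {ffun T -> nat} -> K) (v : T -> K) : (1 < N)%N ->
  \sum_(al <- box T N) c al * lin_part v al =
  c (mzero T) + \sum_j c (munit j) * v j.
Proof.
move=> N1; have cond be x : (mdeg be < N)%N ->
    \sum_(al <- box T N) c al * ((al == be)%:R * x) = c be * x.
  move=> beN; rewrite -(sum_eq_box (fun al => c al * x) beN) [RHS]big_mkcond /=.
  by apply: eq_bigr => al _; case: eqP => [->|]; rewrite ?mul1r ?mul0r ?mulr0.
under eq_bigr do rewrite mulrDr mulr_sumr.
rewrite big_split /= exchange_big /=; congr (_ + _).
  under eq_bigr do rewrite -[X in _ * X]mulr1.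
  by rewrite cond ?mulr1 // /mdeg big1 ?(ltnW N1) // => i; rewrite ffunE.
by apply: eq_bigr => j _; rewrite cond // mdeg_munit.
Qed.

(** The termwise estimate costs the factor (rho / e)^2 against the weights that sum to at most B.
    The field is left general because the same estimate serves real-analytic functions and, over
    [R[i]], holomorphic ones. *)
Lemma power_sum_center (K : numFieldType) (T : finType) (e B : K) c
    (f : (T -> K) -> K) (v : T -> K) (rho : K) : power_sum e B c f ->
  0 <= rho -> rho < e -> (forall i, `|v i| <= rho) ->
  `|f v - (c (mzero T) + \sum_j c (munit j) * v j)| <= (rho / e) ^+ 2 * B.
Proof.
move=> [cB cf] r0 re vr; have e0 : 0 < e by apply: le_lt_trans re.
apply: (cvg_norm_sub_le (K := 2) (cf v _)) => [i|N N2].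
  exact: le_lt_trans re.
rewrite -(sum_lin_part _ _ N2) -sumrB.
apply: le_trans (ler_norm_sum _ _ _) _.
apply: (@le_trans _ _ ((rho / e) ^+ 2 *
    \sum_(al <- box T N) `|c al| * e ^+ mdeg al)); last first.
  by rewrite ler_wpM2l // exprn_ge0 // divr_ge0 // ltW.
rewrite mulr_sumr; apply: ler_sum => al _.
by rewrite -mulrBr normrM mulrCA ler_wpM2l // mono_sub_lin_part // ltW.
Qed.

Lemma power_sum_at0 (K : numFieldType) (T : finType) (e B : K) c
    (f : (T -> K) -> K) : 0 < e -> power_sum e B c f -> f (fun=> 0) = c (mzero
      T).
Proof.
move=> e0 H; have z (i : T) : `|(fun=> 0 : K) i| <= 0 by rewrite normr0.
have := power_sum_center H (lexx 0) e0 z.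
rewrite mul0r expr0n mul0r normr_le0 big1 ?addr0 ?subr_eq0; first by move/eqP.
by move=> j _; rewrite mulr0.
Qed.

(** * Series in two vectors of variables and their derivatives *)

Definition mpair (T : finType) (be ga : {ffun T -> nat}) :
    {ffun T + T -> nat} :=
  [ffun s => match s with inl i => be i | inr i => ga i end].

Lemma big_box_mpair (V : nmodType) (T : finType) (N : nat)
    (u : {ffun T + T -> nat} -> V) :
  \sum_(al <- box (T + T)%type N) u al =
  \sum_(be <- box T N) \sum_(ga <- box T N) u (mpair be ga).
Proof.
transitivity
  (\sum_(al <- [seq mpair be ga | be <- box T N, ga <- box T N]) u al).
  apply: perm_big; apply: uniq_perm; first exact: box_uniq.
    apply: allpairs_uniq; rewrite ?box_uniq // => -[be ga] [be' ga'] _ _ /=.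
    move=> /ffunP E; congr (_, _); apply/ffunP => i.
      by have := E (inl i); rewrite !ffunE.
    by have := E (inr i); rewrite !ffunE.
  move=> al; rewrite mem_box; apply/forallP/allpairsP =>
    [H|[[be ga]] /= [Hb Hg ->]].
    exists ([ffun i => al (inl i)], [ffun i => al (inr i)]); split => /=.
    + by rewrite mem_box; apply/forallP => i; rewrite ffunE.
    + by rewrite mem_box; apply/forallP => i; rewrite ffunE.
    by apply/ffunP => -[i|i]; rewrite !ffunE.
  move: Hb Hg; rewrite !mem_box => /forallP Hb /forallP Hg.
  by move=> [i|i]; rewrite ffunE.
by rewrite big_allpairs_dep.
Qed.

Lemma mono_mpair (K : comPzSemiRingType) (T : finType) (w : T + T -> K) be ga :
  mono w (mpair be ga) = mono (w \o inl) be * mono (w \o inr) ga.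
Proof.
by rewrite /mono big_sumType; congr (_ * _); apply: eq_bigr => i _;
  rewrite ffunE.
Qed.

Lemma mdeg_mpair (T : finType) (be ga : {ffun T -> nat}) :
  mdeg (mpair be ga) = (mdeg be + mdeg ga)%N.
Proof.
by rewrite /mdeg big_sumType; congr addn; apply: eq_bigr => i _; rewrite ffunE.
Qed.

Lemma power_sum_exists (R : realType) (T : finType) (e B : R)
    (c : {ffun T -> nat} -> R) :
  (forall N, \sum_(al <- box T N) `|c al| * e ^+ mdeg al <= B) ->
  exists f, power_sum e B c f.
Proof.
move=> cB.
have /choice[f Hf] : forall x : T -> R, exists l : R, (forall i, `|x i| < e) ->
    (fun N => \sum_(al <- box T N) c al * mono x al) @ \oo --> l.
  (* Outside the polycube the value is irrelevant and is set to 0. *)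
  move=> x; have [xe|nxe] := pselect (forall i, `|x i| < e); last by exists 0.
  have [|l Hl] := @dominated_cvg _ (fun N =>
    \sum_(al <- box T N) c al * mono x al) _ B _ cB.
    move=> K N KN; apply: box_diff_le => // al.
    by rewrite normrM ler_wpM2l // mono_le_deg.
  by exists l.
by exists f; split.
Qed.

(* The average of C and of its image under the exchange of the two vectors of
   variables is a symmetric choice of coefficients; this symmetry is what later
   makes mixed partial derivatives commute. *)
Lemma abs_series_translate (R : realType) (T : finType) (e B : R) (f : (T -> R)
  -> R) :
  0 < e -> abs_series e B f -> exists C,
  power_sum (e / 3) B C (fun w : T + T -> R => f (fun i =>
    w (inl i) + w (inr i))) /\
  forall be ga, C (mpair be ga) = C (mpair ga be).
Proof.
move=> e0 Af; have e30 : 0 < e / 3 by rewrite divr_gt0.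
have [C [CB Cf]] : abs_series (e / 3) B
    (fun w : T + T -> R => f (fun i => w (inl i) + w (inr i))).
  (* A sum of two coordinates has norm 2 * e / 3; the radius e / 3 is chosen so that this stays
     strictly below e. *)
  apply: (@abs_series_comp _ _ _ _ e B (fun=> e / 3 + e / 3) f
      (fun i w => w (inl i) + w (inr i))) => // [i|_]; last by lra.
  by apply: abs_seriesD; rewrite ?ltW //; apply: abs_series_coord; exact: ltW.
pose sw (al : {ffun T + T -> nat}) : {ffun T + T -> nat} :=
  [ffun s => al (match s with inl i => inr i | inr i => inl i end)].
have swE be ga : sw (mpair be ga) = mpair ga be.
  by apply/ffunP => -[i|i]; rewrite !ffunE.
have box_sw (u : {ffun T + T -> nat} -> R) N :
    \sum_(al <- box _ N) u (sw al) = \sum_(al <- box _ N) u al.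
  rewrite !big_box_mpair exchange_big; apply: eq_bigr => be _.
  by apply: eq_bigr => ga _; rewrite swE.
have mdeg_sw al : mdeg (sw al) = mdeg al.
  rewrite /mdeg !big_sumType /= addnC; congr addn; by apply: eq_bigr => i _;
    rewrite ffunE.
exists (fun al => (C al + C (sw al)) / 2); split; last first.
  by move=> be ga; rewrite !swE addrC.
split=> [N|w we].
  apply: (@le_trans _ _ ((\sum_(al <- box _ N) `|C al| * (e / 3) ^+ mdeg al +
     \sum_(al <- box _ N) `|C (sw al)| * (e / 3) ^+ mdeg (sw al)) / 2)).
    rewrite -big_split /= mulr_suml; apply: ler_sum => al _.
    rewrite mdeg_sw -mulrDl mulrAC ler_wpM2r ?exprn_ge0 ?(ltW e30) //.
    by rewrite normrM [`|2^-1|]ger0_norm // ler_wpM2r // ler_normD.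
  by rewrite (box_sw (fun al => `|C al| * (e / 3) ^+ mdeg al)); have := CB N;
    lra.
pose w' s := w (match s with inl i => inr i | inr i => inl i end).
have -> : f (fun i => w (inl i) + w (inr i)) =
    (f (fun i => w (inl i) + w (inr i)) + f (fun i =>
      w' (inl i) + w' (inr i))) / 2.
  have -> : (fun i => w' (inl i) + w' (inr i)) = fun i => w (inl i) + w (inr i).
    by apply/funext => i; rewrite addrC.
  by lra.
have mono_sw al : mono w (sw al) = mono w' al.
  by rewrite /mono !big_sumType /= mulrC; congr (_ * _); apply: eq_bigr =>
    i _; rewrite ffunE.
have we' s : `|w' s| < e / 3 by exact: we.
rewrite (_ : (fun N => _) = (fun N =>
  ((fun N => \sum_(al <- box _ N) C al * mono w al) \+
   (fun N => \sum_(al <- box _ N) C al * mono w' al)) N / 2)).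
  by apply: cvgMl; apply: cvgD; exact: Cf.
apply/funext => N /=; under [X in _ + X]eq_bigr do rewrite -mono_sw.
have swsw al : sw (sw al) = al by apply/ffunP => -[i|i]; rewrite !ffunE.
rewrite -(box_sw (fun al => C al * mono w (sw al))) -big_split mulr_suml /=.
by apply: eq_bigr => al _; rewrite swsw; lra.
Qed.

(* The gradient g at u is read off from the terms of the expansion of f (u + v)
   which are of degree 1 in v. *)
Lemma abs_series_deriv (R : realType) (T : finType) (e B : R) (f : (T -> R) ->
  R) :
  0 < e -> abs_series (3 * e) B f -> exists (g : T -> (T -> R) -> R) (H : T ->
    T -> R),
  [/\ forall j, abs_series e (B / e) (g j),
      forall u v rho, (forall i, `|u i| < e) -> 0 <= rho -> rho < e ->
        (forall i, `|v i| <= rho) ->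
        `|f (fun i => u i + v i) - (f u + \sum_j g j u * v j)| <=
        (rho / e) ^+ 2 * B,
      forall j v rho, 0 <= rho -> rho < e -> (forall i, `|v i| <= rho) ->
        `|g j v - (g j (fun=> 0) + \sum_l H j l * v l)| <=
        (rho / e) ^+ 2 * (B / e) &
      forall j l, H j l = H l j].
Proof.
move=> e0 Af; have [|C [[CB Cf] Csym]] := abs_series_translate _ Af;
  first by lra.
rewrite [3 * e]mulrC mulfK // in CB Cf.
have CB' N : \sum_(be <- box T N) \sum_(ga <- box T N)
    `|C (mpair be ga)| * e ^+ mdeg be * e ^+ mdeg ga <= B.
  apply: le_trans (CB N); rewrite big_box_mpair; apply: ler_sum => be _.
  by apply: ler_sum => ga _; rewrite mdeg_mpair exprD mulrA.
have pos al be : 0 <= `|C al| * e ^+ be by rewrite mulr_ge0 // exprn_ge0 // ltW.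
(* Of the inner sum only the term [munit j], of weight e, is kept; dividing by that weight gives B /
   e. The box of size N.+2 contains [munit j] even when N = 0. *)
have cjB j N : \sum_(be <- box T N) `|C (mpair be (munit j))| * e ^+ mdeg be <=
  B / e.
  have NN : (N <= N.+2)%N by lia.
  rewrite ler_pdivlMr //; apply: le_trans (CB' N.+2).
  apply: (@le_trans _ _ (\sum_(be <- box T N.+2)
      `|C (mpair be (munit j))| * e ^+ mdeg be * e)).
    by rewrite -mulr_suml ler_wpM2r ?(ltW e0) // ler_box.
  apply: ler_sum => be _.
  have := @sum_eq_box _ T N.+2 (munit j)
    (fun ga => `|C (mpair be ga)| * e ^+ mdeg be * e ^+ mdeg ga).
  rewrite !mdeg_munit expr1 => <- //; rewrite big_mkcond /=.
  apply: ler_sum => ga _; case: ifP => // _.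
  by rewrite mulr_ge0 // exprn_ge0 // ltW.
have /choice[g Hg] j := power_sum_exists (cjB j).
(* H collects the coefficients of bidegree (1, 1), which are the linear coefficients of g; its
   symmetry is that of C. *)
exists g, (fun j l => C (mpair (munit l) (munit j))); split => //.
- by move=> j; exists (fun be => C (mpair be (munit j))).
- move=> u v rho ue r0 re vr.
  have ve i : `|v i| < e by apply: le_lt_trans re.
  pose w (s : T + T) := match s with inl i => u i | inr i => v i end.
  pose w0 (s : T + T) := match s with inl i => u i | inr i => 0 end.
  have cw : (fun N => \sum_(be <- box T N) \sum_(ga <- box T N)
      C (mpair be ga) * (mono u be * mono v ga)) @ \oo --> f (fun i =>
        u i + v i).
    have := Cf w (fun s => match s with inl i => ue i | inr i => ve i end).
    by under eq_fun do [rewrite big_box_mpair;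
      under eq_bigr do under eq_bigr do rewrite mono_mpair].
  have cu : (fun N => \sum_(be <- box T N) C (mpair be (mzero T)) * mono u be)
      @ \oo --> f u.
    have := Cf w0 _.
    under eq_fun do [rewrite big_box_mpair;
      under eq_bigr do under eq_bigr do rewrite mono_mpair].
    rewrite (_ : (fun i => w0 (inl i) + w0 (inr i)) = u); last first.
      by apply/funext => i; rewrite addr0.
    have w0e s : `|w0 s| < e by case: s => i; rewrite ?normr0 //; apply: ue.
    move=> /(_ w0e); apply: cvg_trans; apply: near_eq_cvg.
    exists 2%N => // N /= N2; apply: eq_bigr => be _.
    (* At v = 0 a monomial equals its [lin_part], by the quadratic estimate with rho = 0, so only
       the index [mzero] remains. *)
    transitivity (mono u be * \sum_(ga <- box T N)
        C (mpair be ga) * lin_part (fun=> 0) ga).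
      rewrite mulr_sumr; apply: eq_bigr => ga _; rewrite mulrCA;
        congr (_ * (_ * _)).
      apply/eqP; rewrite -subr_eq0 -normr_le0.
      apply: (le_trans (mono_sub_lin_part _ (lexx 0) e0 (ltW e0) _)) => [i|].
        by rewrite normr0.
      by rewrite mul0r expr0n mul0r.
    rewrite sum_lin_part // big1 ?addr0 1?mulrC // => j _; exact: mulr0.
  have cg := fun j => (Hg j).2 u ue.
  have cgv j : (fun N =>
    (\sum_(be <- box T N) C (mpair be (munit j)) * mono u be) * v j)
      @ \oo --> g j u * v j by apply: cvgMl; exact: cg.
  have cl := cvgB cw (cvgD cu (@cvg_sum_seq _ _ (index_enum T) xpredT _ _ cgv)).
  rewrite -[X in `|X|]subr0; apply: (cvg_norm_sub_le (K := 2%N) (cl _ _)) =>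
    N N2.
  rewrite subr0 !fctE /=; under [X in _ - (_ + X)]eq_bigr do rewrite mulr_suml.
  rewrite [X in _ - (_ + X)]exchange_big -big_split -sumrB /=.
  apply: (@le_trans _ _ ((rho / e) ^+ 2 * \sum_(be <- box T N)
     \sum_(ga <- box T N) `|C (mpair be ga)| * e ^+ mdeg be * e ^+ mdeg ga));
    last by rewrite ler_wpM2l // exprn_ge0 // divr_ge0 // ltW.
  rewrite mulr_sumr; apply: le_trans (ler_norm_sum _ _ _) _.
  apply: ler_sum => be _.
  have -> : C (mpair be (mzero T)) * mono u be +
      \sum_j C (mpair be (munit j)) * mono u be * v j =
      \sum_(ga <- box T N) (C (mpair be ga) * mono u be) * lin_part v ga.
    by rewrite (sum_lin_part (fun ga => C (mpair be ga) * mono u be)).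
  rewrite -sumrB mulr_sumr; apply: le_trans (ler_norm_sum _ _ _) _.
  apply: ler_sum => ga _; rewrite [_ * (mono u be * _)]mulrA -mulrBr !normrM.
  rewrite mulrCA; apply: ler_pM => //.
    by rewrite ler_wpM2l // mono_le_deg.
  by apply: mono_sub_lin_part => //; exact: ltW.
- move=> j v rho r0 re vr; have := power_sum_center (Hg j) r0 re vr.
  by rewrite (power_sum_at0 e0 (Hg j)).
Qed.

(** * Real-analytic and holomorphic functions *)

(** This norm has values in R, unlike the modulus of [R[i]], so that estimates reduce to real linear
    arithmetic; it lies between the modulus and twice the modulus. *)
Definition norm1C (R : realType) (z : R[i]) : R :=
  `|complex.Re z| + `|complex.Im z|.

Lemma reCD (R : realType) (x y : R[i]) :
  complex.Re (x + y) = complex.Re x + complex.Re y.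
Proof. by case: x => a b; case: y. Qed.
Lemma imCD (R : realType) (x y : R[i]) :
  complex.Im (x + y) = complex.Im x + complex.Im y.
Proof. by case: x => a b; case: y. Qed.
Lemma reCN (R : realType) (x : R[i]) : complex.Re (- x) = - complex.Re x.
Proof. by case: x. Qed.
Lemma imCN (R : realType) (x : R[i]) : complex.Im (- x) = - complex.Im x.
Proof. by case: x. Qed.
Lemma reCM (R : realType) (x y : R[i]) : complex.Re (x * y) =
  complex.Re x * complex.Re y - complex.Im x * complex.Im y.
Proof. by case: x => a b; case: y. Qed.
Lemma imCM (R : realType) (x y : R[i]) : complex.Im (x * y) =
  complex.Re x * complex.Im y + complex.Im x * complex.Re y.
Proof. by case: x => a b; case: y. Qed.

Lemma reC_sum (R : realType) (I : Type) (s : seq I) (P : pred I)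
    (f : I -> R[i]) :
  complex.Re (\sum_(i <- s | P i) f i) = \sum_(i <- s | P i) complex.Re (f i).
Proof. exact: (big_morph _ (@reCD R) erefl). Qed.
Lemma imC_sum (R : realType) (I : Type) (s : seq I) (P : pred I)
    (f : I -> R[i]) :
  complex.Im (\sum_(i <- s | P i) f i) = \sum_(i <- s | P i) complex.Im (f i).
Proof. exact: (big_morph _ (@imCD R) erefl). Qed.

Lemma complex_eqP (R : realType) (x y : R[i]) :
  complex.Re x = complex.Re y -> complex.Im x = complex.Im y -> x = y.
Proof. by case: x => a b; case: y => c d /= -> ->. Qed.

Lemma norm1C_ge0 (R : realType) (z : R[i]) : 0 <= norm1C z.
Proof. by rewrite addr_ge0. Qed.
Lemma norm1C0 (R : realType) : norm1C (0 : R[i]) = 0.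
Proof. by rewrite /norm1C /= normr0 addr0. Qed.
Lemma norm1CD (R : realType) (x y : R[i]) : norm1C (x + y) <= norm1C x + norm1C
  y.
Proof.
rewrite /norm1C reCD imCD; have := ler_normD (complex.Re x) (complex.Re y).
have := ler_normD (complex.Im x) (complex.Im y); lra.
Qed.
Lemma norm1CM (R : realType) (x y : R[i]) : norm1C (x * y) <= norm1C x * norm1C
  y.
Proof.
case: x => a b; case: y => c d; rewrite /norm1C /=.
have := ler_normB (a * c) (b * d); have := ler_normD (a * d) (b * c).
by rewrite !normrM; lra.
Qed.
Lemma norm1C_conj (R : realType) (x : R[i]) : norm1C x^* = norm1C x.
Proof. by case: x => a b; rewrite /norm1C /= normrN. Qed.
Lemma norm1C_sum (R : realType) (I : Type) (s : seq I) (P : pred I)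
    (f : I -> R[i]) :
  norm1C (\sum_(i <- s | P i) f i) <= \sum_(i <- s | P i) norm1C (f i).
Proof.
elim/big_rec2 : _ => [|i y1 y2 _ H]; first by rewrite norm1C0.
by apply: le_trans (norm1CD _ _) _; rewrite lerD2l.
Qed.
Lemma norm1C_real (R : realType) (a : R) : norm1C a%:C = `|a|.
Proof. by rewrite /norm1C /= normr0 addr0. Qed.
Lemma Re_le_norm1C (R : realType) (z : R[i]) : `|complex.Re z| <= norm1C z.
Proof. by rewrite lerDl. Qed.
Lemma Im_le_norm1C (R : realType) (z : R[i]) : `|complex.Im z| <= norm1C z.
Proof. by rewrite lerDr. Qed.

Lemma norm_le_norm1C (R : realType) (z : R[i]) : `|z| <= (norm1C z)%:C.
Proof.
rewrite normc_def lecR /norm1C; case: z => a b /=.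
rewrite -(ger0_norm (addr_ge0 (normr_ge0 a) (normr_ge0 b))) -sqrtr_sqr.
rewrite ler_wsqrtr // sqrrD !real_normK ?num_real //.
have := mulr_ge0 (normr_ge0 a) (normr_ge0 b); lra.
Qed.

Lemma norm1C_le_norm (R : realType) (z : R[i]) : (norm1C z)%:C <= 2 * `|z|.
Proof.
have H1 := normc_ge_Re z.
have H2 : `|complex.Im z|%:C <= `|z|.
  by have := normc_ge_Re (z * 'i%C); rewrite ReiNIm normrN normrM
    [`|'i%C|]normc_def /= expr0n expr1n add0r sqrtr1 mulr1.
have -> : (norm1C z)%:C = `|complex.Re z|%:C + `|complex.Im z|%:C.
  by rewrite -rmorphD.
by rewrite mulr_natl mulr2n lerD.
Qed.

Lemma mx_norm_ltP (K : numFieldType) (m : nat) (v : 'rV[K]_m) (e : K) :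
  0 < e -> (`|v| < e) <-> (forall j, `|v 0 j| < e).
Proof.
move=> e0; have H : ball v e 0 = (`|v - 0| < e) :> Prop by rewrite mx_norm_ball.
rewrite subr0 in H; rewrite -H; split.
  by move=> [_ H'] j; have := H' 0 j; rewrite /ball /= mxE subr0.
by move=> H'; split=> // i j; rewrite (ord1 i) /ball /= mxE subr0.
Qed.

Lemma mx_norm_lt_norm1C (R : realType) (m : nat) (v : 'rV[R[i]]_m) (e : R) :
  0 < e -> (forall j, norm1C (v 0 j) < e) -> `|v| < e%:C.
Proof.
move=> e0 H; apply/mx_norm_ltP => [|j]; first by rewrite ltcR.
by apply: le_lt_trans (norm_le_norm1C _) _; rewrite ltcR.
Qed.

Lemma norm1C_lt_mx_norm (R : realType) (m : nat) (v : 'rV[R[i]]_m) (e : R) j :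
  0 < e -> `|v| < e%:C -> norm1C (v 0 j) < 2 * e.
Proof.
move=> e0 /mx_norm_ltP; rewrite ltcR => /(_ e0 j) H.
rewrite -ltcR; apply: le_lt_trans (norm1C_le_norm _) _.
by rewrite rmorphM /= rmorph_nat ltr_pM2l.
Qed.

(** Radii of balls over [R[i]] are elements of [R[i]], but a positive one is real. Comparing the two
    norms accounts for the factor 2. *)
Lemma near_norm1CP (R : realType) (m : nat) (p : 'rV[R[i]]_m)
    (P : 'rV[R[i]]_m -> Prop) :
  (\forall z \near p, P z) <->
  exists2 d : R, 0 < d & forall v : 'rV_m, (forall j, norm1C (v 0 j) < d) -> P
    (p + v).
Proof.
split=> [|[d d0 H]].
  move=> /nbhs_normP[e /= e0 H]; have [e' Ee] : exists e', e = e'%:C.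
    by apply/complex_realP; exact: gtr0_real.
  rewrite Ee ltcR in e0; exists e' => // v ve; apply: H.
  by rewrite /= Ee opprD addrA subrr sub0r normrN; apply: mx_norm_lt_norm1C.
apply/nbhs_normP; exists (d / 2)%:C => /=; first by rewrite ltcR divr_gt0.
move=> z /= zd; rewrite -[z](subrK p) addrC; apply: H => j.
have := @norm1C_lt_mx_norm _ _ (z - p) (d / 2) j; rewrite distrC in zd.
by rewrite (_ : 2 * (d / 2) = d); [apply; rewrite ?divr_gt0|lra].
Qed.

Lemma analytic_at_power_sumP (K : numFieldType) (m : nat) (f : 'rV[K]_m -> K) a
  :
  analytic_at f a <-> exists e B c, 0 < e /\
    power_sum e B c (fun x : 'I_m -> K => f (a + \row_i x i)).
Proof.
have monoE c N (x : 'I_m -> K) :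
    \sum_(alpha : {ffun 'I_m -> 'I_N}) c [ffun i => nat_of_ord (alpha i)] *
      \prod_i x i ^+ alpha i = \sum_(al <- box _ N) c al * mono x al.
  rewrite big_boxE; apply: eq_bigr => al _; congr (_ * _).
  by apply: eq_bigr => i _; rewrite ffunE.
have mdegE (c : {ffun 'I_m -> nat} -> K) N (e : K) :
    \sum_(alpha : {ffun 'I_m -> 'I_N})
      `|c [ffun i => nat_of_ord (alpha i)]| * e ^+ (\sum_i alpha i)%N =
    \sum_(al <- box _ N) `|c al| * e ^+ mdeg al.
  rewrite big_boxE; apply: eq_bigr => al _; congr (_ * _ ^+ _).
  by apply: eq_bigr => i _; rewrite ffunE.
split=> [[c [e [B [e0 cB cf]]]]|[e [B [c [e0 [cB cf]]]]]].
  exists e, B, c; split=> //; split=> [N|x xe]; first by rewrite -mdegE.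
  have E i : (a + \row_i x i) 0 i - a 0 i = x i.
    by rewrite !mxE addrAC subrr add0r.
  have -> : (fun N : nat => \sum_(al <- box _ N) c al * mono x al) =
      (fun N => \sum_(alpha : {ffun 'I_m -> 'I_N})
        c [ffun i => nat_of_ord (alpha i)] *
        \prod_i ((a + \row_i x i) 0 i - a 0 i) ^+ alpha i).
    apply/funext => N; rewrite -monoE; apply: eq_bigr => al _; congr (_ * _).
    by apply: eq_bigr => i _; rewrite E.
  by apply: cf => i; rewrite E.
exists c, e, B; split=> // [N|x xe]; first by rewrite mdegE.
rewrite (_ : (fun N => _) = (fun N => \sum_(al <- box _ N)
  c al * mono (fun i => x 0 i - a 0 i) al)); last first.
  by apply/funext => N; rewrite monoE.
have {2}-> : x = a + \row_i (x 0 i - a 0 i).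
  by apply/rowP => i; rewrite !mxE addrC subrK.
exact: (cf (fun i => x 0 i - a 0 i)).
Qed.

Definition cvec (R : realType) (r : nat) (x : 'I_(r + r) -> R) :
    'rV[R[i]]_r := \row_j (x (lshift r j) +i* x (rshift r j)).

Definition crd (R : realType) (r : nat) (v : 'rV[R[i]]_r) (s : 'I_(r + r)) :
  R := real_coords v 0 s.

Lemma crdl (R : realType) (r : nat) (v : 'rV[R[i]]_r) j :
  crd v (lshift r j) = complex.Re (v 0 j).
Proof. by rewrite /crd /real_coords row_mxEl mxE. Qed.

Lemma crdr (R : realType) (r : nat) (v : 'rV[R[i]]_r) j :
  crd v (rshift r j) = complex.Im (v 0 j).
Proof. by rewrite /crd /real_coords row_mxEr mxE. Qed.

Lemma ord_addP (r : nat) (P : 'I_(r + r) -> Prop) :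
  (forall j, P (lshift r j)) -> (forall j, P (rshift r j)) -> forall s, P s.
Proof. by move=> Hl Hr s; case: (split_ordP s) => j ->. Qed.

Lemma cvecK (R : realType) (r : nat) (x : 'I_(r + r) -> R) s :
  crd (cvec x) s = x s.
Proof.
by move: s; apply: ord_addP => j; rewrite ?crdl ?crdr mxE.
Qed.

Lemma crdK (R : realType) (r : nat) (v : 'rV[R[i]]_r) : cvec (crd v) = v.
Proof. by apply/rowP => j; rewrite mxE crdl crdr; case: (v 0 j). Qed.

Lemma cvecD (R : realType) (r : nat) (x y : 'I_(r + r) -> R) :
  cvec (fun s => x s + y s) = cvec x + cvec y.
Proof. by apply/rowP => j; rewrite !mxE. Qed.

Lemma cvec0 (R : realType) (r : nat) : cvec (fun=> 0) = 0 :> 'rV[R[i]]_r.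
Proof. by apply/rowP => j; rewrite !mxE. Qed.

Lemma crd_le_norm1C (R : realType) (r : nat) (v : 'rV[R[i]]_r) (e : R) :
  (forall j, norm1C (v 0 j) <= e) -> forall s, `|crd v s| <= e.
Proof.
move=> H; apply: ord_addP => j; rewrite ?crdl ?crdr; apply: le_trans (H j).
  exact: Re_le_norm1C.
exact: Im_le_norm1C.
Qed.

Lemma crd_lt_norm1C (R : realType) (r : nat) (v : 'rV[R[i]]_r) (e : R) :
  (forall j, norm1C (v 0 j) < e) -> forall s, `|crd v s| < e.
Proof.
move=> H; apply: ord_addP => j; rewrite ?crdl ?crdr; apply: le_lt_trans (H j).
  exact: Re_le_norm1C.
exact: Im_le_norm1C.
Qed.

Lemma of_real_coordsD (R : realType) (r : nat) (p : 'rV[R[i]]_r) x :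
  of_real_coords (real_coords p + \row_s x s) = p + cvec x.
Proof.
have E s : (real_coords p + \row_s x s) 0 s = crd p s + x s.
  by rewrite mxE [X in _ + X]mxE.
apply/rowP => j; rewrite mxE !E crdl crdr !mxE.
by apply: complex_eqP; rewrite ?reCD ?imCD.
Qed.

Lemma real_analytic_atP (R : realType) (r : nat) (f : 'rV[R[i]]_r -> R) p :
  real_analytic_at f p <->
  exists e B, 0 < e /\ abs_series e B (fun x : 'I_(r + r) -> R =>
    f (p + cvec x)).
Proof.
rewrite /real_analytic_at analytic_at_power_sumP.
have E : (fun x : 'I_(r + r) -> R => (f \o of_real_coords (r := r))
    (real_coords p + \row_s x s)) = fun x => f (p + cvec x).
  by apply/funext => x /=; rewrite of_real_coordsD.
rewrite E; split=> [[e [B [c [e0 H]]]]|[e [B [e0 [c H]]]]].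
  by exists e, B; split=> //; exists c.
by exists e, B, c.
Qed.

Lemma real_analytic_at_near (R : realType) (r : nat) (f g : 'rV[R[i]]_r -> R)
    p : (\forall z \near p, f z = g z) ->
  real_analytic_at f p -> real_analytic_at g p.
Proof.
move=> /near_norm1CP[d d0 fg] /real_analytic_atP[e [B [e0 Af]]].
apply/real_analytic_atP; pose e' := Num.min e (d / 2).
have e'0 : 0 < e' by rewrite lt_min e0 divr_gt0.
exists e', B; split=> //.
apply: abs_series_ext (abs_series_shrink (ltW e'0) _ Af);
  last by rewrite ge_min lexx.
move=> x xe; apply: fg => j; rewrite mxE /norm1C /=.
have := xe (lshift r j); have := xe (rshift r j).
rewrite !lt_min => /andP[_ ?] /andP[_ ?]; lra.
Qed.

Lemma real_analytic_at_cst (R : realType) (r : nat) (a : R) (p : 'rV[R[i]]_r) :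
  real_analytic_at (fun=> a) p.
Proof. by apply/real_analytic_atP; exists 1, `|a|; split=> //;
  apply: abs_series_cst. Qed.

Lemma real_analytic_atD (R : realType) (r : nat) (f g : 'rV[R[i]]_r -> R) p :
  real_analytic_at f p -> real_analytic_at g p ->
  real_analytic_at (fun z => f z + g z) p.
Proof.
move=> /real_analytic_atP[e [B [e0 Af]]] /real_analytic_atP[d [B' [d0 Ag]]].
have m0 : 0 < Num.min e d by rewrite lt_min e0.
apply/real_analytic_atP; exists (Num.min e d), (B + B'); split=> //.
by apply: abs_seriesD;
  [exact: ltW|apply: abs_series_shrink Af|apply: abs_series_shrink Ag];
  rewrite ?(ltW m0) // ge_min lexx ?orbT.
Qed.

Lemma real_analytic_atM (R : realType) (r : nat) (f g : 'rV[R[i]]_r -> R) p :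
  real_analytic_at f p -> real_analytic_at g p ->
  real_analytic_at (fun z => f z * g z) p.
Proof.
move=> /real_analytic_atP[e [B [e0 Af]]] /real_analytic_atP[d [B' [d0 Ag]]].
have m0 : 0 < Num.min e d by rewrite lt_min e0.
apply/real_analytic_atP; exists (Num.min e d), (B * B'); split=> //.
by apply: abs_seriesM => //;
  [apply: abs_series_shrink Af|apply: abs_series_shrink Ag];
  rewrite ?(ltW m0) // ge_min lexx ?orbT.
Qed.

(** Without constant term every monomial has degree at least 1 and gains a factor th when the radius
    is multiplied by th. This makes the increment of an inner map small enough for substitution. *)
Lemma abs_series_scale_radius (R : realType) (T : finType) (e th B : R)
    (f : (T -> R) -> R) : 0 < e -> 0 <= th <= 1 -> abs_series e B f ->
  f (fun=> 0) = 0 -> abs_series (th * e) (th * B) f.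
Proof.
move=> e0 /andP[t0 t1] [c H] f0.
have [cB cf] := H; have c0 := power_sum_at0 e0 H; rewrite f0 in c0.
have te : th * e <= e by rewrite ler_piMl // ltW.
exists c; split=> [N|x xe]; last by apply: cf => i; apply: lt_le_trans te.
apply: (@le_trans _ _ (th * \sum_(al <- box T N) `|c al| * e ^+ mdeg al));
  last first.
  by rewrite ler_wpM2l.
rewrite mulr_sumr; apply: ler_sum => al _.
have [->|al0] := eqVneq al (mzero T); first by rewrite -c0 normr0 !mul0r mulr0.
rewrite mulrCA ler_wpM2l // exprMn ler_wpM2r ?exprn_ge0 ?(ltW e0) //.
case E : (mdeg al) => [|n].
  have [] := @mdeg_le1 _ al; first by rewrite E.
    by move/eqP; rewrite (negPf al0).
  by move=> [i ali]; rewrite ali mdeg_munit in E.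
by rewrite exprS ler_piMr // exprn_ile1.
Qed.

Lemma real_analytic_comp (R : realType) (r s : nat) (f : 'rV[R[i]]_s -> R)
    (F : 'rV[R[i]]_r -> 'rV[R[i]]_s) p :
  (forall j, cplx_real_analytic_at (fun z => F z 0 j) p) ->
  real_analytic_at f (F p) -> real_analytic_at (f \o F) p.
Proof.
move=> aF /real_analytic_atP[e1 [B1 [e10 Af]]].
have /choice[E HE] : forall t : 'I_(s + s), exists eB : R * R, 0 < eB.1 /\
    abs_series eB.1 eB.2 (fun x => crd (F (p + cvec x) - F p) t).
  have shift0 (g : 'rV[R[i]]_r -> R) : real_analytic_at g p ->
      exists eB : R * R, 0 < eB.1 /\ abs_series eB.1 eB.2 (fun x =>
        g (p + cvec x) - g p).
    move=> H; have := real_analytic_atD H (real_analytic_at_cst (- g p) p).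
    by move=> /real_analytic_atP[e [B ?]]; exists (e, B).
  apply: ord_addP => j; have [aR aI] := aF j.
    have [eB [? H]] := shift0 _ aR; exists eB; split=> //.
    by apply: abs_series_ext H => x _; rewrite crdl !mxE reCD reCN.
  have [eB [? H]] := shift0 _ aI; exists eB; split=> //.
  by apply: abs_series_ext H => x _; rewrite crdr !mxE imCD imCN.
pose e := \big[Num.min/1]_t (E t).1.
have e0 : 0 < e.
  by rewrite /e; elim/big_ind: _ => // [x y x0 y0|t _];
    [rewrite lt_min x0|have [] := HE t].
have eE t : e <= (E t).1 by rewrite /e (bigD1 t) //= ge_min lexx.
have Ah t : abs_series e (E t).2 (fun x => crd (F (p + cvec x) - F p) t).
  by apply: abs_series_shrink (eE t) (HE t).2; exact: ltW.
have b0 t := abs_series_ge0 e0 (Ah t).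
pose S := 1 + e1 + \sum_t (E t).2.
have ES t : (E t).2 <= S.
  have H0 : 0 <= \sum_(t' | t' != t) (E t').2 by apply: sumr_ge0.
  by rewrite /S (bigD1 t) //=; lra.
have S0 : 0 <= \sum_t (E t).2 by rewrite sumr_ge0.
have Spos : 0 < S by rewrite /S; lra.
(* S dominates e1 and all the norms of the components, so th is at most 1 and the scaled norms are
   at most th * S = e1 / 2, strictly below e1. *)
pose th := e1 / (2 * S).
have th0 : 0 < th by rewrite divr_gt0 // mulr_gt0.
have thS : th * S = e1 / 2 by rewrite /th; field; rewrite gt_eqF.
have th1 : th <= 1.
  by rewrite ler_pdivrMr ?mulr_gt0 // mul1r /S; lra.
have the0 : 0 < th * e by rewrite mulr_gt0.
apply/real_analytic_atP; exists (th * e), B1; split=> //.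
have H t : abs_series (th * e) (th * (E t).2) (fun x =>
  crd (F (p + cvec x) - F p) t).
  apply: abs_series_scale_radius => //; first by rewrite ltW.
  by rewrite cvec0 addr0 subrr; move: t {S S0 ES Spos th th0 thS th1 the0};
    apply: ord_addP => j; rewrite ?crdl ?crdr mxE.
apply: abs_series_ext (abs_series_comp the0 Af H _) => [x _ /=|t].
  by rewrite (crdK (F (p + cvec x) - F p)) addrC subrK.
apply: (@le_lt_trans _ _ (th * S)); first by rewrite ler_wpM2l // ltW.
by rewrite thS; lra.
Qed.

Definition cabs_series (R : realType) (T : finType) (e B : R) (f : (T -> R) ->
  R[i]) :=
  exists b1 b2, [/\ b1 + b2 <= B, abs_series e b1 (fun x => complex.Re (f x)) &
    abs_series e b2 (fun x => complex.Im (f x))].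

Lemma cabs_series_cst (R : realType) (T : finType) (e : R) (a : R[i]) : 0 <= e
  ->
  @cabs_series R T e (norm1C a) (fun=> a).
Proof.
by move=> e0; exists `|complex.Re a|, `|complex.Im a|; split=> //;
  exact: abs_series_cst.
Qed.

(** Bounding the sum of the norms of the real and imaginary parts keeps the norm submultiplicative:
    the four products add up to exactly (b1 + b2) * (d1 + d2). *)
Lemma cabs_seriesM (R : realType) (T : finType) (e B B' : R) (f g : (T -> R) ->
  R[i]) :
  0 < e -> cabs_series e B f -> cabs_series e B' g -> cabs_series e (B * B')
    (fun x => f x * g x).
Proof.
move=> e0 [b1 [b2 [bB Rf If]]] [d1 [d2 [dB Rg Ig]]].
have := (abs_series_ge0 e0 Rf, abs_series_ge0 e0 If, abs_series_ge0 e0 Rg,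
  abs_series_ge0 e0 Ig).
move=> [[[b10 b20] d10] d20].
have negI : abs_series e (b2 * d2) (fun x =>
  - (complex.Im (f x) * complex.Im (g x))).
  have := abs_seriesM e0 (@abs_series_cst R T e (-1) (ltW e0)) (abs_seriesM e0
    If Ig).
  by rewrite normrN1 mul1r; apply: abs_series_ext => x _; rewrite mulN1r.
exists (b1 * d1 + b2 * d2), (b1 * d2 + b2 * d1); split.
- apply: (@le_trans _ _ ((b1 + b2) * (d1 + d2))); first by rewrite le_eqVlt;
  apply/orP; left; apply/eqP; ring.
  by apply: ler_pM => //; rewrite addr_ge0.
- by apply: abs_series_ext (abs_seriesD (ltW e0) (abs_seriesM e0 Rf Rg) negI)
  => x _; rewrite reCM.
by apply: abs_series_ext (abs_seriesD (ltW e0) (abs_seriesM e0 Rf Ig)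
  (abs_seriesM e0 If Rg)) => x _; rewrite imCM.
Qed.

Lemma cabs_seriesX (R : realType) (T : finType) (e B : R) (f : (T -> R) ->
  R[i]) n :
  0 < e -> cabs_series e B f -> cabs_series e (B ^+ n) (fun x => f x ^+ n).
Proof.
move=> e0 Af; elim: n => [|n IH].
  have := @cabs_series_cst R T e 1 (ltW e0); rewrite norm1C_real normr1; exact.
have E : (fun x => f x ^+ n.+1) = (fun x => f x * f x ^+ n).
  by apply/funext => x; rewrite exprS.
by rewrite exprS E; apply: cabs_seriesM.
Qed.

Lemma cabs_series_mono (R : realType) (S T : finType) (e B : R)
    (h : S -> (T -> R) -> R[i]) al : 0 < e ->
  (forall i, cabs_series e B (h i)) -> cabs_series e (B ^+ mdeg al) (fun x =>
    mono (h^~ x) al).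
Proof.
move=> e0 H; rewrite expr_mdeg /mono; elim: (index_enum S) => [|i s IH].
  rewrite big_nil (_ : (fun x => _) = fun=> 1); last first.
    by apply/funext => x; rewrite big_nil.
  have := @cabs_series_cst R T e 1 (ltW e0); rewrite norm1C_real normr1; exact.
rewrite big_cons (_ : (fun x => _) = fun x =>
    h i x ^+ al i * \prod_(j <- s) h j x ^+ al j); last first.
  by apply/funext => x; rewrite big_cons.
by apply: cabs_seriesM => //; apply: cabs_seriesX.
Qed.

Lemma cabs_series_ReIm (R : realType) (T : finType) (e B : R) (f : (T -> R) ->
  R[i]) :
  0 < e -> cabs_series e B f -> abs_series e B (fun x => complex.Re (f x)) /\
  abs_series e B (fun x => complex.Im (f x)).
Proof.
move=> e0 [b1 [b2 [bB Rf If]]].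
have := (abs_series_ge0 e0 Rf, abs_series_ge0 e0 If) => -[b10 b20].
by split; [apply: abs_series_weaken Rf|apply: abs_series_weaken If]; lra.
Qed.

Lemma cvg_ReIm (R : realType) (s : nat -> R[i]) (l : R[i]) :
  s @ \oo --> l -> (fun N => complex.Re (s N)) @ \oo --> complex.Re l /\
  (fun N => complex.Im (s N)) @ \oo --> complex.Im l.
Proof.
move=> /cvgrPdist_lt sl; split; apply/cvgrPdist_lt => eps e0.
  have [|N0 _ H] := sl (eps / 2)%:C; first by rewrite ltcR divr_gt0.
  exists N0 => // N /= /H /= HN; rewrite -ltcR -reCN -reCD.
  by apply: le_lt_trans (normc_ge_Re _) (lt_trans HN _); rewrite ltcR; lra.
have [|N0 _ H] := sl (eps / 2)%:C; first by rewrite ltcR divr_gt0.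
exists N0 => // N /= /H /= HN; rewrite -imCN -imCD.
apply: le_lt_trans (Im_le_norm1C _) _; rewrite -ltcR.
apply: le_lt_trans (norm1C_le_norm _) _.
rewrite (_ : eps%:C = 2 * (eps / 2)%:C); first by rewrite ltr_pM2l.
by apply: complex_eqP; rewrite ?reCM ?imCM /=; lra.
Qed.

(** Substituting z_j = x_j + i y_j into the complex series and separating real and imaginary parts
    gives two real series of monomials in the x_j and y_j. *)
Lemma analytic_at_cplx_real (R : realType) (r : nat) (f : 'rV[R[i]]_r -> R[i])
    p : analytic_at f p -> cplx_real_analytic_at f p.
Proof.
move=> /analytic_at_power_sumP[e [B [c [e0 [cB cf]]]]].
have [e' Ee] : exists e', e = e'%:C by apply/complex_realP; exact: gtr0_real.
rewrite Ee ltcR in e0; subst e.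
(* Each z_j has norm 2 * d at radius d, and 2 * d = e' / 2 lies below the radius of the given
   series. *)
pose d := e' / 4; have d0 : 0 < d by rewrite divr_gt0.
pose z (j : 'I_r) (x : 'I_(r + r) -> R) := (cvec x) 0 j.
have Az j : cabs_series d (2 * d) (z j).
  exists d, d; split; first lra.
    have := @abs_series_coord R _ d (lshift r j) (ltW d0).
    by apply: abs_series_ext => x _; rewrite /z mxE.
  have := @abs_series_coord R _ d (rshift r j) (ltW d0).
  by apply: abs_series_ext => x _; rewrite /z mxE.
have Aterm al : cabs_series d (norm1C (c al) * (2 * d) ^+ mdeg al)
    (fun x => c al * mono (z^~ x) al).
  by apply: cabs_seriesM => //; [apply: cabs_series_cst;
    exact: ltW|exact: cabs_series_mono].
have bound N : \sum_(al <- box _ N) norm1C (c al) * (2 * d) ^+ mdeg al <=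
    2 * complex.Re B.
  have : (\sum_(al <- box _ N) norm1C (c al) * (2 * d) ^+ mdeg al)%:C <= 2 * B.
    apply: le_trans (_ : _ <= 2 * \sum_(al <- box _ N) `|c al| * e'%:C ^+ mdeg
      al) _; last first.
      by rewrite ler_pM2l.
    rewrite rmorph_sum mulr_sumr /=; apply: ler_sum => al _.
    rewrite rmorphM rmorphXn mulrA /=; apply: ler_pM.
    - by rewrite lecR norm1C_ge0.
    - by rewrite exprn_ge0 // lecR mulr_ge0 // ltW.
    - exact: norm1C_le_norm.
    by rewrite lerXn2r ?nnegrE ?lecR // /d; lra.
  by rewrite (mulr_natl B 2) mulr2n lecE reCD /= => /andP[_]; lra.
have lim x : (forall s, `|x s| < d) ->
    (fun N => \sum_(al <- box _ N) c al * mono (z^~ x) al) @ \oo --> f (p +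
      cvec x).
  move=> xd; have -> : cvec x = \row_j z j x by apply/rowP => j;
    rewrite [RHS]mxE.
  apply: (cf (z^~ x)) => j; apply: le_lt_trans (norm_le_norm1C _) _.
  rewrite ltcR /z mxE /norm1C /=; have := xd (lshift r j);
    have := xd (rshift r j).
  by rewrite /d; lra.
split; apply/real_analytic_atP; exists d, (2 * complex.Re B); split=> //.
  apply: (abs_series_box_series d0 (fun al =>
    (cabs_series_ReIm d0 (Aterm al)).1) bound) => x xd.
  under eq_fun do rewrite -reC_sum.
  by have [] := cvg_ReIm (lim x xd).
apply: (abs_series_box_series d0 (fun al =>
  (cabs_series_ReIm d0 (Aterm al)).2) bound) => x xd.
under eq_fun do rewrite -imC_sum.
by have [] := cvg_ReIm (lim x xd).
Qed.

(** * Wirtinger derivatives *)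

(* The real tangent vector v as the complexified vector (v, conj v). *)
Definition hat (R : realType) (r : nat) (v : 'rV[R[i]]_r) : 'rV[R[i]]_(r + r) :=
  row_mx v (map_mx (@conjc R) v).

Lemma hatl (R : realType) (r : nat) (v : 'rV[R[i]]_r) j :
  hat v 0 (lshift r j) = v 0 j.
Proof. by rewrite row_mxEl. Qed.

Lemma hatr (R : realType) (r : nat) (v : 'rV[R[i]]_r) j :
  hat v 0 (rshift r j) = (v 0 j)^*.
Proof. by rewrite row_mxEr mxE. Qed.

Lemma norm1C_hat (R : realType) (r : nat) (v : 'rV[R[i]]_r) (e : R) :
  (forall j, norm1C (v 0 j) <= e) -> forall s, norm1C (hat v 0 s) <= e.
Proof.
by move=> H; apply: ord_addP => j; rewrite ?hatl ?hatr ?norm1C_conj; apply: H.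
Qed.

(* First order expansion in dz and dzbar, D listing the coefficients of
   dz_1, ..., dz_r, dzbar_1, ..., dzbar_r.  The same K bounds the remainder, the
   increment and the inverse of the radius, so that the property only
   gets weaker when K grows. *)
Definition wexpansion (R : realType) (r : nat) (K : R) (f : 'rV[R[i]]_r -> R[i])
    (p : 'rV[R[i]]_r) (D : 'I_(r + r) -> R[i]) : Prop :=
  1 <= K /\ forall (v : 'rV[R[i]]_r) (rho : R), 0 <= rho -> K * rho < 1 ->
    (forall j, norm1C (v 0 j) <= rho) ->
    norm1C (f (p + v) - f p) <= K * rho /\
    norm1C (f (p + v) - f p - \sum_s D s * hat v 0 s) <= K * rho ^+ 2.

Definition wdiff (R : realType) (r : nat) (f : 'rV[R[i]]_r -> R[i])
    (p : 'rV[R[i]]_r) (D : 'I_(r + r) -> R[i]) : Prop :=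
  exists K : R, wexpansion K f p D.

Lemma wexpansion_weaken (R : realType) (r : nat) (K K' : R) (f : 'rV[R[i]]_r ->
  R[i])
    p D : K <= K' -> wexpansion K f p D -> wexpansion K' f p D.
Proof.
move=> KK [K1 H]; split=> [|v rho r0 Kr vr]; first lra.
have KKr : K * rho <= K' * rho by rewrite ler_wpM2r.
have [H1 H2] := H v rho r0 (le_lt_trans KKr Kr) vr.
split; first lra.
by apply: le_trans H2 _; rewrite ler_wpM2r // exprn_ge0.
Qed.

(** Only the quadratic remainder has to be estimated, on any neighbourhood: the bound on the
    increment follows from it and from the linear part. *)
Lemma wdiffI (R : realType) (r : nat) (K d : R) (f : 'rV[R[i]]_r -> R[i])
    p (D : 'I_(r + r) -> R[i]) : 0 < d ->
  (forall (v : 'rV[R[i]]_r) (rho : R), 0 <= rho -> rho < d ->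
    (forall j, norm1C (v 0 j) <= rho) ->
    norm1C (f (p + v) - f p - \sum_s D s * hat v 0 s) <= K * rho ^+ 2) ->
  wdiff f p D.
Proof.
move=> d0 H; pose S := \sum_s norm1C (D s).
have S0 : 0 <= S by apply: sumr_ge0 => s _; exact: norm1C_ge0.
have di : 0 < d^-1 by rewrite invr_gt0.
have Kd : 0 <= `|K| * d by rewrite mulr_ge0 // ltW.
(* The summand d^-1 forces rho < d, |K| bounds the remainder, and |K| * d + S bounds the increment,
   since the remainder is at most |K| * d * rho and the linear part at most S * rho. *)
exists (1 + d^-1 + `|K| + `|K| * d + S); split; first by have := normr_ge0 K;
  lra.
move=> v rho r0 Kr vr; have nK := normr_ge0 K.
have rd : rho < d.
  have : d^-1 * rho < 1.
    by apply: le_lt_trans Kr; apply: ler_wpM2r => //; lra.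
  by rewrite mulrC ltr_pdivrMr // mul1r.
have Hrem : norm1C (f (p + v) - f p - \sum_s D s * hat v 0 s) <= `|K| * rho ^+
  2.
  apply: le_trans (H v rho r0 rd vr) _; rewrite ler_wpM2r ?exprn_ge0 //.
  exact: ler_norm.
split; last first.
  by apply: le_trans Hrem _; rewrite ler_wpM2r ?exprn_ge0 //; lra.
have Hlin : norm1C (\sum_s D s * hat v 0 s) <= S * rho.
  apply: le_trans (norm1C_sum _ _ _) _; rewrite mulr_suml; apply: ler_sum =>
    s _.
  apply: le_trans (norm1CM _ _) _; rewrite ler_wpM2l ?norm1C_ge0 //;
    exact: norm1C_hat.
rewrite -[X in norm1C X](subrK (\sum_s D s * hat v 0 s)).
apply: le_trans (norm1CD _ _) _;
  apply: (@le_trans _ _ (`|K| * d * rho + S * rho)).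
  apply: lerD => //; apply: le_trans Hrem _.
  by rewrite expr2 mulrA ler_wpM2r // ler_wpM2l // ltW.
by rewrite -mulrDl ler_wpM2r //; lra.
Qed.

Lemma wdiff_near (R : realType) (r : nat) (f g : 'rV[R[i]]_r -> R[i]) p D :
  (\forall z \near p, f z = g z) -> wdiff f p D -> wdiff g p D.
Proof.
move=> /near_norm1CP[d d0 fg] [K [K1 H]].
have pp : f p = g p by rewrite -[p]addr0 fg // => j; rewrite mxE norm1C0.
pose d' := Num.min d K^-1.
have d'0 : 0 < d' by rewrite lt_min d0 invr_gt0; lra.
apply: (@wdiffI _ _ K d') => // v rho r0; rewrite lt_min => /andP[rd rK] vr.
have Kr : K * rho < 1.
  by rewrite mulrC -ltr_pdivlMr ?div1r //; lra.
rewrite -fg -?pp; first by have [] := H v rho r0 Kr vr.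
by move=> j; apply: le_lt_trans rd.
Qed.

Lemma wdiff_cst (R : realType) (r : nat) (a : R[i]) (p : 'rV[R[i]]_r) :
  wdiff (fun=> a) p (fun=> 0).
Proof.
apply: (@wdiffI _ _ 0 1) => // v rho _ _ _.
by rewrite subrr sub0r big1 ?oppr0 ?norm1C0 ?mul0r // => s _; rewrite mul0r.
Qed.

Lemma wdiffD (R : realType) (r : nat) (f g : 'rV[R[i]]_r -> R[i]) p D D' :
  wdiff f p D -> wdiff g p D' ->
  wdiff (fun z => f z + g z) p (fun s => D s + D' s).
Proof.
move=> [K [K1 Hf]] [K' [K'1 Hg]]; exists (K + K'); split=> [|v rho r0 Kr vr].
  lra.
have K0 : 0 <= K * rho by rewrite mulr_ge0 //; lra.
have K'0 : 0 <= K' * rho by rewrite mulr_ge0 //; lra.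
rewrite mulrDl in Kr.
have [|Hf1 Hf2] := Hf v rho r0 _ vr; first lra.
have [|Hg1 Hg2] := Hg v rho r0 _ vr; first lra.
under eq_bigr do rewrite mulrDl; rewrite big_split /= !mulrDl; split.
  by rewrite opprD addrACA; apply: le_trans (norm1CD _ _) _; lra.
set A := \sum_s D s * _ in Hf2 *; set B := \sum_s D' s * _ in Hg2 *.
rewrite (_ : _ - _ - _ = (f (p + v) - f p - A) + (g (p + v) - g p - B));
  last ring.
by apply: le_trans (norm1CD _ _) _; lra.
Qed.

Lemma wdiffM (R : realType) (r : nat) (f g : 'rV[R[i]]_r -> R[i]) p D D' :
  wdiff f p D -> wdiff g p D' ->
  wdiff (fun z => f z * g z) p (fun s => g p * D s + f p * D' s).
Proof.
move=> [K [K1 Hf]] [K' [K'1 Hg]].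
have KK : 0 < K + K' by lra.
apply: (@wdiffI _ _ (K * K' + norm1C (f p) * K' + norm1C (g p) * K) (K +
  K')^-1).
  by rewrite invr_gt0.
move=> v rho r0 rK vr.
have {rK}Kr : (K + K') * rho < 1.
  by rewrite mulrC -ltr_pdivlMr // div1r.
have K0 : 0 <= K * rho by rewrite mulr_ge0 //; lra.
have K'0 : 0 <= K' * rho by rewrite mulr_ge0 //; lra.
rewrite mulrDl in Kr.
have [|Hf1 Hf2] := Hf v rho r0 _ vr; first lra.
have [|Hg1 Hg2] := Hg v rho r0 _ vr; first lra.
have -> : \sum_s (g p * D s + f p * D' s) * hat v 0 s =
    g p * (\sum_s D s * hat v 0 s) + f p * (\sum_s D' s * hat v 0 s).
  rewrite !mulr_sumr -big_split; apply: eq_bigr => s _ /=; ring.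
set A := \sum_s D s * _ in Hf2 *; set B := \sum_s D' s * _ in Hg2 *.
have -> : f (p + v) * g (p + v) - f p * g p - (g p * A + f p * B) =
    (f (p + v) - f p) * (g (p + v) - g p) + f p * (g (p + v) - g p - B) +
    g p * (f (p + v) - f p - A) by ring.
rewrite [leRHS](_ : _ = K * K' * rho ^+ 2 + norm1C (f p) * K' * rho ^+ 2 +
  norm1C (g p) * K * rho ^+ 2); last ring.
apply: le_trans (norm1CD _ _) _; apply: lerD; last first.
  by apply: le_trans (norm1CM _ _) _; rewrite -mulrA ler_wpM2l ?norm1C_ge0.
apply: le_trans (norm1CD _ _) _; apply: lerD; last first.
  by apply: le_trans (norm1CM _ _) _; rewrite -mulrA ler_wpM2l ?norm1C_ge0.
apply: le_trans (norm1CM _ _) _; rewrite expr2 mulrACA.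
by apply: ler_pM; rewrite ?norm1C_ge0.
Qed.

Lemma wdiffZ (R : realType) (r : nat) (a : R[i]) (f : 'rV[R[i]]_r -> R[i]) p D :
  wdiff f p D -> wdiff (fun z => a * f z) p (fun s => a * D s).
Proof.
move=> Df; have := wdiffM (wdiff_cst a p) Df.
by congr wdiff; apply/funext => s; rewrite mulr0 add0r.
Qed.

Lemma wdiff_sum (R : realType) (r : nat) (I : Type) (l : seq I)
    (f : I -> 'rV[R[i]]_r -> R[i]) p D : (forall i, wdiff (f i) p (D i)) ->
  wdiff (fun z => \sum_(i <- l) f i z) p (fun s => \sum_(i <- l) D i s).
Proof.
move=> H; elim: l => [|i l IH].
  rewrite (_ : (fun z => _) = fun=> 0); last by apply/funext => z;
    rewrite big_nil.
  by have := wdiff_cst 0 p; congr wdiff; apply/funext => s; rewrite big_nil.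
have := wdiffD (H i) IH.
by congr wdiff; apply/funext => z; rewrite big_cons.
Qed.

Lemma split_lshift r (j : 'I_r) : fintype.split (lshift r j) = inl j.
Proof. exact: (unsplitK (inl j : 'I_r + 'I_r)). Qed.

Lemma split_rshift r (j : 'I_r) : fintype.split (rshift r j) = inr j.
Proof. exact: (unsplitK (inr j : 'I_r + 'I_r)). Qed.

Definition blocks (K : Type) (r : nat) (a b : 'I_r -> K) (s : 'I_(r + r)) : K :=
  match fintype.split s with inl j => a j | inr j => b j end.

Lemma blocksl (K : Type) (r : nat) (a b : 'I_r -> K) j :
  blocks a b (lshift r j) = a j.
Proof. by rewrite /blocks split_lshift. Qed.

Lemma blocksr (K : Type) (r : nat) (a b : 'I_r -> K) j :
  blocks a b (rshift r j) = b j.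
Proof. by rewrite /blocks split_rshift. Qed.

Lemma sum_hat (R : realType) (r : nat) (D : 'I_(r + r) -> R[i]) v :
  \sum_s D s * hat v 0 s =
  \sum_j (D (lshift r j) * v 0 j + D (rshift r j) * (v 0 j)^*).
Proof.
rewrite big_split_ord /= -big_split /=.
by apply: eq_bigr => j _; rewrite hatl hatr.
Qed.

Lemma wdiff_conj (R : realType) (r : nat) (f : 'rV[R[i]]_r -> R[i]) p D :
  wdiff f p D -> wdiff (fun z => (f z)^*) p
    (blocks (fun j => (D (rshift r j))^*) (fun j => (D (lshift r j))^*)).
Proof.
move=> [K [K1 H]]; exists K; split=> // v rho r0 Kr vr.
have [H1 H2] := H v rho r0 Kr vr.
rewrite -rmorphB norm1C_conj; split=> //.
rewrite (_ : \sum_s _ = (\sum_s D s * hat v 0 s)^*).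
  by rewrite -rmorphB norm1C_conj.
rewrite !sum_hat rmorph_sum; apply: eq_bigr => j _ /=.
by rewrite blocksl blocksr rmorphD !rmorphM /= conjcK addrC.
Qed.

(** The components of F have no dzbar terms, so the dz and dzbar coefficients of f are transformed
    separately, by J and by its conjugate. *)
Lemma wdiff_comp (R : realType) (r t : nat) (f : 'rV[R[i]]_t -> R[i])
    (F : 'rV[R[i]]_r -> 'rV[R[i]]_t) p D (J : 'I_t -> 'I_r -> R[i]) :
  (forall i, wdiff (fun z => F z 0 i) p (blocks (J i) (fun=> 0))) ->
  wdiff f (F p) D ->
  wdiff (f \o F) p (blocks (fun j => \sum_i D (lshift t i) * J i j)
    (fun j => \sum_i D (rshift t i) * (J i j)^* )).
Proof.
move=> /choice[K0 HF] [L [L1 Hf]].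
pose K := 1 + \sum_i K0 i.
have K0pos i : 0 <= K0 i by have [] := HF i; lra.
have K0K i : K0 i <= K.
  have H0 : 0 <= \sum_(i' | i' != i) K0 i' by apply: sumr_ge0.
  by rewrite /K (bigD1 i) //=; lra.
have K1 : 1 <= K by rewrite /K lerDl sumr_ge0.
have LK : 0 < (L * K) by rewrite mulr_gt0 //; lra.
have LK' : K <= L * K by rewrite ler_peMl //; lra.
apply: (@wdiffI _ _ (L * K ^+ 2 + \sum_s norm1C (D s) * K) (L * K)^-1).
  by rewrite invr_gt0.
move=> v rho r0 rK vr.
have {rK}Kr : L * K * rho < 1.
  by rewrite mulrC -ltr_pdivlMr // div1r.
have Kr' : K * rho < 1.
  by apply: le_lt_trans Kr; rewrite ler_wpM2r.
pose w := F (p + v) - F p.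
have wE i : w 0 i = F (p + v) 0 i - F p 0 i by rewrite !mxE.
have H1 i : norm1C (w 0 i) <= K * rho /\ norm1C (w 0 i - \sum_j J i j * v 0 j)
  <= K * rho ^+ 2.
  have [_ /(_ v rho r0 Kr' vr)] := wexpansion_weaken (K0K i) (HF i).
  rewrite wE sum_hat; under eq_bigr do rewrite blocksl blocksr mul0r addr0.
  by [].
have Kr0 : 0 <= K * rho by rewrite mulr_ge0 //; lra.
have LKr : L * (K * rho) < 1 by rewrite mulrA.
have [_ H2] := Hf w (K * rho) Kr0 LKr (fun i => (H1 i).1).
move: H2; rewrite {1}/w [F p + _]addrC subrK /= exprMn => H2.
set A := \sum_s D s * hat w 0 s in H2.
set B := \sum_s _.
have -> : f (F (p + v)) - f (F p) - B = (f (F (p + v)) - f (F p) - A) + (A - B)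
  by ring.
apply: le_trans (norm1CD _ _) _; rewrite mulrDl -mulrA; apply: lerD => //.
(* The two linear parts differ by D applied to the remainder of F, which is already quadratic in
   rho. *)
have -> : A - B = \sum_s D s * blocks
    (fun i => w 0 i - \sum_j J i j * v 0 j)
    (fun i => (w 0 i - \sum_j J i j * v 0 j)^*) s.
  rewrite /A /B !sum_hat [RHS]big_split_ord /= -[RHS]big_split /=.
  have -> : \sum_j (blocks (fun j => \sum_i D (lshift t i) * J i j)
    (fun j => \sum_i D (rshift t i) * (J i j)^* ) (lshift r j) * v 0 j +
     blocks (fun j => \sum_i D (lshift t i) * J i j)
    (fun j => \sum_i D (rshift t i) * (J i j)^* ) (rshift r j) * (v 0 j)^* ) =
    \sum_i (D (lshift t i) * (\sum_j J i j * v 0 j) +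
       D (rshift t i) * (\sum_j J i j * v 0 j)^* ).
    under eq_bigr do rewrite blocksl blocksr !mulr_suml -big_split /=.
    rewrite exchange_big; apply: eq_bigr => i _ /=.
    rewrite rmorph_sum !mulr_sumr -big_split; apply: eq_bigr => j _ /=.
    by rewrite rmorphM !mulrA.
  rewrite -sumrB; apply: eq_bigr => i _.
  by rewrite blocksl blocksr rmorphB; ring.
apply: le_trans (norm1C_sum _ _ _) _; rewrite mulr_suml; apply: ler_sum => s _.
apply: le_trans (norm1CM _ _) _; rewrite -mulrA ler_wpM2l ?norm1C_ge0 //.
move: s; apply: ord_addP => i; rewrite ?blocksl ?blocksr ?norm1C_conj;
  exact: (H1 i).2.
Qed.

(** * From expansions to the derivatives of the definitions *)

Lemma hatZ (R : realType) (r : nat) (h : R) (v : 'rV[R[i]]_r) s :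
  hat (h%:C *: v) 0 s = h%:C * hat v 0 s.
Proof.
move: s; apply: ord_addP => j; rewrite ?hatl ?hatr !mxE // rmorphM /=.
by congr (_ * _); apply: complex_eqP; rewrite /= ?oppr0.
Qed.

Lemma real_derive_eq (R : realType) (r : nat) (g : 'rV[R[i]]_r -> R)
    (p w : 'rV[R[i]]_r) (l K d : R) : 0 < d ->
  (forall h : R, `|h| < d -> `|g (p + h%:C *: w) - g p - h * l| <= K * h ^+ 2)
    ->
  'D_(real_coords w) (g \o @of_real_coords R r) (real_coords p) = l.
Proof.
move=> d0 H; rewrite /derive; apply: cvg_lim => //.
have E h : of_real_coords (h *: real_coords w + real_coords p) = p + h%:C *: w.
  rewrite addrC (_ : h *: _ = \row_s (h * crd w s)); last first.
    by apply/rowP => s; rewrite [LHS]mxE [RHS]mxE.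
  rewrite of_real_coordsD; congr (_ + _); apply/rowP => j.
  by rewrite !mxE crdl crdr; apply: complex_eqP; rewrite ?reCM ?imCM /=; ring.
have E0 : of_real_coords (real_coords p) = p.
  by have := E 0; rewrite !scale0r add0r addr0.
apply/cvgrPdist_le => eps eps0.
have K0 : 0 < 1 + `|K| by have := normr_ge0 K; lra.
pose d' := Num.min d (eps / (1 + `|K|)).
have d'0 : 0 < d' by rewrite lt_min d0 divr_gt0.
exists d'; first exact: d'0.
move=> h; rewrite /ball_ /= sub0r normrN lt_min => /andP[hd hK] h0.
have {}H := H h hd.
rewrite E E0 /=; have hn0 : 0 < `|h| by rewrite normr_gt0.
have -> : l - h^-1 *: (g (p + h%:C *: w) - g p) =
    - (h^-1 * (g (p + h%:C *: w) - g p - h * l)).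
  by rewrite /GRing.scale /=; field.
rewrite normrN normrM normfV ler_pdivrMl //.
apply: le_trans H _; rewrite -real_normK ?num_real // expr2 mulrCA.
rewrite ler_wpM2l //; apply: le_trans (_ : _ <= (1 + `|K|) * `|h|) _.
  by rewrite ler_wpM2r //; have := ler_norm K; lra.
by rewrite mulrC -ler_pdivlMr // ltW.
Qed.

Lemma wdiff_derive (R : realType) (r : nat) (f : 'rV[R[i]]_r -> R[i]) p D w :
  wdiff f p D ->
  'D_(real_coords w) ((fun z => complex.Re (f z)) \o @of_real_coords R r)
     (real_coords p) = complex.Re (\sum_s D s * hat w 0 s) /\
  'D_(real_coords w) ((fun z => complex.Im (f z)) \o @of_real_coords R r)
     (real_coords p) = complex.Im (\sum_s D s * hat w 0 s).
Proof.
(* W dominates every component of w, so that h times w has size at most W * |h|; the summand 1 keeps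
   W positive when w = 0. *)
move=> [K [K1 H]]; pose W := 1 + \sum_j norm1C (w 0 j).
have W0 : 0 < W.
  have : 0 <= \sum_j norm1C (w 0 j) by apply: sumr_ge0 => j _;
    exact: norm1C_ge0.
  by rewrite /W; lra.
have KW0 : 0 < K * W by rewrite mulr_gt0 //; lra.
have H' h : `|h| < (K * W)^-1 -> norm1C (f (p + h%:C *: w) - f p -
    h%:C * (\sum_s D s * hat w 0 s)) <= K * W ^+ 2 * h ^+ 2.
  rewrite -[_^-1]mul1r ltr_pdivlMr // => hK.
  have [||j|_] := H (h%:C *: w) (W * `|h|).
  - by rewrite mulr_ge0 // ltW.
  - by rewrite mulrA mulrC.
  - rewrite mxE; apply: le_trans (norm1CM _ _) _;
    rewrite norm1C_real mulrC ler_wpM2r //.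
    have H0 : 0 <= \sum_(i | i != j) norm1C (w 0 i).
      by apply: sumr_ge0 => i _; exact: norm1C_ge0.
    by rewrite /W (bigD1 j) //=; have := norm1C_ge0 (w 0 j); lra.
  rewrite mulr_sumr exprMn real_normK ?num_real // mulrA.
  by under eq_bigr do rewrite hatZ mulrCA.
have ReR h (z : R[i]) : complex.Re (h%:C * z) = h * complex.Re z.
  by rewrite reCM /= mul0r subr0.
have ImR h (z : R[i]) : complex.Im (h%:C * z) = h * complex.Im z.
  by rewrite imCM /= mul0r addr0.
split; apply: (@real_derive_eq _ _ _ _ _ _ (K * W ^+ 2) (K * W)^-1);
  rewrite ?invr_gt0 // => h hK.
  rewrite -ReR -!reCN -!reCD; apply: le_trans (Re_le_norm1C _) (H' h hK).
rewrite -ImR -!imCN -!imCD; apply: le_trans (Im_le_norm1C _) (H' h hK).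
Qed.

(** The real coordinate directions are the vectors e_j and i e_j, on which dz_j and dzbar_j take the
    values 1, 1 and i, -i. *)
Lemma wdiff_partial (R : realType) (r : nat) (f : 'rV[R[i]]_r -> R[i]) p D j :
  wdiff f p D ->
  cplx_partial f (lshift r j) p = D (lshift r j) + D (rshift r j) /\
  cplx_partial f (rshift r j) p = 'i%C * (D (lshift r j) - D (rshift r j)).
Proof.
move=> H.
have E (a : R[i]) : \sum_s D s * hat (a *: delta_mx 0 j) 0 s =
    D (lshift r j) * a + D (rshift r j) * a^*.
  rewrite sum_hat (bigD1 j) //= big1 ?addr0; last first.
    move=> i /negPf ij; rewrite !mxE ij andbF mulr0 rmorph0 !mulr0 addr0 //.
  by rewrite !mxE !eqxx mulr1.
have dl : delta_mx 0 (lshift r j) =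
    real_coords (1 *: delta_mx 0 j : 'rV[R[i]]_r) :> 'rV[R]_(r + r).
  apply/rowP => s; rewrite mxE -/(crd _ s) /=; move: s.
  apply: ord_addP => i;
    rewrite ?crdl ?crdr !mxE mul1r ?(inj_eq (@lshift_inj _ _)).
    by case: (i == j).
  by rewrite eq_rlshift /=; case: (i == j).
have dr : delta_mx 0 (rshift r j) =
    real_coords ('i%C *: delta_mx 0 j : 'rV[R[i]]_r) :> 'rV[R]_(r + r).
  apply/rowP => s; rewrite mxE -/(crd _ s) /=; move: s.
  apply: ord_addP => i; rewrite ?crdl ?crdr !mxE ?(inj_eq (@rshift_inj _ _)) /=.
    by rewrite eq_lrshift; case: (i == j);
      rewrite /= ?mulr0 ?mulr1 ?mul0r ?subrr.
  by case: (i == j); rewrite /= ?mulr0 ?mulr1 ?mul0r ?mul1r ?addr0 ?add0r.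
have E1 : \sum_s D s * hat (1 *: delta_mx 0 j) 0 s =
    D (lshift r j) + D (rshift r j).
  by rewrite E rmorph1 !mulr1.
have E2 : \sum_s D s * hat ('i%C *: delta_mx 0 j) 0 s =
    'i%C * (D (lshift r j) - D (rshift r j)).
  rewrite E; case: (D (lshift r j)) => a b; case: (D (rshift r j)) => a' b' /=.
  by apply: complex_eqP => /=; ring.
rewrite /cplx_partial /real_partial dl dr; split; apply: complex_eqP.
- exact: etrans (wdiff_derive _ H).1 (congr1 _ E1).
- exact: etrans (wdiff_derive _ H).2 (congr1 _ E1).
- exact: etrans (wdiff_derive _ H).1 (congr1 _ E2).
exact: etrans (wdiff_derive _ H).2 (congr1 _ E2).
Qed.

Lemma wdiff_d_dz (R : realType) (r : nat) (f : 'rV[R[i]]_r -> R[i]) p D j :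
  wdiff f p D -> d_dz f j p = D (lshift r j) /\ d_dzbar f j p = D (rshift r j).
Proof.
move=> /wdiff_partial-/(_ j)[El Er]; rewrite /d_dz /d_dzbar El Er.
have ii : 'i%C * 'i%C = -1 :> R[i] by rewrite -expr2 sqr_i.
by rewrite mulrA ii; split; field.
Qed.

Lemma wdiff_unique (R : realType) (r : nat) (f : 'rV[R[i]]_r -> R[i]) p D D' :
  wdiff f p D -> wdiff f p D' -> D = D'.
Proof.
move=> H H'; apply/funext; apply: ord_addP => j.
  by rewrite -(wdiff_d_dz j H).1 -(wdiff_d_dz j H').1.
by rewrite -(wdiff_d_dz j H).2 -(wdiff_d_dz j H').2.
Qed.

Lemma wdiff_vec_apply (R : realType) (r : nat) (f : 'rV[R[i]]_r -> R[i]) p D w :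
  wdiff f p D -> vec_apply w f p = \sum_s w 0 s * D s.
Proof.
move=> H; rewrite big_split_ord /= -big_split; apply: eq_bigr => j _ /=.
by have [-> ->] := wdiff_d_dz j H.
Qed.

(* Wirtinger derivatives of a real function with real partial derivatives g. *)
Definition wirt (R : realType) (r : nat) (g : 'I_(r + r) -> R) :
    'I_(r + r) -> R[i] :=
  blocks (fun j => ((g (lshift r j))%:C - 'i%C * (g (rshift r j))%:C) / 2)
    (fun j => ((g (lshift r j))%:C + 'i%C * (g (rshift r j))%:C) / 2).

Lemma wirt_hat (R : realType) (r : nat) (g : 'I_(r + r) -> R) v :
  \sum_s wirt g s * hat v 0 s = (\sum_s g s * crd v s)%:C.
Proof.
rewrite sum_hat big_split_ord /= -big_split /= rmorph_sum; apply: eq_bigr =>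
  j _.
rewrite /wirt blocksl blocksr crdl crdr; case: (v 0 j) => a b /=.
by apply: complex_eqP; rewrite ?reCD ?imCD ?reCM ?imCM /=; field.
Qed.

Lemma wdiff_real_partial (R : realType) (r : nat) (f : 'rV[R[i]]_r -> R) p g :
  wdiff (fun z => (f z)%:C) p (wirt g) -> forall s, real_partial f s p = g s.
Proof.
move=> /wdiff_partial H; apply: ord_addP => j; have [Hl Hr] := H j.
  have -> : real_partial f (lshift r j) p =
    complex.Re (cplx_partial (fun z => (f z)%:C) (lshift r j) p) by [].
  by rewrite Hl /wirt blocksl blocksr (_ : _ + _ = (g (lshift r j))%:C) //;
    field.
have -> : real_partial f (rshift r j) p =
  complex.Re (cplx_partial (fun z => (f z)%:C) (rshift r j) p) by [].
have ii : 'i%C * 'i%C = -1 :> R[i] by rewrite -expr2 sqr_i.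
rewrite Hr /wirt blocksl blocksr.
rewrite (_ : 'i%C * _ = - ('i%C * 'i%C) * (g (rshift r j))%:C); last by field.
by rewrite ii opprK mul1r.
Qed.

Lemma wdiff_real (R : realType) (r : nat) (f : 'rV[R[i]]_r -> R) p
    (g : 'I_(r + r) -> R) (K d : R) : 0 < d ->
  (forall (v : 'rV[R[i]]_r) (rho : R), 0 <= rho -> rho < d ->
    (forall s, `|crd v s| <= rho) ->
    `|f (p + v) - (f p + \sum_s g s * crd v s)| <= K * rho ^+ 2) ->
  wdiff (fun z => (f z)%:C) p (wirt g).
Proof.
move=> d0 H; apply: (@wdiffI _ _ K d) => // v rho r0 rd vr.
by rewrite wirt_hat -!rmorphB norm1C_real -addrA -opprD /= H //;
  exact: crd_le_norm1C.
Qed.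

Lemma real_analytic_deriv (R : realType) (r : nat) (f : 'rV[R[i]]_r -> R) p :
  real_analytic_at f p ->
  [/\ \forall z \near p,
        wdiff (fun z => (f z)%:C) z (wirt (fun s => real_partial f s z)),
      forall s, real_analytic_at (real_partial f s) p &
      forall s t, real_partial (real_partial f s) t p =
        real_partial (real_partial f t) s p].
Proof.
move=> /real_analytic_atP[e' [B [e'0 Af]]].
pose e := e' / 3; have e0 : 0 < e by rewrite divr_gt0.
have [|g [H [Ag fg gH Hsym]]] := abs_series_deriv e0 (B := B) (f := fun x =>
  f (p + cvec x)).
  by rewrite /e (_ : 3 * _ = e') //; field.
have fW (v : 'rV[R[i]]_r) : (forall j, norm1C (v 0 j) < e) ->
    wdiff (fun z => (f z)%:C) (p + v) (wirt (g^~ (crd v))).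
  move=> ve; apply: (@wdiff_real _ _ _ _ _ (B / e ^+ 2) e) => // w rho r0 re wr.
  have := fg (crd v) (crd w) rho (crd_lt_norm1C ve) r0 re wr.
  rewrite cvecD !crdK addrA (_ : (rho / e) ^+ 2 * B = B / e ^+ 2 * rho ^+ 2) //.
  by field; rewrite gt_eqF.
have fR (v : 'rV[R[i]]_r) : (forall j, norm1C (v 0 j) < e) ->
    forall s, real_partial f s (p + v) = g s (crd v).
  by move=> /fW /wdiff_real_partial.
have near_g s : \forall z \near p, g s (crd (z - p)) = real_partial f s z.
  apply/near_norm1CP; exists e => // v ve.
  by rewrite fR // [p + v]addrC addrK.
split.
- apply/near_norm1CP; exists e => // v ve.
  by have := fW v ve; congr (wdiff _ _ (wirt _)); apply/funext => s; rewrite fR.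
- move=> s; apply: real_analytic_at_near (near_g s) _.
  apply/real_analytic_atP; exists e, (B / e); split=> //.
  apply: abs_series_ext (Ag s) => x _; congr (g s _); apply/funext => t.
  by rewrite [p + _]addrC addrK cvecK.
(* The partial derivatives are expanded only at p itself, where the symmetric matrix H gives their
   linear parts. *)
have HW s : wdiff (fun z => (real_partial f s z)%:C) p (wirt (H s)).
  apply: (@wdiff_near _ _ (fun z => (g s (crd (z - p)))%:C)).
    by apply: filterS (near_g s) => z ->.
  apply: (@wdiff_real _ _ _ _ _ (B / e / e ^+ 2) e) => // w rho r0 re wr.
  have := gH s (crd w) rho r0 re wr.
  have c0 : crd (0 : 'rV[R[i]]_r) = fun=> 0.
    by apply/funext; apply: ord_addP => j; rewrite ?crdl ?crdr mxE.
  rewrite subrr c0 [p + w]addrC addrK.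
  rewrite (_ : (rho / e) ^+ 2 * (B / e) = B / e / e ^+ 2 * rho ^+ 2) //.
  by field; rewrite gt_eqF.
by move=> s t; rewrite !(wdiff_real_partial (HW _)) Hsym.
Qed.

Lemma cplx_real_analytic_wdiff (R : realType) (r : nat)
    (f : 'rV[R[i]]_r -> R[i]) p : cplx_real_analytic_at f p ->
  \forall z \near p, wdiff f z (blocks (fun j => d_dz f j z)
    (fun j => d_dzbar f j z)).
Proof.
move=> [/real_analytic_deriv[nR _ _] /real_analytic_deriv[nI _ _]].
apply: filterS (filterI nR nI) => z [WR WI].
have [D HD] : exists D, wdiff f z D.
  have := wdiffD WR (wdiffZ 'i%C WI).
  rewrite (_ : (fun z => _) = f); first by move=> H; eexists; exact: H.
  by apply/funext => w; rewrite -complexE.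
rewrite (_ : blocks _ _ = D) //; apply/funext.
by apply: ord_addP => j; have [El Er] := wdiff_d_dz j HD;
  rewrite ?blocksl ?blocksr.
Qed.

(** * Complex-valued real-analytic functions *)

Lemma cplx_analytic_cst (R : realType) (r : nat) (a : R[i]) (p : 'rV[R[i]]_r) :
  cplx_real_analytic_at (fun=> a) p.
Proof. by split; apply: real_analytic_at_cst. Qed.

Lemma cplx_analytic_real (R : realType) (r : nat) (f : 'rV[R[i]]_r -> R) p :
  real_analytic_at f p -> cplx_real_analytic_at (fun z => (f z)%:C) p.
Proof. by move=> fp; split=> //; apply: real_analytic_at_cst. Qed.

Lemma real_analytic_atN (R : realType) (r : nat) (f : 'rV[R[i]]_r -> R) p :
  real_analytic_at f p -> real_analytic_at (fun z => - f z) p.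
Proof.
move=> fp; have := real_analytic_atM (real_analytic_at_cst (-1) p) fp.
by congr real_analytic_at; apply/funext => z; rewrite mulN1r.
Qed.

Lemma cplx_analytic_conj (R : realType) (r : nat) (f : 'rV[R[i]]_r -> R[i]) p :
  cplx_real_analytic_at f p -> cplx_real_analytic_at (fun z => (f z)^*) p.
Proof.
move=> [Rf If]; split.
  by move: Rf; congr real_analytic_at; apply/funext => z; case: (f z).
move: (real_analytic_atN If); congr real_analytic_at.
by apply/funext => z; case: (f z).
Qed.

Lemma cplx_analyticD (R : realType) (r : nat) (f g : 'rV[R[i]]_r -> R[i]) p :
  cplx_real_analytic_at f p -> cplx_real_analytic_at g p ->
  cplx_real_analytic_at (fun z => f z + g z) p.
Proof.
move=> [Rf If] [Rg Ig]; split.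
  by move: (real_analytic_atD Rf Rg); congr real_analytic_at;
    apply/funext => z; rewrite reCD.
by move: (real_analytic_atD If Ig); congr real_analytic_at; apply/funext => z;
  rewrite imCD.
Qed.

Lemma cplx_analyticM (R : realType) (r : nat) (f g : 'rV[R[i]]_r -> R[i]) p :
  cplx_real_analytic_at f p -> cplx_real_analytic_at g p ->
  cplx_real_analytic_at (fun z => f z * g z) p.
Proof.
move=> [Rf If] [Rg Ig]; split.
  move: (real_analytic_atD (real_analytic_atM Rf Rg)
    (real_analytic_atN (real_analytic_atM If Ig))).
  by congr real_analytic_at; apply/funext => z; rewrite reCM.
move: (real_analytic_atD (real_analytic_atM Rf Ig) (real_analytic_atM If Rg)).
by congr real_analytic_at; apply/funext => z; rewrite imCM.
Qed.

Lemma cplx_analytic_sum (R : realType) (r : nat) (I : Type) (l : seq I)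
    (f : I -> 'rV[R[i]]_r -> R[i]) p :
  (forall i, cplx_real_analytic_at (f i) p) ->
  cplx_real_analytic_at (fun z => \sum_(i <- l) f i z) p.
Proof.
move=> H; elim: l => [|i l IH].
  move: (cplx_analytic_cst 0 p); congr cplx_real_analytic_at.
  by apply/funext => z; rewrite big_nil.
move: (cplx_analyticD (H i) IH); congr cplx_real_analytic_at.
by apply/funext => z; rewrite big_cons.
Qed.

Lemma cplx_analytic_comp (R : realType) (r s : nat) (f : 'rV[R[i]]_s -> R[i])
    (F : 'rV[R[i]]_r -> 'rV[R[i]]_s) p :
  (forall j, cplx_real_analytic_at (fun z => F z 0 j) p) ->
  cplx_real_analytic_at f (F p) -> cplx_real_analytic_at (f \o F) p.
Proof.
move=> aF [Rf If]; split.
  exact: (real_analytic_comp (f := fun z => complex.Re (f z))).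
exact: (real_analytic_comp (f := fun z => complex.Im (f z))).
Qed.

Lemma cplx_analytic_partial (R : realType) (r : nat) (f : 'rV[R[i]]_r -> R[i])
  p s :
  cplx_real_analytic_at f p -> cplx_real_analytic_at (cplx_partial f s) p.
Proof.
move=> [/real_analytic_deriv[_ H _] /real_analytic_deriv[_ H' _]].
by split; [exact: H|exact: H'].
Qed.

Lemma d_dzE (R : realType) (r : nat) (f : 'rV[R[i]]_r -> R[i]) j :
  d_dz f j = fun z => 2^-1 * cplx_partial f (lshift r j) z +
    (- 'i%C / 2) * cplx_partial f (rshift r j) z.
Proof. by apply/funext => z; rewrite /d_dz; field. Qed.

Lemma d_dzbarE (R : realType) (r : nat) (f : 'rV[R[i]]_r -> R[i]) j :
  d_dzbar f j = fun z => 2^-1 * cplx_partial f (lshift r j) z +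
    ('i%C / 2) * cplx_partial f (rshift r j) z.
Proof. by apply/funext => z; rewrite /d_dzbar; field. Qed.

Lemma cplx_analytic_d_dz (R : realType) (r : nat) (f : 'rV[R[i]]_r -> R[i]) p j
  :
  cplx_real_analytic_at f p -> cplx_real_analytic_at (d_dz f j) p.
Proof.
move=> fp; rewrite d_dzE; apply: cplx_analyticD; apply: cplx_analyticM;
  first exact: cplx_analytic_cst.
- exact: cplx_analytic_partial.
- exact: cplx_analytic_cst.
exact: cplx_analytic_partial.
Qed.

Lemma cplx_analytic_wdiff (R : realType) (r : nat) (f : 'rV[R[i]]_r -> R[i]) p :
  cplx_real_analytic_at f p ->
  wdiff f p (blocks (fun j => d_dz f j p) (fun j => d_dzbar f j p)).
Proof. by move=> /cplx_real_analytic_wdiff /nbhs_singleton. Qed.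

Lemma d_dz_lincomb (R : realType) (r : nat) (f g : 'rV[R[i]]_r -> R[i]) p a b j
  :
  cplx_real_analytic_at f p -> cplx_real_analytic_at g p ->
  d_dz (fun z => a * f z + b * g z) j p = a * d_dz f j p + b * d_dz g j p /\
  d_dzbar (fun z => a * f z + b * g z) j p =
    a * d_dzbar f j p + b * d_dzbar g j p.
Proof.
move=> /cplx_analytic_wdiff fp /cplx_analytic_wdiff gp.
have [-> ->] := wdiff_d_dz j (wdiffD (wdiffZ a fp) (wdiffZ b gp)).
by rewrite !blocksl !blocksr.
Qed.

Lemma cplx_partial_sym (R : realType) (r : nat) (f : 'rV[R[i]]_r -> R[i]) p s t
  :
  cplx_real_analytic_at f p ->
  cplx_partial (cplx_partial f s) t p = cplx_partial (cplx_partial f t) s p.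
Proof.
move=> [/real_analytic_deriv[_ _ HR] /real_analytic_deriv[_ _ HI]].
by apply: complex_eqP; [apply: HR|apply: HI].
Qed.

(** Wirtinger derivatives are combinations of the real partial derivatives with constant
    coefficients, so the symmetry is inherited from [cplx_partial_sym]. *)
Lemma d_dz_sym (R : realType) (r : nat) (f : 'rV[R[i]]_r -> R[i]) p i j :
  cplx_real_analytic_at f p ->
  d_dz (d_dz f i) j p = d_dz (d_dz f j) i p /\
  d_dzbar (d_dz f i) j p = d_dz (d_dzbar f j) i p.
Proof.
move=> fp; pose Q s t := cplx_partial (cplx_partial f s) t p.
have Qsym s t : Q s t = Q t s by exact: cplx_partial_sym.
have P s := cplx_analytic_partial s fp.
pose A s k := 2^-1 * Q s (lshift r k) + (- 'i%C / 2) * Q s (rshift r k).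
pose B s k := 2^-1 * Q s (lshift r k) + ('i%C / 2) * Q s (rshift r k).
have L a b s t k : d_dz (fun z => a * cplx_partial f s z +
      b * cplx_partial f t z) k p = a * A s k + b * A t k.
  by rewrite (d_dz_lincomb a b k (P s) (P t)).1 !d_dzE.
have L' a b s t k : d_dzbar (fun z => a * cplx_partial f s z +
      b * cplx_partial f t z) k p = a * B s k + b * B t k.
  by rewrite (d_dz_lincomb a b k (P s) (P t)).2 !d_dzbarE.
have Lzz k l : d_dz (d_dz f k) l p =
    2^-1 * A (lshift r k) l + (- 'i%C / 2) * A (rshift r k) l.
  by rewrite (d_dzE f k); exact: L.
have Lzb k l : d_dzbar (d_dz f k) l p =
    2^-1 * B (lshift r k) l + (- 'i%C / 2) * B (rshift r k) l.
  by rewrite (d_dzE f k); exact: L'.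
have Lbz k l : d_dz (d_dzbar f k) l p =
    2^-1 * A (lshift r k) l + ('i%C / 2) * A (rshift r k) l.
  by rewrite (d_dzbarE f k); exact: L.
have [E1 E2] : 2^-1 * A (lshift r i) j + (- 'i%C / 2) * A (rshift r i) j =
      2^-1 * A (lshift r j) i + (- 'i%C / 2) * A (rshift r j) i /\
    2^-1 * B (lshift r i) j + (- 'i%C / 2) * B (rshift r i) j =
      2^-1 * A (lshift r j) i + ('i%C / 2) * A (rshift r j) i.
  rewrite /A /B (Qsym (lshift r j) (lshift r i)) (Qsym (lshift r j) (rshift r
    i)).
  rewrite (Qsym (rshift r j) (lshift r i)) (Qsym (rshift r j) (rshift r i)).
  by split; move: (Q _ _) (Q _ _) (Q _ _) (Q _ _) => *; ring.
split; first exact: etrans (Lzz i j) (etrans E1 (esym (Lzz j i))).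
exact: etrans (Lzb i j) (etrans E2 (esym (Lbz j i))).
Qed.

(** The Cauchy-Riemann equations: the linear part of a power series in z involves the increment but
    not its conjugate. *)
Lemma analytic_at_wdiff (R : realType) (r : nat) (f : 'rV[R[i]]_r -> R[i]) p :
  analytic_at f p -> wdiff f p (blocks (fun j => d_dz f j p) (fun=> 0)).
Proof.
move=> /analytic_at_power_sumP[e [B [c [e0 H]]]].
have [e' Ee] : exists e', e = e'%:C by apply/complex_realP; exact: gtr0_real.
rewrite Ee ltcR in e0; subst e.
have c0 : f p = c (mzero _).
  have := power_sum_at0 _ H; rewrite ltcR => /(_ e0) <-; congr f.
  by apply/rowP => j; rewrite !mxE addr0.
have H' : wdiff f p (blocks (fun j => c (munit j)) (fun=> 0)).
  apply: (@wdiffI _ _ (2 * complex.Re B / e' ^+ 2) e') => // v rho r0 re vr.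
  have vr' j : `|v 0 j| <= rho%:C.
    by apply: le_trans (norm_le_norm1C _) _; rewrite lecR.
  have := power_sum_center H (v := fun j => v 0 j) (rho := rho%:C) _ _ vr'.
  rewrite ler0c ltcR => /(_ r0 re).
  have -> : p + \row_i v 0 i = p + v by congr (_ + _); apply/rowP => i;
    rewrite mxE.
  rewrite sum_hat -c0 opprD addrA => Hv.
  under eq_bigr do rewrite blocksl blocksr mul0r addr0.
  set X := _ - _ in Hv *;
    have {Hv} : (norm1C X)%:C <= 2 * ((rho%:C / e'%:C) ^+ 2 * B).
    by apply: le_trans (norm1C_le_norm _) _; rewrite ler_pM2l.
  rewrite -fmorph_div -rmorphXn mulrA (_ : 2 * _ = (2 * (rho / e') ^+ 2)%:C);
    last first.
    by apply: complex_eqP; rewrite ?reCM ?imCM /=; ring.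
  rewrite lecE reCM /= mul0r subr0 => /andP[_] /le_trans; apply.
  by rewrite le_eqVlt; apply/orP; left; apply/eqP; field; rewrite gt_eqF.
have E : (fun j => d_dz f j p) = (fun j => c (munit j)).
  by apply/funext => j; rewrite (wdiff_d_dz j H').1 blocksl.
by rewrite E.
Qed.

(** * Action of a biholomorphic map on tangent vectors *)

(* A biholomorphic map between germs, put in a form symmetric in F and its
   inverse G, so that only one inclusion of each invariance has to be proved. *)
Record biholo (R : realType) (r : nat) (F G : 'rV[R[i]]_r -> 'rV[R[i]]_r)
    (O O' M M' : set 'rV[R[i]]_r) : Prop := Biholo {
  biholo_open : open O;
  biholo_open' : open O';
  biholo_to : forall z, O z -> O' (F z);
  biholo_from : forall w, O' w -> O (G w);
  biholo_FK : forall z, O z -> G (F z) = z;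
  biholo_GK : forall w, O' w -> F (G w) = w;
  biholo_holoF : forall z, O z -> holomorphic_at F z;
  biholo_holoG : forall w, O' w -> holomorphic_at G w;
  biholo_M : forall z, O z -> M z <-> M' (F z) }.

Lemma biholo_sym (R : realType) (r : nat) (F G : 'rV[R[i]]_r -> 'rV[R[i]]_r)
    O O' M M' : biholo F G O O' M M' -> biholo G F O' O M' M.
Proof.
case=> oO oO' FO GO FK GK hF hG MM; split=> // w O'w.
by rewrite (MM _ (GO _ O'w)) GK.
Qed.

Definition jac (R : realType) (r : nat) (F : 'rV[R[i]]_r -> 'rV[R[i]]_r)
    (i j : 'I_r) : 'rV[R[i]]_r -> R[i] := d_dz (fun z => F z 0 i) j.

(* Matrix of the complex differential of F, acting on the right of rows. *)
Definition jmx (R : realType) (r : nat) (F : 'rV[R[i]]_r -> 'rV[R[i]]_r)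
    (z : 'rV[R[i]]_r) : 'M[R[i]]_r := \matrix_(j, i) jac F i j z.

(* The differential of F on complexified tangent vectors, in the coordinates
   d/dz, d/dzbar. *)
Definition pmx (R : realType) (r : nat) (F : 'rV[R[i]]_r -> 'rV[R[i]]_r)
    (z : 'rV[R[i]]_r) : 'M[R[i]]_(r + r) :=
  block_mx (jmx F z) 0 0 (map_mx (@conjc R) (jmx F z)).

Lemma pmxll (R : realType) (r : nat) (F : 'rV[R[i]]_r -> 'rV[R[i]]_r) z j i :
  pmx F z (lshift r j) (lshift r i) = jac F i j z.
Proof. by rewrite block_mxEul mxE. Qed.
Lemma pmxlr (R : realType) (r : nat) (F : 'rV[R[i]]_r -> 'rV[R[i]]_r) z j i :
  pmx F z (lshift r j) (rshift r i) = 0.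
Proof. by rewrite block_mxEur mxE. Qed.
Lemma pmxrl (R : realType) (r : nat) (F : 'rV[R[i]]_r -> 'rV[R[i]]_r) z j i :
  pmx F z (rshift r j) (lshift r i) = 0.
Proof. by rewrite block_mxEdl mxE. Qed.
Lemma pmxrr (R : realType) (r : nat) (F : 'rV[R[i]]_r -> 'rV[R[i]]_r) z j i :
  pmx F z (rshift r j) (rshift r i) = (jac F i j z)^*.
Proof. by rewrite block_mxEdr mxE mxE. Qed.

Lemma holomorphic_wdiff (R : realType) (r : nat)
    (F : 'rV[R[i]]_r -> 'rV[R[i]]_r) z i : holomorphic_at F z ->
  wdiff (fun z => F z 0 i) z (blocks (fun j => jac F i j z) (fun=> 0)).
Proof. by move=> /(_ i); apply: analytic_at_wdiff. Qed.

Lemma wdiff_coord (R : realType) (r : nat) (p : 'rV[R[i]]_r) i :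
  wdiff (fun z : 'rV[R[i]]_r => z 0 i) p
    (blocks (fun j => (j == i)%:R) (fun=> 0)).
Proof.
apply: (@wdiffI _ _ 0 1) => // v rho _ _ _.
rewrite sum_hat (bigD1 i) //= big1 => [|j /negPf ji]; rewrite blocksl blocksr.
  rewrite eqxx mul1r mul0r !addr0 mxE (_ : _ - _ - _ = 0) ?norm1C0 ?mul0r //;
    ring.
by rewrite ji !mul0r addr0.
Qed.

(** Continuity of F at p, extracted from the bound on increments contained in its expansion. *)
Lemma near_wdiff_comp (R : realType) (r t : nat)
    (F : 'rV[R[i]]_r -> 'rV[R[i]]_t) p D (P : 'rV[R[i]]_t -> Prop) :
  (forall i, wdiff (fun z => F z 0 i) p (D i)) ->
  (\forall w \near F p, P w) -> \forall z \near p, P (F z).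
Proof.
move=> /choice[K0 HF] /near_norm1CP[d d0 HP].
pose K := 1 + \sum_i K0 i.
have K0pos i : 0 <= K0 i by have [] := HF i; lra.
have K0K i : K0 i <= K.
  have H0 : 0 <= \sum_(i' | i' != i) K0 i' by apply: sumr_ge0.
  by rewrite /K (bigD1 i) //=; lra.
have K1 : 1 <= K by rewrite /K lerDl sumr_ge0.
have K0' : 0 < K by lra.
(* Then K * rho is below 1, as the expansion demands, and below d, which places the image in the
   given neighbourhood. *)
pose rho := Num.min (d / 2) 2^-1 / K.
have rK : K * rho = Num.min (d / 2) 2^-1.
  by rewrite /rho mulrC divfK // gt_eqF.
have m0 : 0 < Num.min (d / 2) (2^-1 : R) by rewrite lt_min divr_gt0 //=
  invr_gt0.
have r0 : 0 < rho by rewrite divr_gt0.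
have m1 : Num.min (d / 2) (2^-1 : R) <= d / 2 by rewrite ge_min lexx.
have m2 : Num.min (d / 2) (2^-1 : R) <= 2^-1 by rewrite ge_min lexx orbT.
apply/near_norm1CP; exists rho => // v vr.
rewrite -[F (p + v)](subrK (F p)) addrC; apply: HP => i; rewrite !mxE.
have [_ H] := wexpansion_weaken (K0K i) (HF i).
have [||j|H1 _] := H v rho; rewrite ?(ltW r0) ?rK ?(ltW (vr j)) //; first lra.
by apply: le_lt_trans H1 _; rewrite rK; lra.
Qed.

Lemma near_holo_comp (R : realType) (r : nat)
    (F : 'rV[R[i]]_r -> 'rV[R[i]]_r) p (P : 'rV[R[i]]_r -> Prop) :
  holomorphic_at F p -> (\forall w \near F p, P w) -> \forall z \near p, P (F
    z).
Proof. by move=> hF; apply: near_wdiff_comp => i; apply: holomorphic_wdiff. Qed.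

Lemma vec_apply_near (R : realType) (r : nat) (f g : 'rV[R[i]]_r -> R[i]) p D w
  :
  (\forall z \near p, f z = g z) -> wdiff f p D ->
  vec_apply w f p = vec_apply w g p.
Proof.
move=> fg Df; rewrite (wdiff_vec_apply w Df).
by rewrite (wdiff_vec_apply w (wdiff_near fg Df)).
Qed.

Lemma vec_apply_push (R : realType) (r : nat)
    (F : 'rV[R[i]]_r -> 'rV[R[i]]_r) (f : 'rV[R[i]]_r -> R[i]) z D w :
  holomorphic_at F z -> wdiff f (F z) D ->
  vec_apply (w *m pmx F z) f (F z) = vec_apply w (f \o F) z.
Proof.
move=> hF Df; rewrite (wdiff_vec_apply _ Df).
rewrite (wdiff_vec_apply _ (wdiff_comp (fun i => holomorphic_wdiff i hF) Df)).
under eq_bigr do rewrite mxE mulr_suml.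
rewrite exchange_big; apply: eq_bigr => s _ /=.
under eq_bigr do rewrite -mulrA; rewrite -mulr_sumr; congr (_ * _).
rewrite big_split_ord /=; move: s; apply: ord_addP => j.
  rewrite blocksl [X in _ + X]big1 ?addr0; last first.
    by move=> i _; rewrite pmxlr mul0r.
  by apply: eq_bigr => i _; rewrite pmxll mulrC.
rewrite blocksr [X in X + _]big1 ?add0r; last first.
  by move=> i _; rewrite pmxrl mul0r.
by apply: eq_bigr => i _; rewrite pmxrr mulrC.
Qed.

Lemma biholo_near (R : realType) (r : nat) (F G : 'rV[R[i]]_r -> 'rV[R[i]]_r)
    O O' M M' z : biholo F G O O' M M' -> O z -> \forall y \near z, O y.
Proof. by move=> H Oz; apply: open_nbhs_nbhs; split=> //;
  apply: biholo_open H. Qed.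

(** The chain rule for [G \o F], which is the identity near z; uniqueness of the expansion
    identifies the coefficients. *)
Lemma jmxK (R : realType) (r : nat) (F G : 'rV[R[i]]_r -> 'rV[R[i]]_r)
    O O' M M' z : biholo F G O O' M M' -> O z -> jmx F z *m jmx G (F z) = 1%:M.
Proof.
move=> H Oz; apply/matrixP => j i; rewrite !mxE.
have hG := biholo_holoG H (biholo_to H Oz).
have W := wdiff_comp (fun i => holomorphic_wdiff i (biholo_holoF H Oz))
  (holomorphic_wdiff i hG).
have W' := wdiff_coord z i.
have nE : \forall y \near z, ((fun w => G w 0 i) \o F) y = y 0 i.
  by apply: filterS (biholo_near H Oz) => y /= Oy; rewrite (biholo_FK H).
have := congr1 (fun D => D (lshift r j)) (wdiff_unique (wdiff_near nE W) W').
rewrite !blocksl => <-; apply: eq_bigr => l _.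
by rewrite !mxE blocksl mulrC.
Qed.

Lemma pmxK (R : realType) (r : nat) (F G : 'rV[R[i]]_r -> 'rV[R[i]]_r)
    O O' M M' z : biholo F G O O' M M' -> O z -> pmx F z *m pmx G (F z) = 1%:M.
Proof.
move=> H Oz; rewrite mulmx_block !mulmx0 !mul0mx !addr0 !add0r -map_mxM.
by rewrite (jmxK H Oz) map_mx1 -scalar_mx_block.
Qed.

Lemma germ_ideal_comp (R : realType) (r : nat)
    (F G : 'rV[R[i]]_r -> 'rV[R[i]]_r) O O' M M' z rho :
  biholo F G O O' M M' -> O z -> germ_ideal M' (F z) rho ->
  germ_ideal M z (rho \o F).
Proof.
move=> H Oz [arho rho0]; split.
  apply: real_analytic_comp => // i.
  by apply: analytic_at_cplx_real; apply: (biholo_holoF H Oz).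
apply: filterS (filterI (biholo_near H Oz) (near_holo_comp (biholo_holoF H Oz)
  rho0)).
by move=> y [Oy Hy] /(biholo_M H Oy).
Qed.

Lemma CT_push (R : realType) (r : nat)
    (F G : 'rV[R[i]]_r -> 'rV[R[i]]_r) O O' M M' z w :
  biholo F G O O' M M' -> O z -> CT M z w -> CT M' (F z) (w *m pmx F z).
Proof.
move=> H Oz Cw rho Irho.
rewrite (vec_apply_push _ (biholo_holoF H Oz) (cplx_analytic_wdiff
  (cplx_analytic_real Irho.1))).
exact: Cw _ (germ_ideal_comp H Oz Irho).
Qed.

(** With (1,0) vectors seen as vectors of [CT] whose second block is zero, [CT_push] and the block
    form of [pmx] suffice to transport them. *)
Lemma TcP (R : realType) (r : nat) (M : set 'rV[R[i]]_r) z w :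
  Tc M z w <-> exists2 a, w = row_mx a 0 & CT M z w.
Proof.
have E a rho : vec_apply (row_mx a 0 : 'rV_(r + r)) (fun y => (rho y)%:C) z =
    \sum_(j < r) a 0 j * d_dz (fun y => (rho y)%:C) j z :> R[i].
  by apply: eq_bigr => j _; rewrite row_mxEl row_mxEr mxE mul0r addr0.
split=> [[a Ha <-]|[a -> Ha]]; exists a => // rho Irho.
  by rewrite E; apply: Ha.
by rewrite -E; apply: Ha.
Qed.

Lemma TcbarP (R : realType) (r : nat) (M : set 'rV[R[i]]_r) z w :
  Tcbar M z w <-> exists2 b, w = row_mx 0 b & CT M z w.
Proof.
have E b rho : vec_apply (row_mx 0 b : 'rV_(r + r)) (fun y => (rho y)%:C) z =
    \sum_(j < r) b 0 j * d_dzbar (fun y => (rho y)%:C) j z :> R[i].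
  by apply: eq_bigr => j _; rewrite row_mxEl row_mxEr mxE mul0r add0r.
split=> [[b Hb <-]|[b -> Hb]]; exists b => // rho Irho.
  by rewrite E; apply: Hb.
by rewrite -E; apply: Hb.
Qed.

Lemma Tc_sum_push (R : realType) (r : nat)
    (F G : 'rV[R[i]]_r -> 'rV[R[i]]_r) O O' M M' z w :
  biholo F G O O' M M' -> O z -> Tc_sum M z w -> Tc_sum M' (F z) (w *m pmx F z).
Proof.
move=> H Oz [u /TcP[a ua Cu] [v /TcbarP[b vb Cv] <-]].
exists (u *m pmx F z).
  apply/TcP; exists (a *m jmx F z); last exact: CT_push H Oz Cu.
  by rewrite ua mul_row_block !mulmx0 !mul0mx !addr0.
exists (v *m pmx F z); last by rewrite mulmxDl.
apply/TcbarP; exists (b *m map_mx (@conjc R) (jmx F z)).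
  by rewrite vb mul_row_block !mulmx0 !mul0mx !add0r.
exact: CT_push H Oz Cv.
Qed.

Lemma hat_jmx (R : realType) (r : nat) (F : 'rV[R[i]]_r -> 'rV[R[i]]_r) z v :
  hat (v *m jmx F z) = hat v *m pmx F z.
Proof.
by rewrite /hat mul_row_block !mulmx0 addr0 add0r map_mxM.
Qed.

Lemma vec_apply_hat (R : realType) (r : nat) (f : 'rV[R[i]]_r -> R) p v :
  real_analytic_at f p ->
  vec_apply (hat v) (fun z => (f z)%:C) p = (real_diff f p v)%:C /\
  real_diff f p v = \sum_s real_partial f s p * crd v s.
Proof.
move=> /real_analytic_deriv[/nbhs_singleton W _ _].
have E : real_diff f p v = \sum_s real_partial f s p * crd v s.
  by have [+ _] := wdiff_derive v W; rewrite wirt_hat.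
split=> //; rewrite E (wdiff_vec_apply _ W) -wirt_hat.
by apply: eq_bigr => s _; rewrite mulrC.
Qed.

(** Reduces real tangent vectors to [CT], so that regularity is transported by the same argument as
    the Zariski spaces. *)
Lemma real_tangentP (R : realType) (r : nat) (M : set 'rV[R[i]]_r) z v :
  real_tangent M z v <-> CT M z (hat v).
Proof.
split=> T rho Irho; have [E _] := vec_apply_hat v Irho.1.
  by rewrite E T.
by apply: (@complexI R); rewrite -E T.
Qed.

Lemma cplx_tangent_push (R : realType) (r : nat)
    (F G : 'rV[R[i]]_r -> 'rV[R[i]]_r) O O' M M' z v :
  biholo F G O O' M M' -> O z -> cplx_tangent M z v ->
  cplx_tangent M' (F z) (v *m jmx F z).
Proof.
move=> H Oz [T1 [v' T2 vE]].
have push u : real_tangent M z u -> real_tangent M' (F z) (u *m jmx F z).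
  by move=> /real_tangentP Tu; apply/real_tangentP; rewrite hat_jmx;
    apply: CT_push H Oz Tu.
split; first exact: push.
exists (v' *m jmx F z); first exact: push.
by rewrite -vE scalemxAl.
Qed.

(** * Dimensions of transported sets *)

Lemma cdim_eq (K : fieldType) (vT : vectType K) (A : set vT) (U : {vspace vT}) :
  [set` U] = A -> cdim A = \dim U.
Proof.
move=> UA; rewrite /cdim; case: xgetP => [V _ VA|/(_ U) []//].
congr (\dim _); apply/vspaceP => v.
have : [set` V] v = [set` U] v by rewrite VA UA.
by move=> /= E; apply/idP/idP => Hv; move: (Hv); rewrite ?(propext E) //;
  [rewrite -E|rewrite E].
Qed.

Lemma cdim_mulmx (K : fieldType) (m : nat) (A B : set 'rV[K]_m) (P Q : 'M[K]_m)
  :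
  P *m Q = 1%:M -> (forall v, A v -> B (v *m P)) ->
  (forall v, B v -> A (v *m Q)) -> cdim A = cdim B.
Proof.
move=> PQ AB BA; have QP := mulmx1C PQ.
have sub (A' B' : set 'rV[K]_m) (P' Q' : 'M[K]_m) : P' *m Q' = 1%:M ->
    Q' *m P' = 1%:M ->
    (forall v, A' v -> B' (v *m P')) -> (forall v, B' v -> A' (v *m Q')) ->
    forall U : {vspace 'rV[K]_m}, [set` U] = A' ->
    exists2 V : {vspace 'rV[K]_m}, [set` V] = B' & \dim U = \dim V.
  move=> PQ' QP' AB' BA' U UA;
    pose f : 'Hom('rV[K]_m, 'rV[K]_m) := linfun (mulmxr P').
  exists (f @: U)%VS.
    apply/seteqP; split=> v /=.
      move=> /memv_imgP[u Uu ->]; rewrite lfunE /=; apply: AB'.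
      by rewrite -UA.
    move=> /BA'; rewrite -UA /= => Uv; apply/memv_imgP.
    by exists (v *m Q') => //; rewrite lfunE /= -mulmxA QP' mulmx1.
  rewrite limg_dim_eq // (_ : lker f = 0%VS) ?capv0 //.
  apply/eqP/lker0P => u v; rewrite !lfunE /= => /(congr1 (mulmx^~ Q')).
  by rewrite -!mulmxA PQ' !mulmx1.
have [[U UA]|nA] := pselect (exists U : {vspace 'rV[K]_m}, [set` U] = A).
  have [V VB dUV] := sub _ _ _ _ PQ QP AB BA U UA.
  by rewrite (cdim_eq UA) (cdim_eq VB).
(* If A is not a subspace then neither is B, and both dimensions take the default value 0. *)
rewrite /cdim [in LHS]xgetPN => [|U UA]; last by apply: nA; exists U.
rewrite xgetPN // => V VB; apply: nA.
by have [U UA _] := sub _ _ _ _ QP PQ BA AB V VB; exists U.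
Qed.

Lemma cdim_cplx_tangent (R : realType) (r : nat)
    (F G : 'rV[R[i]]_r -> 'rV[R[i]]_r) O O' M M' z :
  biholo F G O O' M M' -> O z ->
  cdim (cplx_tangent M z) = cdim (cplx_tangent M' (F z)).
Proof.
move=> H Oz; apply: (cdim_mulmx (jmxK H Oz)) => v.
  exact: cplx_tangent_push H Oz.
move=> T; have := cplx_tangent_push (biholo_sym H) (biholo_to H Oz) T.
by rewrite (biholo_FK H).
Qed.

(** * Vector fields *)

Lemma jac_cplx_analytic (R : realType) (r : nat) (F : 'rV[R[i]]_r -> 'rV[R[i]]_r) i j z :
  holomorphic_at F z -> cplx_real_analytic_at (jac F i j) z.
Proof. by move=> hF; apply/cplx_analytic_d_dz/analytic_at_cplx_real/hF. Qed.

Lemma pmx_cplx_analytic (R : realType) (r : nat) (F : 'rV[R[i]]_r -> 'rV[R[i]]_r) t s z :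
  holomorphic_at F z -> cplx_real_analytic_at (fun y => pmx F y t s) z.
Proof.
move=> hF; move: t s; apply: ord_addP => j; apply: ord_addP => i.
- by under eq_fun do rewrite pmxll; apply: jac_cplx_analytic.
- by under eq_fun do rewrite pmxlr; apply: cplx_analytic_cst.
- by under eq_fun do rewrite pmxrl; apply: cplx_analytic_cst.
by under eq_fun do rewrite pmxrr; apply/cplx_analytic_conj/jac_cplx_analytic.
Qed.

(** The derivatives of a holomorphic map are again holomorphic: exchanging the order, d/dzbar_l of
    dF_i/dz_j is d/dz_j of dF_i/dzbar_l, and the latter function vanishes near z. *)
Lemma jac_wdiff (R : realType) (r : nat) (F : 'rV[R[i]]_r -> 'rV[R[i]]_r) i j z
  :
  (\forall y \near z, holomorphic_at F y) ->
  wdiff (jac F i j) z (blocks (fun l => d_dz (jac F i j) l z) (fun=> 0)).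
Proof.
move=> nF; have hF := nbhs_singleton nF.
have aF : cplx_real_analytic_at (fun z => F z 0 i) z.
  exact/analytic_at_cplx_real/hF.
have := cplx_analytic_wdiff (jac_cplx_analytic i j hF).
congr (wdiff _ _ (blocks _ _)); apply/funext => l.
rewrite (d_dz_sym j l aF).2.
have W0 : wdiff (d_dzbar (fun z => F z 0 i) l) z (fun=> 0).
  apply: wdiff_near (wdiff_cst 0 z); apply: filterS nF => y hFy.
  by rewrite (wdiff_d_dz l (holomorphic_wdiff i hFy)).2 blocksr.
by rewrite (wdiff_d_dz j W0).1.
Qed.

(* The derivatives of the coefficients of the differential of F are second
   derivatives of F, whence the symmetry of H. *)
Lemma pmx_wdiff (R : realType) (r : nat) (F : 'rV[R[i]]_r -> 'rV[R[i]]_r) s z :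
  (\forall y \near z, holomorphic_at F y) ->
  exists H : 'I_(r + r) -> 'I_(r + r) -> R[i],
    (forall t, wdiff (fun y => pmx F y t s) z (H t)) /\
    (forall t t', H t t' = H t' t).
Proof.
move=> nF; have hF := nbhs_singleton nF.
have W i j := jac_wdiff i j nF.
have sym i j l : d_dz (jac F i j) l z = d_dz (jac F i l) j z.
  by apply: (d_dz_sym j l _).1; exact/analytic_at_cplx_real/hF.
move: s; apply: ord_addP => i.
  exists (blocks (fun j => blocks (fun l => d_dz (jac F i j) l z) (fun=> 0))
    (fun=> fun=> 0)); split.
    apply: ord_addP => j; rewrite ?blocksl ?blocksr.
      by under eq_fun do rewrite pmxll.
    by under eq_fun do rewrite pmxrl; apply: wdiff_cst.
  apply: ord_addP => j; apply: ord_addP => l.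
  - by rewrite !blocksl; exact: sym.
  - by rewrite blocksl !blocksr.
  - by rewrite blocksr blocksl blocksr.
  by rewrite !blocksr.
exists (blocks (fun=> fun=> 0)
  (fun j => blocks (fun=> 0) (fun l => (d_dz (jac F i j) l z)^*))); split.
  apply: ord_addP => j; rewrite ?blocksl ?blocksr.
    by under eq_fun do rewrite pmxlr; apply: wdiff_cst.
  under eq_fun do rewrite pmxrr.
  move: (wdiff_conj (W i j)); congr wdiff; apply/funext.
  by apply: ord_addP => l; rewrite ?blocksl ?blocksr ?blocksl ?blocksr ?rmorph0.
apply: ord_addP => j; apply: ord_addP => l.
- by rewrite !blocksl.
- by rewrite blocksl blocksr blocksl.
- by rewrite blocksr !blocksl.
by rewrite !blocksr; exact: (congr1 (fun x : R[i] => x^*) (sym i j l)).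
Qed.

Definition push_field (R : realType) (r : nat)
    (F G : 'rV[R[i]]_r -> 'rV[R[i]]_r)
    (V : 'rV[R[i]]_r -> 'rV[R[i]]_(r + r)) (w : 'rV[R[i]]_r) :
    'rV[R[i]]_(r + r) := V (G w) *m pmx F (G w).

Lemma push_field_analytic (R : realType) (r : nat)
    (F G : 'rV[R[i]]_r -> 'rV[R[i]]_r) O O' M M' z V :
  biholo F G O O' M M' -> O z -> analytic_field_at V z ->
  analytic_field_at (push_field F G V) (F z).
Proof.
move=> H Oz aV s.
apply: (@cplx_analytic_comp _ _ _ (fun y => (V y *m pmx F y) 0 s) G).
  by move=> j; apply/analytic_at_cplx_real/(biholo_holoG H)/(biholo_to H).
rewrite (biholo_FK H) //; under eq_fun do rewrite mxE.
apply: cplx_analytic_sum => t; apply: cplx_analyticM; first exact: aV.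
by apply: pmx_cplx_analytic; apply: biholo_holoF H _ Oz.
Qed.

(** The hypotheses are expansions at one point, not analyticity, because analyticity of a field at a
    point is used only to get expansions at all nearby points, where the identity must hold as
    well. *)
Lemma commutator_push_at (R : realType) (r : nat)
    (F G : 'rV[R[i]]_r -> 'rV[R[i]]_r) O O' M M' z
    (X Y : 'rV[R[i]]_r -> 'rV[R[i]]_(r + r)) DX DY DX' DY' :
  biholo F G O O' M M' -> O z ->
  (forall s, wdiff (fun y => X y 0 s) z (DX s)) ->
  (forall s, wdiff (fun y => Y y 0 s) z (DY s)) ->
  (forall s, wdiff (fun w => push_field F G X w 0 s) (F z) (DX' s)) ->
  (forall s, wdiff (fun w => push_field F G Y w 0 s) (F z) (DY' s)) ->
  commutator (push_field F G X) (push_field F G Y) (F z) =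
  commutator X Y z *m pmx F z.
Proof.
move=> H Oz WX WY WX' WY'; apply/rowP => s.
have nF : \forall y \near z, holomorphic_at F y.
  by apply: filterS (biholo_near H Oz) => y; apply: biholo_holoF H _.
have [h [Wh hsym]] := pmx_wdiff s nF.
(* The second sum comes from differentiating the differential of F. By symmetry of h it is unchanged
   when A and B are exchanged, so it drops out of the commutator. *)
have half (A B : 'rV[R[i]]_r -> 'rV[R[i]]_(r + r)) DB DB' :
    (forall s, wdiff (fun y => B y 0 s) z (DB s)) ->
    (forall s, wdiff (fun w => push_field F G B w 0 s) (F z) (DB' s)) ->
    vec_apply (push_field F G A (F z)) (fun w => push_field F G B w 0 s) (F z) =
    \sum_t vec_apply (A z) (fun y => B y 0 t) z * pmx F z t s +
    \sum_t \sum_t' A z 0 t' * B z 0 t * h t t'.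
  move=> WB WB'; rewrite {1}/push_field (biholo_FK H Oz).
  rewrite (vec_apply_push _ (biholo_holoF H Oz) (WB' s)).
  have nE : \forall y \near z, \sum_t B y 0 t * pmx F y t s =
      ((fun w => push_field F G B w 0 s) \o F) y.
    by apply: filterS (biholo_near H Oz) => y Oy;
      rewrite /= /push_field (biholo_FK H Oy) mxE.
  have W := wdiff_sum (index_enum 'I_(r + r)) (fun t => wdiffM (WB t) (Wh t)).
  rewrite -(vec_apply_near _ nE W) (wdiff_vec_apply _ W).
  under eq_bigr do rewrite mulr_sumr.
  rewrite exchange_big -big_split; apply: eq_bigr => t _ /=.
  rewrite (wdiff_vec_apply _ (WB t)) mulr_suml -big_split.
  by apply: eq_bigr => t' _ /=; ring.
rewrite [LHS]mxE (half X Y DY DY' WY WY') (half Y X DX DX' WX WX').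
have -> : \sum_t \sum_t' Y z 0 t' * X z 0 t * h t t' =
    \sum_t \sum_t' X z 0 t' * Y z 0 t * h t t'.
  rewrite exchange_big; apply: eq_bigr => t _; apply: eq_bigr => t' _ /=.
  by rewrite hsym; ring.
rewrite opprD addrACA subrr addr0 mxE -sumrB; apply: eq_bigr => t _.
by rewrite [X in _ = X * _]mxE mulrBl.
Qed.

Lemma commutator_push (R : realType) (r : nat)
    (F G : 'rV[R[i]]_r -> 'rV[R[i]]_r) O O' M M' z X Y :
  biholo F G O O' M M' -> O z -> analytic_field_at X z -> analytic_field_at Y z
    ->
  \forall y \near z, commutator (push_field F G X) (push_field F G Y) (F y) =
    commutator X Y y *m pmx F y.
Proof.
move=> H Oz aX aY.
have nW (V : 'rV[R[i]]_r -> 'rV[R[i]]_(r + r)) p : analytic_field_at V p ->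
  \forall y \near p, forall s : 'I_(r + r),
    exists D, wdiff (fun u : 'rV[R[i]]_r => V u 0 s) y D.
  move=> aV; apply: (@filter_forall _ _ (fun s y => exists D,
    wdiff (fun u : 'rV[R[i]]_r => V u 0 s) y D) (nbhs p) _) => s.
  by apply: filterS (cplx_real_analytic_wdiff (aV s)) => y W; eexists; exact: W.
have hF := biholo_holoF H Oz.
have nX' := near_holo_comp hF (nW _ _ (push_field_analytic H Oz aX)).
have nY' := near_holo_comp hF (nW _ _ (push_field_analytic H Oz aY)).
apply: filterS (filterI (biholo_near H Oz) (filterI (filterI (nW _ _ aX) (nW _
  _ aY))
  (filterI nX' nY'))).
move=> y [Oy [[/choice[DX WX] /choice[DY WY]] [/choice[DX' WX'] /choice[DY' WY']]]].
exact: commutator_push_at H Oy WX WY WX' WY'.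
Qed.

Lemma D_germ_analytic (R : realType) (r : nat) (M : set 'rV[R[i]]_r) z nu V :
  D_germ M z nu V -> analytic_field_at V z.
Proof. by case: nu => [|[|nu]] //= []. Qed.

Lemma D1_germ_push (R : realType) (r : nat)
    (F G : 'rV[R[i]]_r -> 'rV[R[i]]_r) O O' M M' z V :
  biholo F G O O' M M' -> O z -> D1_germ M z V ->
  D1_germ M' (F z) (push_field F G V).
Proof.
move=> H Oz [aV TV]; split; first exact: push_field_analytic H Oz aV.
have hG := biholo_holoG H (biholo_to H Oz).
(* Writing the base point z as G (F z) lets continuity of G carry the neighbourhood of z to one of F
   z. *)
rewrite -{1}(biholo_FK H Oz) in TV.
apply: filterS (filterI (biholo_near (biholo_sym H) (biholo_to H Oz))
  (near_holo_comp hG TV)).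
move=> w [ Ow Tw]; rewrite -{1 2}(biholo_GK H Ow) =>
  /(biholo_M H (biholo_from H Ow)) Mw.
by rewrite /push_field; apply: Tc_sum_push H (biholo_from H Ow) (Tw Mw).
Qed.

Lemma D_germ_push (R : realType) (r : nat)
    (F G : 'rV[R[i]]_r -> 'rV[R[i]]_r) O O' M M' z nu V :
  biholo F G O O' M M' -> O z -> D_germ M z nu V ->
  D_germ M' (F z) nu (push_field F G V).
Proof.
move=> H Oz; elim: nu V => [//|[|nu] IH] V; first exact: D1_germ_push H Oz.
move=> [aV [m [X [Y [Z [DX DY DZ VE]]]]]].
split; first exact: push_field_analytic H Oz aV.
exists m, (fun i => push_field F G (X i)), (fun i => push_field F G (Y i)),
  (push_field F G Z); split.
- by move=> i; apply: IH (DX i).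
- by move=> i; apply: D1_germ_push H Oz (DY i).
- exact: IH DZ.
(* The relation defining the next distribution is required on M near the point, so the commutators
   must be transported on a common neighbourhood; it exists because i ranges over a finite type. *)
have nC : \forall y \near z, forall i, commutator (push_field F G (X i))
    (push_field F G (Y i)) (F y) = commutator (X i) (Y i) y *m pmx F y.
  apply: (@filter_forall _ _ (fun i y => commutator (push_field F G (X i))
    (push_field F G (Y i)) (F y) = commutator (X i) (Y i) y *m pmx F y)
    (nbhs z) _) => i.
  apply: commutator_push H Oz _ (DY i).1.
  exact: (@D_germ_analytic _ _ M z nu.+1 _ (DX i)).
have hG := biholo_holoG H (biholo_to H Oz).
rewrite -{1}(biholo_FK H Oz) in VE; rewrite -{1}(biholo_FK H Oz) in nC.
have nO := biholo_near (biholo_sym H) (biholo_to H Oz).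
have nV := near_holo_comp hG VE; have nC' := near_holo_comp hG nC.
apply: filterS (filterI nO (filterI nV nC')).
move=> w [ Ow [Vw Cw]] M'w.
have Mw : M (G w) by apply/(biholo_M H (biholo_from H Ow));
  rewrite (biholo_GK H Ow).
rewrite /push_field (Vw Mw) mulmxDl mulmx_suml; congr (_ + _).
by apply: eq_bigr => i _; rewrite -Cw (biholo_GK H Ow).
Qed.

Lemma D_reg_push (R : realType) (r : nat)
    (F G : 'rV[R[i]]_r -> 'rV[R[i]]_r) O O' M M' z nu v :
  biholo F G O O' M M' -> O z -> D_reg M nu z v ->
  D_reg M' nu (F z) (v *m pmx F z).
Proof.
move=> H Oz [V DV <-]; exists (push_field F G V).
  exact: D_germ_push H Oz DV.
by rewrite /push_field (biholo_FK H Oz).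
Qed.

(** * Regular points and limit cones *)

Lemma row_freeP0 (K : fieldType) (m n : nat) (A : 'M[K]_(m, n)) :
  (forall la : 'rV_m, la *m A = 0 -> la = 0) -> row_free A.
Proof.
move=> H; rewrite -kermx_eq0; apply/eqP/row_matrixP => i; rewrite row0.
by apply: H; rewrite -row_mul mulmx_ker row0.
Qed.

(** A linear relation between the differentials of the rho s \o G at F z, evaluated on the images
    under dF of the real coordinate vectors, is the same relation between the differentials of the
    rho s at z. *)
Lemma row_free_partials_push (R : realType) (r k : nat)
    (F G : 'rV[R[i]]_r -> 'rV[R[i]]_r) O O' M M' z
    (rho : 'I_k -> 'rV[R[i]]_r -> R) :
  biholo F G O O' M M' -> O z -> (forall s, real_analytic_at (rho s) z) ->
  (forall s, real_analytic_at (rho s \o G) (F z)) ->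
  row_free (\matrix_(s < k, j < r + r) real_partial (rho s) j z) ->
  row_free (\matrix_(s < k, j < r + r) real_partial (rho s \o G) j (F z)).
Proof.
move=> H Oz arho arho' free; apply: row_freeP0 => la laA.
apply: (row_free_inj free); rewrite mul0mx; apply/rowP => t.
pose v : 'rV[R[i]]_r := cvec (fun t' => (t' == t)%:R).
have diffE s : real_diff (rho s \o G) (F z) (v *m jmx F z) = real_partial (rho
  s) t z.
  have [E _] := vec_apply_hat (v *m jmx F z) (arho' s).
  have [E2 E3] := vec_apply_hat v (arho s).
  transitivity (real_diff (rho s) z v); last first.
    rewrite E3 (bigD1 t) //= big1 => [|t' /negPf tt];
      rewrite cvecK ?tt ?mulr0 //.
    by rewrite eqxx mulr1 addr0.
  apply: (@complexI R); rewrite -E -E2 hat_jmx.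
  rewrite (vec_apply_push _ (biholo_holoF H Oz) (cplx_analytic_wdiff
    (cplx_analytic_real (arho' s)))).
  apply/esym/(vec_apply_near _ _ (cplx_analytic_wdiff (cplx_analytic_real (arho
    s)))).
  by apply: filterS (biholo_near H Oz) => y Oy; rewrite /= (biholo_FK H Oy).
rewrite !mxE;
  under eq_bigr do rewrite mxE -diffE (vec_apply_hat _ (arho' _)).2 mulr_sumr.
rewrite exchange_big big1 // => t' _ /=.
under eq_bigr do rewrite mulrA; rewrite -mulr_suml.
have := congr1 (fun A : 'rV_(r + r) => A 0 t') laA; rewrite !mxE.
by under eq_bigr do rewrite mxE; move=> ->; rewrite mul0r.
Qed.

Lemma reg_push (R : realType) (r n k : nat)
    (F G : 'rV[R[i]]_r -> 'rV[R[i]]_r) O O' M M' z :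
  biholo F G O O' M M' -> O z -> reg n k M z -> reg n k M' (F z).
Proof.
move=> H Oz [Mz [[rho [arho free Mrho]] dimM]].
have hG := biholo_holoG H (biholo_to H Oz).
have nO := biholo_near (biholo_sym H) (biholo_to H Oz).
split; first exact/(biholo_M H Oz).
split.
  have arho' s : real_analytic_at (rho s \o G) (F z).
    apply: real_analytic_comp => [j|]; last by rewrite (biholo_FK H Oz).
    exact/analytic_at_cplx_real/hG.
  exists (fun s => rho s \o G); split=> //.
    exact: row_free_partials_push H Oz arho arho' free.
  rewrite -{1}(biholo_FK H Oz) in Mrho.
  apply: filterS (filterI nO (near_holo_comp hG Mrho)) => w [ Ow Hw].
  by rewrite (biholo_M (biholo_sym H) Ow).
rewrite -{1}(biholo_FK H Oz) in dimM.
apply: filterS (filterI nO (near_holo_comp hG dimM)) => w [ Ow Hw] Mw.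
by rewrite (cdim_cplx_tangent (biholo_sym H) Ow) Hw // -(biholo_M (biholo_sym
  H) Ow).
Qed.

Lemma reg_cdim (R : realType) (r n k : nat) (M : set 'rV[R[i]]_r) z :
  reg n k M z -> cdim (cplx_tangent M z) = n.
Proof. by move=> [Mz [_ /nbhs_singleton]]; apply. Qed.

Lemma regular_dim_unique (R : realType) (r n k n' k' : nat)
    (F G : 'rV[R[i]]_r -> 'rV[R[i]]_r) O O' M M' p :
  biholo F G O O' M M' -> O p -> M p -> M `<=` closure (reg n k M) ->
  M' `<=` closure (reg n' k' M') -> n = n'.
Proof.
move=> H Op Mp dM dM'.
have [z [Rz Oz]] := dM p Mp O (biholo_near H Op).
have Rz' := reg_push H Oz Rz.
have [M'z [_ dimz]] := Rz'.
(* F z is regular of type (n, k), so complex tangent spaces have dimension n at all points of M'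
   near it; density supplies among them a point w regular of type (n', k'). *)
have [w [Rw Hw]] := dM' (F z) M'z _ dimz.
by rewrite -(reg_cdim Rw) Hw //; case: Rw.
Qed.

(** * Continuity of the differential and limit values *)

Lemma near_normP (R : realType) (m : nat) (p : 'rV[R[i]]_m)
    (P : 'rV[R[i]]_m -> Prop) :
  (\forall z \near p, P z) <->
  exists2 d : R, 0 < d & forall z, `|z - p| < d%:C -> P z.
Proof.
split=> [/near_norm1CP[d d0 H]|[d d0 H]].
  exists (d / 2); first by rewrite divr_gt0.
  move=> z zp; rewrite -[z](subrK p) addrC; apply: H => j.
  have := @norm1C_lt_mx_norm _ _ (z - p) (d / 2) j.
  by rewrite (_ : 2 * (d / 2) = d); [apply; rewrite ?divr_gt0|lra].
apply/near_norm1CP; exists d => // v vd; apply: H.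
by rewrite [p + v]addrC addrK; apply: mx_norm_lt_norm1C.
Qed.

Lemma wdiff_near_lt (R : realType) (r : nat) (f : 'rV[R[i]]_r -> R[i]) p D
    (e : R) : wdiff f p D -> 0 < e -> \forall z \near p, norm1C (f z - f p) < e.
Proof.
(* A scalar function is viewed as a row of length 1 in order to apply [near_wdiff_comp]. *)
move=> Df e0; pose g z : 'rV[R[i]]_1 := const_mx (f z).
have Dg i : wdiff (fun z => g z 0 i) p D by under eq_fun do rewrite mxE.
have ne : \forall w \near g p, norm1C ((w : 'rV[R[i]]_1) 0 0 - f p) < e.
  apply/near_norm1CP; exists e => // v ve.
  by rewrite !mxE addrAC subrr add0r.
have := @near_wdiff_comp _ _ _ _ _ (fun=> D) _ Dg ne.
by apply: filterS => z; rewrite mxE.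
Qed.

(** Joint continuity in the point and the vector: for the second and third cones the vectors
    converge while their base points move. *)
Lemma push_cont (R : realType) (r : nat) (F : 'rV[R[i]]_r -> 'rV[R[i]]_r) p
    (v : 'rV[R[i]]_(r + r)) (e : R) : holomorphic_at F p -> 0 < e ->
  exists2 d : R, 0 < d & \forall z \near p, forall w : 'rV[R[i]]_(r + r),
    (forall s, norm1C ((w - v) 0 s) < d) ->
    forall s, norm1C ((w *m pmx F z - v *m pmx F p) 0 s) < e.
Proof.
move=> hF e0.
pose A := \sum_t \sum_s norm1C (pmx F p t s); pose V := \sum_s norm1C (v 0 s).
pose m : R := (r + r)%:R.
have A0 : 0 <= A.
  by apply: sumr_ge0 => t _; apply: sumr_ge0 => s _; exact: norm1C_ge0.
have V0 : 0 <= V by apply: sumr_ge0 => s _; exact: norm1C_ge0.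
have gA t s : norm1C (pmx F p t s) <= A.
  apply: (@le_trans _ _ (\sum_s' norm1C (pmx F p t s'))).
    by rewrite (bigD1 s) //= lerDl sumr_ge0 // => s' _; exact: norm1C_ge0.
  rewrite /A [leRHS](bigD1 t) //= lerDl sumr_ge0 // => t' _;
    apply: sumr_ge0 => s' _.
  exact: norm1C_ge0.
have vV t : norm1C (v 0 t) <= V.
  by rewrite /V (bigD1 t) //= lerDl sumr_ge0 // => s' _; exact: norm1C_ge0.
have m0 : 0 <= m by rewrite ler0n.
(* Each of the m summands is at most d * (A + 1) + V * d, where d <= 1 bounds the entries of the
   differential at z by A + 1. Using m + 1 in place of m makes the final inequality strict. *)
pose d := Num.min 1 (e / ((m + 1) * (A + V + 1))).
have den : 0 < (m + 1) * (A + V + 1) by rewrite mulr_gt0 //; lra.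
have d0 : 0 < d by rewrite lt_min ltr01 divr_gt0.
have d1 : d <= 1 by rewrite ge_min lexx.
have de : d * ((m + 1) * (A + V + 1)) <= e.
  by rewrite -ler_pdivlMr // ge_min lexx orbT.
exists d => //.
have nd : \forall z \near p, forall t s, norm1C (pmx F z t s - pmx F p t s) < d.
  apply: (@filter_forall _ _ (fun t z => forall s,
    norm1C (pmx F z t s - pmx F p t s) < d) (nbhs p) _) => t.
  apply: (@filter_forall _ _ (fun s z =>
    norm1C (pmx F z t s - pmx F p t s) < d) (nbhs p) _) => s.
  exact: wdiff_near_lt (cplx_analytic_wdiff (pmx_cplx_analytic t s hF)) d0.
apply: filterS nd => z zd w wd s.
have -> : (w *m pmx F z - v *m pmx F p) 0 s =
    \sum_t ((w - v) 0 t * pmx F z t s + v 0 t * (pmx F z t s - pmx F p t s)).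
  rewrite [LHS]mxE [X in _ + X]mxE [X in X - _]mxE [X in _ - X]mxE -sumrB.
  have wv t : (w - v) 0 t = w 0 t - v 0 t by rewrite !mxE.
  by apply: eq_bigr => t _; rewrite wv mulrBl mulrBr addrA subrK.
apply: (@le_lt_trans _ _ (\sum_(t < r + r) d * (A + V + 1))).
  apply: le_trans (norm1C_sum _ _ _) _; apply: ler_sum => t _.
  apply: le_trans (norm1CD _ _) _.
  have H1 : norm1C ((w - v) 0 t * pmx F z t s) <= d * (A + 1).
    apply: le_trans (norm1CM _ _) _.
    apply: (ler_pM (norm1C_ge0 _) (norm1C_ge0 _) (ltW (wd t))).
    rewrite -[pmx F z t s](subrK (pmx F p t s));
      apply: le_trans (norm1CD _ _) _.
    by rewrite addrC; apply: (lerD (gA t s) (le_trans (ltW (zd t s)) d1)).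
  have H2 : norm1C (v 0 t * (pmx F z t s - pmx F p t s)) <= V * d.
    apply: le_trans (norm1CM _ _) _.
    exact: ler_pM (norm1C_ge0 _) (norm1C_ge0 _) (vV t) (ltW (zd t s)).
  have -> : d * (A + V + 1) = d * (A + 1) + V * d by ring.
  exact: lerD.
rewrite sumr_const card_ord -mulr_natl -/m.
apply: lt_le_trans de; rewrite mulrCA ltr_pM2l //.
by rewrite ltr_pM2r //; lra.
Qed.

Lemma cone_push (R : realType) (r n k : nat)
    (F G : 'rV[R[i]]_r -> 'rV[R[i]]_r) O O' M M' p j nu v :
  biholo F G O O' M M' -> O p -> D_sing n k M j nu p v ->
  D_sing n k M' j nu (F p) (v *m pmx F p).
Proof.
move=> H Op; have hF := biholo_holoF H Op;
  have hG := biholo_holoG H (biholo_to H Op).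
have nO := biholo_near H Op.
have nO' := biholo_near (biholo_sym H) (biholo_to H Op).
have pull (P : 'rV[R[i]]_r -> Prop) : (\forall z \near p, P z) ->
    \forall w \near F p, O' w /\ P (G w).
  by rewrite -{1}(biholo_FK H Op) => /(near_holo_comp hG); apply: filterI.
case: j; rewrite /D_sing /=.
- move=> [U [V [[oU Up] aV DV Vp]]].
  have nU := pull U (open_nbhs_nbhs (conj oU Up)).
  (* The definition of the first cone asks for an open neighbourhood; taking the interior avoids
     proving that this preimage is open. *)
  exists (interior [set w | O' w /\ U (G w)]), (push_field F G V); split.
  + by split; [exact: open_interior|exact: nU].
  + move=> w /interior_subset[ Ow Uw]; rewrite -[w](biholo_GK H Ow).
    exact: push_field_analytic H (biholo_from H Ow) (aV _ Uw).
  + move=> w Rw /interior_subset[ Ow Uw].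
    have := reg_push (biholo_sym H) Ow Rw => RGw.
    have := D_reg_push H (biholo_from H Ow) (DV _ RGw Uw).
    by rewrite (biholo_GK H Ow).
  by rewrite /push_field (biholo_FK H Op) Vp.
- move=> Hv eps eps0; have [d d0 nd] := push_cont v hF eps0.
  (* Halved because [norm1C] may be twice the modulus in which the second cone is stated. *)
  have d20 : 0 < d / 2 by rewrite divr_gt0.
  have [del del0 Hdel] := Hv _ d20.
  have ndel : \forall z \near p, `|z - p| < del%:C by apply/near_normP;
    exists del.
  have [del' del'0 H'] := (near_normP _ _).1 (pull _ (filterI nd ndel)).
  exists del' => // w Rw /H'[ Ow [Hd Hdel']].
  have [v1 Dv1 v1v] := Hdel _ (reg_push (biholo_sym H) Ow Rw) Hdel'.
  exists (v1 *m pmx F (G w)).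
    by have := D_reg_push H (biholo_from H Ow) Dv1; rewrite (biholo_GK H Ow).
  apply: mx_norm_lt_norm1C => //; apply: Hd => s.
  have := @norm1C_lt_mx_norm _ _ (v1 - v) (d / 2) s d20 v1v.
  by rewrite (_ : 2 * (d / 2) = d) //; lra.
move=> [z_ [v_ [RD zp vv]]].
have [N _ HN] := zp _ nO.
(* The third cone requires every term of the sequence to be regular, so the terms before N, which
   may lie outside O, are discarded. *)
exists (fun i => F (z_ (i + N)%N)), (fun i =>
  v_ (i + N)%N *m pmx F (z_ (i + N)%N)).
have ON i : O (z_ (i + N)%N) by apply: HN; rewrite /= leq_addl.
split.
- move=> i; have [Rz Dv] := RD (i + N)%N; split;
  first exact: reg_push H (ON i) Rz.
  exact: D_reg_push H (ON i) Dv.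
- move=> A /(near_holo_comp hF) /zp [N0 _ H0].
  by exists N0 => // i /= iN; apply: H0 => /=; apply: leq_trans (leq_addr _ _).
move=> A /near_norm1CP[e e0 He]; have [d d0 nd] := push_cont v hF e0.
have [N0 _ H0] := zp _ nd.
have nv : \forall w \near v, forall s, norm1C (((w : 'rV[R[i]]_(r + r)) - v) 0
  s) < d.
  by apply/near_norm1CP; exists d => // w wd s; rewrite [v + w]addrC addrK.
have [N1 _ H1] := vv _ nv.
exists (maxn N0 N1) => // i /=; rewrite geq_max => /andP[iN0 iN1].
rewrite /= -[_ *m _](subrK (v *m pmx F p)) addrC; apply: He.
apply: H0 => /=; first exact: leq_trans (leq_addr _ _).
by apply: H1 => /=; apply: leq_trans (leq_addr _ _).
Qed.

(** * Spans, chains and invariance of the type *)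

Lemma lin_span_mulmx (K : fieldType) (m : nat) (A B : set 'rV[K]_m)
    (P : 'M[K]_m) v :
  (forall w, A w -> B (w *m P)) -> lin_span A v -> lin_span B (v *m P).
Proof.
move=> AB [X XA vX]; pose f : 'Hom('rV[K]_m, 'rV[K]_m) := linfun (mulmxr P).
exists (map f X).
  by move=> _ /mapP[w /XA /AB Bw ->]; rewrite lfunE.
by rewrite -limg_span (_ : v *m P = f v) ?memv_img // lfunE.
Qed.

Lemma chain_push (R : realType) (r n k : nat)
    (F G : 'rV[R[i]]_r -> 'rV[R[i]]_r) O O' M M' p j q nu v :
  biholo F G O O' M M' -> O p -> chain n k M j q nu p v ->
  chain n k M' j q nu (F p) (v *m pmx F p).
Proof.
move=> H Op.
have span w : lin_span (D_sing n k M j nu p) w ->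
    lin_span (D_sing n k M' j nu (F p)) (w *m pmx F p).
  by apply: lin_span_mulmx => u; apply: cone_push H Op.
case: q => /=; first exact: span.
by move=> [sv Tv]; split; [exact: span|exact: Tc_sum_push H Op Tv].
Qed.

Lemma ambient_push (R : realType) (r : nat)
    (F G : 'rV[R[i]]_r -> 'rV[R[i]]_r) O O' M M' p q v :
  biholo F G O O' M M' -> O p -> ambient_space M q p v ->
  ambient_space M' q (F p) (v *m pmx F p).
Proof. by case: q => H Op; [exact: CT_push H Op|exact: Tc_sum_push H Op]. Qed.

Lemma chain_union_push (R : realType) (r n k : nat)
    (F G : 'rV[R[i]]_r -> 'rV[R[i]]_r) O O' M M' p j q v :
  biholo F G O O' M M' -> O p -> chain_union n k M j q p v ->
  chain_union n k M' j q (F p) (v *m pmx F p).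
Proof. by move=> H Op [nu nu1 Cv]; exists nu => //;
  apply: chain_push H Op Cv. Qed.

(** Serves the case distinction between finite and infinite type, which compares two sets and not
    their dimensions. *)
Lemma set_eq_mulmx (K : fieldType) (m : nat) (A B A' B' : set 'rV[K]_m)
    (P Q : 'M[K]_m) : Q *m P = 1%:M ->
  (forall v, A v -> A' (v *m P)) -> (forall v, A' v -> A (v *m Q)) ->
  (forall v, B v -> B' (v *m P)) -> (forall v, B' v -> B (v *m Q)) ->
  A = B -> A' = B'.
Proof.
move=> QP AA' A'A BB' B'B AB; apply/seteqP; split=> v.
  by move=> /A'A; rewrite AB => /BB'; rewrite -mulmxA QP mulmx1.
by move=> /B'B; rewrite -AB => /AA'; rewrite -mulmxA QP mulmx1.
Qed.

Lemma sing_invariant (R : realType) (r n k : nat)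
    (F G : 'rV[R[i]]_r -> 'rV[R[i]]_r) O O' M M' p j q :
  biholo F G O O' M M' -> O p ->
  sing_type n k M j q p = sing_type n k M' j q (F p) /\
  sing_defect n k M j q p = sing_defect n k M' j q (F p).
Proof.
move=> H Op; have H' := biholo_sym H; have O'p := biholo_to H Op.
have PQ := pmxK H Op; have QP := mulmx1C PQ.
(* Pushing forward by G lands at the point G (F p), which has to be replaced by p. *)
have back (A : 'rV[R[i]]_r -> set 'rV[R[i]]_(r + r)) v :
    A (G (F p)) v -> A p v by rewrite (biholo_FK H Op).
have dimC nu : cdim (chain n k M j q nu p) = cdim (chain n k M' j q nu (F p)).
  apply: (cdim_mulmx PQ) => v; first exact: chain_push H Op.
  by move=> /(chain_push H' O'p) /(back (chain n k M j q nu)).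
have A2 v : ambient_space M' q (F p) v -> ambient_space M q p (v *m pmx G (F
  p)).
  by move=> /(ambient_push H' O'p) /(back (ambient_space M q)).
have U2 v : chain_union n k M' j q (F p) v ->
    chain_union n k M j q p (v *m pmx G (F p)).
  by move=> /(chain_union_push H' O'p) /(back (chain_union n k M j q)).
have A1 v := @ambient_push _ _ _ _ _ _ _ _ p q v H Op.
have U1 v := @chain_union_push _ _ n k _ _ _ _ _ _ p j q v H Op.
have defE : sing_defect n k M j q p = sing_defect n k M' j q (F p).
  by rewrite /sing_defect (cdim_mulmx PQ A1 A2) (cdim_mulmx PQ U1 U2).
split=> //; rewrite /sing_type defE.
have -> : (fun nu => cdim (chain n k M j q nu p)) =
    (fun nu => cdim (chain n k M' j q nu (F p))) by apply/funext.
have -> // : `[< chain_union n k M j q p = ambient_space M q p >] =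
  `[< chain_union n k M' j q (F p) = ambient_space M' q (F p) >].
apply: asbool_equiv_eq; split.
  exact: set_eq_mulmx QP U1 U2 A1 A2.
exact: set_eq_mulmx PQ U2 U1 A2 A1.
Qed.

Lemma biholo_of_germ_onto (R : realType) (r : nat)
    (F : 'rV[R[i]]_r -> 'rV[R[i]]_r) (W W' M M' : set 'rV[R[i]]_r) p :
  biholomorphic W W' F -> germ_onto F W M M' p ->
  exists (G : 'rV[R[i]]_r -> 'rV[R[i]]_r) (O O' : set 'rV[R[i]]_r),
    O p /\ biholo F G O O' M M'.
Proof.
move=> [oW oW' [WW' Finj Fsurj] hF [G [GF hG]]] [ O [[oO Op] OW FM]].
exists G, O, (F @` O); split=> //.
have FG w : W' w -> F (G w) = w by move=> /Fsurj[z Wz <-]; rewrite GF.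
split=> //.
- rewrite openE => _ [z Oz <-]; have Wz := OW z Oz.
  have nW' : \forall w \near F z, W' w.
    by apply: open_nbhs_nbhs; split=> //; apply: WW'.
  have nO : \forall w \near F z, O (G w).
    by apply: near_holo_comp (hG _ (WW' _ Wz)) _; rewrite (GF _ Wz);
      apply: open_nbhs_nbhs.
  by apply: filterS (filterI nW' nO) => w [W'w OGw]; exists (G w) => //;
    rewrite FG.
- by move=> _ [z Oz <-]; rewrite GF //; apply: OW.
- by move=> z /OW; apply: GF.
- by move=> _ [z /OW Wz <-]; apply: FG; apply: WW'.
- by move=> z /OW; apply: hF.
- by move=> _ [z /OW Wz <-]; apply: hG; apply: WW'.
move=> z Oz; split=> [Mz|M'z].
  have : (F @` (M `&` O)) (F z) by exists z.
  by rewrite FM => -[].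
(* The germ condition only yields some y of M in O with the same image as z; injectivity of F on W
   identifies y with z. *)
have : (M' `&` F @` O) (F z) by split=> //; exists z.
rewrite -FM => -[y [My Oy]] /Finj; rewrite !inE => E.
by rewrite -E //; exact: OW.
Qed.

Theorem theorem3 (R : realType) (r n k n' k' : nat)
    (M M' W W' : set 'rV[R[i]]_r) (p p' : 'rV[R[i]]_r)
    (F : 'rV[R[i]]_r -> 'rV[R[i]]_r) :
  CR_regular_sing_germ n k M p ->
  CR_regular_sing_germ n' k' M' p' ->
  biholomorphic W W' F ->
  W p -> F p = p' ->
  germ_onto F W M M' p ->
  forall j : cone_kind,
    (sing_type n k M j Kind1 p, sing_type n k M j Kind2 p) =
      (sing_type n' k' M' j Kind1 p', sing_type n' k' M' j Kind2 p') /\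
    (sing_defect n k M j Kind1 p, sing_defect n k M j Kind2 p) =
      (sing_defect n' k' M' j Kind1 p', sing_defect n' k' M' j Kind2 p').
Proof.
move=> [[rnk _ dM] [Mp _] _ _] [[rnk' _ dM'] _ _ _] bF _ <- gF j.
have [G [ O [ O' [ Op H]]]] := biholo_of_germ_onto bF gF.
have nn := regular_dim_unique H Op Mp dM dM'.
(* The codimension follows from r = n + k. Equality of both numbers is needed since [reg] depends on
   them and the jump at index 1 is measured from 2 * n. *)
have kk : k = k' by apply/eqP; rewrite -(eqn_add2l n) -rnk rnk' nn.
have [T1 D1] := sing_invariant n k j Kind1 H Op.
have [T2 D2] := sing_invariant n k j Kind2 H Op.
move: T1 T2 D1 D2; rewrite nn kk => T1 T2 D1 D2.
by split; [exact: (f_equal2 pair T1 T2)|exact: (f_equal2 pair D1 D2)].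
Qed.
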